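(* Let $\beta>0$, and let $\mu$ be a deterministic probability measure on $\mathbb{C}$ with at least polynomially decaying tail, i.e. there exists $c>0$ with $$\sup_{R\ge1}R^c\,\mu(\{z\in\mathbb{C}:|z|>R\})<\infty.$$ For each $n\ge2$ let $(Z^{(n,0)}_k)_{1\le k\le n}$ be i.i.d. random variables with distribution $\mu$, let $m(n)$ be an integer with $1\le m(n)\le n-1$, and let $(Z^{(n,j)}_k)_{1\le k\le n-j}$, $1\le j\le m(n)$, be the zeros of the iterated randomized derivatives with parameter $\beta$, with empirical measures $\mu_{n,j}=\frac1{n-j}\sum_{k=1}^{n-j}\delta_{Z^{(n,j)}_k}$ (as defined in the context). If $$\frac{m(n)}{n/\log n}\underset{n\to\infty}{\longrightarrow}0,$$ then $(\mu_{n,m(n)})_{n\ge2}$ converges almost surely to $\mu$.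
   Context: All random variables are defined on one probability space. The Gamma distribution of parameter $\beta/2$ has density $\frac{1}{\Gamma(\beta/2)}t^{\beta/2-1}e^{-t}$ on $(0,\infty)$. Iterated randomized derivatives: for each $n\ge2$, let $(\gamma^{(n,j)}_k)_{1\le j\le m(n),\,1\le k\le n+1-j}$ be i.i.d. Gamma random variables of parameter $\beta/2$, independent of $(Z^{(n,0)}_k)_{1\le k\le n}$. Inductively for $1\le j\le m(n)$, $(Z^{(n,j)}_k)_{1\le k\le n-j}$ are the zeros, counted with multiplicity, of the polynomial $$z\mapsto\sum_{k=1}^{n+1-j}\gamma^{(n,j)}_k\prod_{1\le\ell\le n+1-j,\ \ell\ne k}(z-Z^{(n,j-1)}_\ell),$$ which almost surely has degree $n-j$. The zeros are labelled in some measurable way depending only on $(Z^{(n,j-1)}_\ell)_\ell$ and $(\gamma^{(n,j)}_k)_k$, so that $(\gamma^{(n,j)}_k)_{1\le k\le n+1-j}$ is independent of $(Z^{(n,j-1)}_\ell)_{1\le\ell\le n+1-j}$. Almost sure convergence of random probability measures means that, almost surely, the sequence converges weakly (tested against bounded continuous functions on $\mathbb{C}$). *)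

(* Defs.v *)
From HB Require Import structures.
From mathcomp Require Import all_boot all_order all_algebra.
From mathcomp Require Import finmap.
From mathcomp Require Import all_classical all_reals all_analysis.
From mathcomp Require Import complex.

Set Implicit Arguments.
Unset Strict Implicit.
Unset Printing Implicit Defensive.

Import Order.TTheory GRing.Theory Num.Theory.
Import numFieldNormedType.Exports.

Local Open Scope classical_set_scope.
Local Open Scope ring_scope.
Local Open Scope complex_scope.

(* The complex plane [R[i]] carries the topology of its modulus, and the Borel
   sigma-algebra of that topology. *)
HB.instance Definition _ (R : realType) := NormedModule.copy R[i] (R[i])^o.

HB.instance Definition _ (R : realType) :=
  @isMeasurable.Build (sigma_display (@open R[i])) R[i] <<s @open R[i] >>
    (@sigma_algebra0 _ setT (@open R[i])) (@sigma_algebraC _ (@open R[i]))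
    (@sigma_algebra_bigcup _ setT (@open R[i])).

Section independence.
Context d d1 d2 (T : measurableType d) (T1 : measurableType d1)
  (T2 : measurableType d2) (R : realType) (P : probability T R).

Definition mutually_independent (I : choiceType) (D : set I)
    (X : I -> T -> T1) : Prop :=
  forall (J : {fset I}) (A : I -> set T1),
    [set` J] `<=` D -> (forall i, measurable (A i)) ->
    P (\bigcap_(i in [set` J]) X i @^-1` A i) =
      (\prod_(i <- J) P (X i @^-1` A i))%E.

Definition sigma_generated_by d' (T' : measurableType d') (I : Type)
    (D : set I) (X : I -> T -> T') : set (set T) :=
  <<s \bigcup_(i in D) preimage_set_system setT (X i) measurable >>.

Definition independent_families (I1 I2 : Type) (D1 : set I1) (D2 : set I2)
    (X : I1 -> T -> T1) (Y : I2 -> T -> T2) : Prop :=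
  forall A B : set T, sigma_generated_by D1 X A -> sigma_generated_by D2 Y B ->
    P (A `&` B) = (P A * P B)%E.

End independence.

Section gamma_distribution.
Context (R : realType).

Definition Gamma_fun (a : R) : R :=
  \int[lebesgue_measure]_(t in `]0, +oo[) (t `^ (a - 1) * expR (- t)).

Definition gamma_pdf (a : R) : R -> R :=
  (fun t => (Gamma_fun a)^-1 * t `^ (a - 1) * expR (- t)) \_ `]0, +oo[.

Definition has_gamma_law d (T : measurableType d) (P : probability T R)
    (a : R) (X : T -> R) : Prop :=
  forall A : set R, measurable A ->
    P (X @^-1` A) = (\int[lebesgue_measure]_(t in A) (gamma_pdf a t)%:E)%E.

End gamma_distribution.

Section zeros.
Context (R : realType).

Definition randomized_derivative n (z : n.-tuple R[i]) (g : n.-tuple R) :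
    {poly R[i]} :=
  \sum_(k < n) (tnth g k)%:C *:
    \prod_(l < n | l != k) ('X - (tnth z l)%:P).

(* [mup a 0] is a junk value, so nonvanishing of [p] is required separately. *)
Definition zeros_with_multiplicity (p : {poly R[i]}) (z : seq R[i]) : Prop :=
  p != 0 /\ forall a, mup a p = count_mem a z.

(* For [z] empty this is the zero measure. *)
Definition empirical_measure (z : seq R[i]) : {measure set R[i] -> \bar R} :=
  mscale ((size z)%:R^-1)%:nng (msum (fun k => \d_(nth 0 z k)) (size z)).

Definition weakly_converges (nu : nat -> {measure set R[i] -> \bar R})
    (mu : {measure set R[i] -> \bar R}) : Prop :=
  forall f : R[i] -> R, continuous f ->
    (exists M : R, forall z, `|f z| <= M) ->
    (fun n => \int[nu n]_z f z) @ \oo --> \int[mu]_z f z.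

End zeros.

(* Main.v *)
Require Import Defs.
From HB Require Import structures.
From mathcomp Require Import all_boot all_order all_algebra.
From mathcomp Require Import finmap.
From mathcomp Require Import all_classical all_reals all_analysis.
From mathcomp Require Import measurable_realfun complex.
From mathcomp Require Import ring lra zify.

Set Implicit Arguments.
Unset Strict Implicit.
Unset Printing Implicit Defensive.

Import Order.TTheory GRing.Theory Num.Theory.
Import numFieldNormedType.Exports.
Import ComplexField.Normc.

Local Open Scope classical_set_scope.
Local Open Scope ring_scope.
Local Open Scope complex_scope.

(** Write [log_max r w] for [ln (max r |w|)]. By Jensen's formula, the mean of [ln |P|] over
    the circle of centre [a] and radius [r], for a monic polynomial [P], is the sum of
    [log_max r (Z - a)] over the zeros [Z] of [P]. Hence the difference between the radii
    [2 r] and [r] is, up to the factor [ln 2], the sum over the zeros of a bump function: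
    1 on the disc of radius [r], 0 off the disc of radius [2 r], decreasing in between.
    These bumps determine weak convergence ([bounded_continuous_cvg]), so it is enough to
    show that the means of each bump over the initial zeros and over the final zeros have
    the same limit, and to apply the law of large numbers to the initial zeros.

    Let [P_j] be the monic polynomial of the [j]-th zeros. At a point [z], the quotient of
    the randomized derivative by [P_j] is [Q = \sum_k g_k / (z - Z_k)]. If [|ln |Q||] is
    [O(ln n)] at the points of the circle that are used, each of the [m n] steps changes
    [ln |P_j (z)|] by [O(ln n)], and the total change, divided by [n], is [O(m n ln n / n)],
    which tends to 0 by hypothesis. The two bounds on [Q] have different origins.
    - [|Q|] is at most a power of [n] if [z] is at a distance at least a negative power of
      [n] from the zeros. To have this at all times, the circle is replaced by the [n]-th
      roots [z] of one of [2 n^2 + 1] separated points [u] of the unit circle, moved to the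
      circle at hand: each zero spoils a bounded number of [u], so that some [u] is good
      ([exists_good_angle]). The Jensen formula is then the factorisation
      [X^n - u = \prod (X - z)], with an error controlled by the same separation
      ([circle_log_average]). This yields the deterministic [log_max_sum_comparison].
    - [|Q|] is at least a negative power of [n] at all points of all these root sets, with
      a probability summably close to 1. Indeed, once everything but the first weight [g_0]
      is fixed, a small [|Q|] forces [g_0] into a short interval as long as the zeros are
      polynomially bounded; this interval is independent of [g_0], and the Gamma law gives
      short intervals a small mass ([gamma_law_window], [anti_concentration],
      [no_cancellation_on_grid]).

    The zeros are polynomially bounded because the initial ones are, by the tail hypothesis
    and the Borel-Cantelli lemma, and because a weighted Gauss-Lucas theorem keeps the later
    ones in the same disc ([gauss_lucas_disc]). The weights lie between 0 and [n] by the tail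
    of the Gamma law ([weights_bounded]), which controls the leading coefficients. *)

Local Notation Re := complex.Re.
Local Notation Im := complex.Im.

(** * Modulus, and separated points on a circle *)

Section modulus.
Context {R : realType}.
Implicit Types x y z : R[i].

Lemma normE z : `|z| = (normc z)%:C.
Proof. by rewrite normc_def; case: z. Qed.

Lemma normc_ge0 z : 0 <= normc z.
Proof. by case: z => a b; exact: sqrtr_ge0. Qed.

Lemma normc_eq0 z : (normc z == 0) = (z == 0).
Proof. by apply/eqP/eqP => [/eq0_normc//|->]; rewrite normc0. Qed.

Lemma normc_gt0 z : (0 < normc z) = (z != 0).
Proof. by rewrite lt_def normc_ge0 andbT normc_eq0. Qed.

Lemma normcD x y : normc (x + y) <= normc x + normc y.
Proof. exact: le_normcD. Qed.

Lemma normcNE x : normc (- x) = normc x.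
Proof. exact: normcN. Qed.

Lemma normcB x y : normc (x - y) = normc (y - x).
Proof. by rewrite -normcNE opprB. Qed.

Lemma normcB_ge x y : normc x - normc y <= normc (x - y).
Proof. by have := normcD (x - y) y; rewrite subrK lerBlDr. Qed.

Lemma normcX x n : normc (x ^+ n) = normc x ^+ n.
Proof.
by elim: n => [|n IH]; rewrite ?expr0 ?normc1// !exprS normcM IH.
Qed.

Lemma normc_real (r : R) : normc r%:C = `|r|.
Proof. by rewrite /= expr0n/= addr0 sqrtr_sqr. Qed.

Lemma normc_prod I (s : seq I) (Q : pred I) (F : I -> R[i]) :
  normc (\prod_(i <- s | Q i) F i) = \prod_(i <- s | Q i) normc (F i).
Proof. by elim/big_rec2: _ => [|i y1 y2 _ <-]; rewrite ?normc1// normcM. Qed.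

Lemma normc_sum I (s : seq I) (Q : pred I) (F : I -> R[i]) :
  normc (\sum_(i <- s | Q i) F i) <= \sum_(i <- s | Q i) normc (F i).
Proof.
elim/big_rec2: _ => [|i y1 y2 _ h]; first by rewrite normc0.
by apply: (le_trans (normcD _ _)); rewrite lerD2l.
Qed.

Lemma Re_le_normc z : `|Re z| <= normc z.
Proof. by have := normc_ge_Re z; rewrite normE lecR. Qed.

Lemma normc_sqr z : normc z ^+ 2 = Re z ^+ 2 + Im z ^+ 2.
Proof. by case: z => a b; rewrite sqr_sqrtr// addr_ge0// sqr_ge0. Qed.

Lemma normc_expB x y n (b : R) : normc x <= b -> normc y <= b -> 
  normc (x ^+ n - y ^+ n) <= n%:R * b ^+ n.-1 * normc (x - y).
Proof.
move=> xb yb; rewrite subrXX normcM mulrC ler_wpM2r ?normc_ge0//.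
apply: (le_trans (normc_sum _ _ _)).
have -> : n%:R * b ^+ n.-1 = \sum_(i < n) b ^+ n.-1.
  by rewrite sumr_const card_ord mulr_natl.
apply: ler_sum => -[i /= ilt] _.
rewrite normcM !normcX.
have -> : n.-1 = (n - i.+1 + i)%N by lia.
have b0 : 0 <= b := le_trans (normc_ge0 _) xb.
have le_exp k t : normc t <= b -> normc t ^+ k <= b ^+ k.
  by move=> tb; apply: lerXn2r; rewrite ?nnegrE ?normc_ge0.
by rewrite addnK exprD ler_pM ?exprn_ge0 ?normc_ge0 ?le_exp.
Qed.

End modulus.

Lemma pigeonhole_avoid (J T : finType) (Q : J -> T -> bool) :
  (forall j t t', Q j t -> Q j t' -> t = t') -> (#|J| < #|T|)%N ->
  exists t, forall j, ~~ Q j t.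
Proof.
move=> Quniq JT.
have [/existsP[t /forallP]|/existsPn noT] := boolP [exists t, forall j, ~~ Q j t].
  by exists t.
have ex t : {j | Q j t}.
  by apply: cid; move: (noT t); rewrite negb_forall => /existsP[j]; rewrite negbK => Qjt; exists j.
have inj : injective (fun t => sval (ex t)).
  move=> t t' /= tt'; apply: (Quniq (sval (ex t))); first exact: (svalP (ex t)).
  by rewrite tt'; exact: (svalP (ex t')).
by have := leq_card _ inj; rewrite leqNgt JT.
Qed.

Section circle_grid.
Context {R : realType}.
Implicit Types (x y z u : R[i]).

(** The rational parametrisation of the unit circle, which avoids trigonometry. *)
Definition circle_point (t : R) : R[i] :=
  ((1 - t ^+ 2) / (1 + t ^+ 2)) +i* ((2 * t) / (1 + t ^+ 2)).

Lemma normc_circle_point t : normc (circle_point t) = 1.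
Proof.
apply/eqP; rewrite -(eqrXn2 (n := 2)) ?normc_ge0// normc_sqr expr1n/=; apply/eqP.
have : 1 + t ^+ 2 != 0 by rewrite gt_eqF// ltr_wpDr// sqr_ge0.
by move=> h; field.
Qed.

(** The distance is [2 |s - t|] divided by the product of the two square roots of
    [1 + s^2] and [1 + t^2], each of which is at most the square root of 2 here. *)
Lemma circle_point_separated s t : 0 <= s <= 1 -> 0 <= t <= 1 ->
  `|s - t| <= normc (circle_point s - circle_point t).
Proof.
move=> /andP[s0 s1] /andP[t0 t1].
rewrite -(ler_pXn2r (n := 2))// ?nnegrE ?normc_ge0// normc_sqr/= real_normK ?num_real//.
have hs : 0 < 1 + s ^+ 2 by rewrite ltr_wpDr// sqr_ge0.
have ht : 0 < 1 + t ^+ 2 by rewrite ltr_wpDr// sqr_ge0.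
rewrite [leRHS](_ : _ = 4 * (s - t) ^+ 2 / ((1 + s ^+ 2) * (1 + t ^+ 2))); last first.
  by field; rewrite !gt_eqF.
rewrite ler_pdivlMr ?mulr_gt0// [leRHS]mulrC ler_wpM2l ?sqr_ge0//.
have s2 : s ^+ 2 <= 1 by rewrite expr_le1.
have t2 : t ^+ 2 <= 1 by rewrite expr_le1.
rewrite (_ : 4 = (1 + 1) * (1 + 1) :> R); last by ring.
by apply: ler_pM; rewrite ?lerD2l//; exact: ltW.
Qed.

Definition roots_of N u : seq R[i] :=
  sval (closed_field_poly_normal ('X^N - u%:P)).

Lemma roots_ofE N u : (0 < N)%N ->
  'X^N - u%:P = \prod_(z <- roots_of N u) ('X - z%:P).
Proof.
move=> N0; rewrite /roots_of; case: closed_field_poly_normal => s /= {1}->.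
by rewrite lead_coefDl ?lead_coefXn ?scale1r// size_polyN size_polyXn size_polyC; case: eqP => //=; lia.
Qed.

Lemma size_roots_of N u : (0 < N)%N -> size (roots_of N u) = N.
Proof.
move=> N0; have := congr1 (fun p => size (polyseq p)) (roots_ofE u N0).
rewrite size_prod_XsubC size_polyDl ?size_polyXn; first by case.
by rewrite size_polyN size_polyC; case: eqP => //=; lia.
Qed.

Lemma roots_ofP N u z : (0 < N)%N -> z \in roots_of N u -> z ^+ N = u.
Proof.
move=> N0; rewrite -root_prod_XsubC -roots_ofE// => /rootP.
by rewrite !hornerE => /eqP; rewrite subr_eq0 => /eqP.
Qed.

Lemma normc_roots_of N u z : (0 < N)%N -> normc u = 1 -> z \in roots_of N u -> normc z = 1.
Proof.
move=> N0 u1 /(roots_ofP N0) zu; apply/eqP.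
by rewrite -(eqrXn2 (n := N)) ?normc_ge0// -normcX zu u1 expr1n.
Qed.

Lemma prod_roots_of N u x : (0 < N)%N ->
  \prod_(z <- roots_of N u) normc (x - z) = normc (x ^+ N - u).
Proof.
move=> N0; have := congr1 (fun p => p.[x]) (roots_ofE u N0).
rewrite horner_prod !hornerE => ->; rewrite normc_prod.
by apply: eq_bigr => z _; rewrite !hornerE.
Qed.

End circle_grid.

(** * Circle averages of logarithms and one step of derivation *)

Section ln_bigop.
Context {R : realType}.

Lemma ln_prod I (s : seq I) (F : I -> R) : (forall i, 0 < F i) ->
  ln (\prod_(i <- s) F i) = \sum_(i <- s) ln (F i).
Proof.
move=> F0; elim: s => [|i s IH]; first by rewrite !big_nil ln1.
by rewrite !big_cons lnM ?posrE// ?IH//; apply: prodr_gt0.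
Qed.

Lemma ler_ln_le (x y : R) : 0 < x -> x <= y -> ln x <= ln y.
Proof. by move=> x0 xy; rewrite ler_ln ?posrE// (lt_le_trans x0). Qed.

End ln_bigop.

Section circle_average.
Context {R : realType}.
Implicit Types (u y Z a : R[i]) (r d : R).

Definition log_max r (w : R[i]) : R := ln (Num.max r (normc w)).

(** If [|y| <= 2] the maximum lies between 1 and 2, and [|y - u|] between [d] and 3;
    otherwise [|y - u|] lies between [|y| / 2] and [2 |y|]. *)
Lemma normc_sub_unit u y d : normc u = 1 -> 0 < d -> d <= 1 -> d <= normc (y - u) ->
  Num.max 1 (normc y) * (d / 2) <= normc (y - u) <= Num.max 1 (normc y) * (2 / d).
Proof.
move=> u1 d0 d1 dy; apply/andP; split.
  have [y2|y2] := leP (normc y) 2.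
    apply: (le_trans _ dy); rewrite mulrA ler_pdivrMr// mulrC ler_pM2l//.
    by rewrite ge_max y2 ler1n.
  rewrite max_r; last by rewrite (le_trans _ (ltW y2))// ler1n.
  have := normcB_ge y u; rewrite u1; apply: le_trans.
  have : normc y * d <= normc y by rewrite ler_piMr ?normc_ge0.
  lra.
have h : normc (y - u) <= Num.max 1 (normc y) * 2.
  apply: (le_trans (normcD _ _)); rewrite normcNE u1 mulr_natr mulr2n addrC.
  by rewrite lerD// le_max lexx ?orbT.
apply: (le_trans h); rewrite ler_wpM2l ?le_max ?ler01// ler_pdivlMr//.
by rewrite ler_piMr.
Qed.

(** A discrete Jensen formula. With [x = (Z - a) / r] the product of the distances from [x]
    to the roots is exactly [|x^N - u|], and [|x^N - u|] is comparable to [max 1 |x|^N] if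
    [x^N] stays away from [u]. *)
Lemma circle_log_average N a r u Z d : (0 < N)%N -> 0 < r -> normc u = 1 ->
  0 < d -> d <= 1 -> d <= normc (((Z - a) / r%:C) ^+ N - u) ->
  (forall z, z \in roots_of N u -> 0 < normc (a + r%:C * z - Z)) ->
  `|\sum_(z <- roots_of N u) ln (normc (a + r%:C * z - Z)) - N%:R * log_max r (Z - a)|
     <= ln (2 / d).
Proof.
move=> N0 r0 u1 d0 d1 dy far.
set x := (Z - a) / r%:C.
have rC0 : r%:C != 0 by rewrite (inj_eq (@complexI R)) gt_eqF.
have rn : normc r%:C = r by rewrite normc_real gtr0_norm.
have xE z : normc (a + r%:C * z - Z) = r * normc (x - z).
  transitivity (normc r%:C * normc (x - z)); last by rewrite rn.
  rewrite -normcM -normcNE; congr (normc _).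
  by rewrite /x mulrBr mulrCA divff// mulr1; ring.
have maxE : Num.max r (normc (Z - a)) = r * Num.max 1 (normc x).
  rewrite maxr_pMr ?ltW// mulr1; congr (Num.max _ _).
  by rewrite -[in RHS]rn -normcM /x mulrCA divff// mulr1.
have yX : normc (x ^+ N) = normc x ^+ N by rewrite normcX.
have maxX : Num.max 1 (normc (x ^+ N)) = Num.max 1 (normc x) ^+ N.
  rewrite yX; have [x1|x1] := leP 1 (normc x).
    by rewrite max_r// exprn_ege1.
  by rewrite expr1n max_l// exprn_ile1 ?normc_ge0 ?ltW.
have -> : \sum_(z <- roots_of N u) ln (normc (a + r%:C * z - Z)) =
    N%:R * ln r + ln (normc (x ^+ N - u)).
  rewrite -prod_roots_of//.
  have far' z : z \in roots_of N u -> 0 < normc (x - z).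
    by move/far; rewrite xE pmulr_rgt0.
  rewrite -[in N%:R](size_roots_of u N0).
  elim: (roots_of N u) far' => [|z s IH] far'.
    by rewrite !big_nil mul0r ln1 addr0.
  rewrite !big_cons IH; last by move=> t ts; apply: far'; rewrite inE ts orbT.
  have z0 : 0 < normc (x - z) by apply: far'; rewrite inE eqxx.
  rewrite xE !lnM ?posrE//; last first.
    rewrite big_seq; apply: prodr_gt0 => t ts; apply: far'.
    by rewrite inE ts orbT.
  by rewrite /= -natr1; ring.
have m0 : 0 < Num.max 1 (normc x) by rewrite lt_max ltr01.
rewrite /log_max maxE lnM ?posrE// mulrDr opprD addrACA subrr add0r.
have -> : N%:R * ln (Num.max 1 (normc x)) = ln (Num.max 1 (normc (x ^+ N))).
  by rewrite maxX lnXn// mulr_natl.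
have /andP[lo hi] := normc_sub_unit u1 d0 d1 dy.
set m := Num.max 1 _ in lo hi *.
have mp : 0 < m by rewrite lt_max ltr01.
have yu0 : 0 < normc (x ^+ N - u) by exact: lt_le_trans dy.
have d20 : 0 < 2 / d by rewrite divr_gt0.
rewrite ler_norml; apply/andP; split; last first.
  by rewrite lerBlDr -lnM ?posrE// mulrC ler_ln_le.
rewrite lerBrDr addrC -ln_div ?posrE// ler_ln_le ?divr_gt0//.
by apply: le_trans lo; rewrite invf_div.
Qed.

End circle_average.

Section derivative_step.
Context {R : realType}.

(** Algebraic closedness: the multiplicities determine a polynomial up to its leading
    coefficient. *)
Lemma zeros_with_multiplicityP (p : {poly R[i]}) s :
  zeros_with_multiplicity p s -> p = lead_coef p *: \prod_(z <- s) ('X - z%:P).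
Proof.
move=> [p0 mups].
have [t pE] := closed_field_poly_normal p; rewrite {1}pE; congr (_ *: _).
apply: perm_big; apply/allP => x _ /=; apply/eqP.
rewrite -mups [in RHS]pE -mul_polyC mupMr ?mu_prod_XsubC//.
by rewrite /root hornerC lead_coef_eq0.
Qed.

Lemma lead_coef_randomized_derivative n (z : n.-tuple R[i]) (g : n.-tuple R) :
  0 < \sum_(k < n) tnth g k ->
  lead_coef (randomized_derivative z g) = (\sum_(k < n) tnth g k)%:C.
Proof.
case: n z g => [|n] z g G0; first by rewrite big_ord0 ltxx in G0.
have szk (k : 'I_n.+1) : size (\prod_(l < n.+1 | l != k) ('X - (tnth z l)%:P)) = n.+1.
  rewrite -big_filter size_prod_XsubC; congr _.+1.
  by rewrite -sum1_size big_filter (sum1_card (predC1 k)) cardC1 card_ord.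
have cE : (randomized_derivative z g)`_n = (\sum_(k < n.+1) tnth g k)%:C.
  rewrite coef_sum raddf_sum; apply: eq_bigr => k _; rewrite coefZ.
  have mon : (\prod_(l < n.+1 | l != k) ('X - (tnth z l)%:P)) \is monic.
    exact: monic_prod_XsubC.
  by move/monicP: mon; rewrite lead_coefE szk /= => ->; rewrite mulr1.
have sz : (size (randomized_derivative z g) <= n.+1)%N.
  apply: (leq_trans (size_sum _ _ _)); apply/bigmax_leqP => k _.
  by apply: (leq_trans (size_scale_leq _ _)); rewrite szk.
rewrite lead_coefE (_ : size _ = n.+1) ?cE//.
apply/eqP; rewrite eqn_leq sz ltnNge; apply/negP => /leq_sizeP/(_ n (leqnn n)).
by rewrite cE => /eqP; rewrite (inj_eq (@complexI R)) gt_eqF.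
Qed.

(** This turns bounds on the randomized derivative into bounds on the monic polynomial of
    the next zeros; the sum of the weights is its leading coefficient. *)
Lemma normc_randomized_derivative n n' (z : n.-tuple R[i]) (g : n.-tuple R)
    (z' : n'.-tuple R[i]) t :
  0 < \sum_(k < n) tnth g k -> zeros_with_multiplicity (randomized_derivative z g) z' ->
  normc (randomized_derivative z g).[t] =
    (\sum_(k < n) tnth g k) * \prod_(k < n') normc (t - tnth z' k).
Proof.
move=> G0 /zeros_with_multiplicityP ->.
rewrite hornerZ normcM lead_coef_randomized_derivative// normc_real gtr0_norm//.
rewrite horner_prod normc_prod big_tuple; congr (_ * _).
by apply: eq_bigr => k _; rewrite !hornerE.
Qed.

Lemma randomized_derivativeE n (z : n.-tuple R[i]) (g : n.-tuple R) t :
  (forall k, t != tnth z k) ->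
  (randomized_derivative z g).[t] =
    (\prod_(k < n) (t - tnth z k)) * \sum_(k < n) (tnth g k)%:C / (t - tnth z k).
Proof.
move=> tz; rewrite horner_sum mulr_sumr; apply: eq_bigr => k _.
rewrite hornerZ horner_prod [\prod_(i < n) (t - _)](bigD1 k)//= mulrC.
have tk : t - tnth z k != 0 by rewrite subr_eq0.
under eq_bigr do rewrite !hornerE.
set p := \prod_(_ < _ | _) _; by rewrite mulrC; field; exact: tk.
Qed.

Lemma normc_randomized_derivative_le n (z : n.-tuple R[i]) (g : n.-tuple R) t d :
  0 < d -> (forall k, 0 <= tnth g k) -> (forall k, d <= normc (t - tnth z k)) ->
  normc (randomized_derivative z g).[t] <=
    (\sum_(k < n) tnth g k) / d * \prod_(k < n) normc (t - tnth z k).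
Proof.
move=> d0 g0 dz; rewrite randomized_derivativeE; last first.
  by move=> k; rewrite -subr_eq0 -normc_gt0 (lt_le_trans d0).
have p0 : 0 <= \prod_(k < n) normc (t - tnth z k) by apply: prodr_ge0 => k _; exact: normc_ge0.
rewrite normcM normc_prod mulrC ler_wpM2r//.
apply: (le_trans (normc_sum _ _ _)); rewrite mulr_suml; apply: ler_sum => k _.
rewrite normcM normcV normc_real ger0_norm// ler_wpM2l// lef_pV2 ?posrE//.
exact: lt_le_trans (dz k).
Qed.

(** The upper bound holds because every term [g_k / (t - z_k)] is at most [g_k / d] and
    the leading coefficient is the sum of the [g_k]; the lower bound is the absence of
    cancellation, quantified by [e]. *)
Lemma ln_potential_step n n' (z : n.-tuple R[i]) (g : n.-tuple R)
    (z' : n'.-tuple R[i]) t d e T B :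
  0 < d -> 0 < e -> (0 < n)%N ->
  (forall k, 0 < tnth g k <= T) ->
  (forall k, d <= normc (t - tnth z k)) -> (forall k, d <= normc (t - tnth z' k)) ->
  zeros_with_multiplicity (randomized_derivative z g) z' ->
  e * \prod_(k < n) normc (t - tnth z k) <= normc (randomized_derivative z g).[t] ->
  ln d^-1 <= B -> ln (n%:R * T / e) <= B ->
  `|\sum_(k < n') ln (normc (t - tnth z' k)) - \sum_(k < n) ln (normc (t - tnth z k))| <= B.
Proof.
move=> d0 e0 n0 gT dz dz' zz' lo dB TB.
pose G := \sum_(k < n) tnth g k.
have g0 k : 0 < tnth g k by case/andP: (gT k).
have G0 : 0 < G.
  rewrite /G (bigD1 (Ordinal n0))//= ltr_pwDl// sumr_ge0// => k _; exact: ltW.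
have T0 : 0 < T by case/andP: (gT (Ordinal n0)) => ?; exact: lt_le_trans.
have GT : G <= n%:R * T.
  rewrite /G -[n in n%:R]card_ord mulr_natl -sumr_const.
  by apply: ler_sum => k _; case/andP: (gT k).
have zp k : 0 < normc (t - tnth z k) by exact: lt_le_trans (dz k).
have zp' k : 0 < normc (t - tnth z' k) by exact: lt_le_trans (dz' k).
have hi := normc_randomized_derivative_le d0 (fun k => ltW (g0 k)) dz.
rewrite (normc_randomized_derivative t G0 zz') -/G in lo hi.
rewrite -!ln_prod//.
set p := \prod_(k < n) _ in lo hi *; set p' := \prod_(k < n') _ in lo hi *.
have p0 : 0 < p by apply: prodr_gt0.
have p0' : 0 < p' by apply: prodr_gt0.
rewrite ler_norml lerBlDr lerNl opprB lerBlDr; apply/andP; split.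
  apply: (@le_trans _ _ (ln (n%:R * T / e) + ln p')); last by rewrite lerD2r.
  have nT0 : 0 < n%:R * T / e by rewrite divr_gt0// mulr_gt0// ltr0n.
  rewrite -lnM ?posrE// ler_ln_le// mulrAC ler_pdivlMr// mulrC.
  by apply: (le_trans lo); rewrite ler_wpM2r// ltW.
apply: (@le_trans _ _ (ln d^-1 + ln p)); last by rewrite lerD2r.
rewrite -lnM ?posrE ?invr_gt0// ler_ln_le//.
by rewrite -(ler_pM2l G0) mulrA.
Qed.

End derivative_step.

(** * Logarithmic potentials along a chain of randomized derivatives *)

Section comparison.
Context {R : realType}.
Implicit Types (a u x : R[i]) (r : R).

Definition grid_size n := (2 * (n * n)).+1.

Definition grid_angle n (t : 'I_(grid_size n)) : R[i] :=
  circle_point (t%:R / (grid_size n)%:R).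

Lemma grid_angle_separated n (t t' : 'I_(grid_size n)) :
  normc (grid_angle t - grid_angle t') < (grid_size n)%:R^-1 -> t = t'.
Proof.
have M0 : 0 < (grid_size n)%:R :> R by rewrite ltr0n.
have rg (s : 'I_(grid_size n)) : 0 <= (s%:R / (grid_size n)%:R : R) <= 1.
  by rewrite divr_ge0//= ler_pdivrMr// mul1r ler_nat ltnW.
move=> /(le_lt_trans (circle_point_separated (rg t) (rg t'))).
rewrite -mulrBl normrM normfV (gtr0_norm M0) ltr_pdivrMr// mulVf ?gt_eqF// => tt'.
move: tt'; rewrite ltr_distl ltrBlDr !natr1 !ltr_nat !ltnS => h.
by apply/val_inj/anti_leq; rewrite andbC.
Qed.

Definition circle_grid n a r : seq R[i] :=
  [seq a + r%:C * z | t <- enum 'I_(grid_size n), z <- roots_of n (grid_angle t)].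

(** The [n^2] points [x j] have room for all the zeros of all the derivatives. For each of the
    two conditions a point [x j] excludes at most one angle, since the angles are separated
    by the inverse of their number, and there are more than [2 n^2] angles. *)
Lemma exists_good_angle n a r (x : 'I_n * 'I_n -> R[i]) : (0 < n)%N -> 0 < r ->
  exists t : 'I_(grid_size n), forall j,
    ((2 * (grid_size n)%:R)^-1 <= normc (((x j - a) / r%:C) ^+ n - grid_angle t)) /\
    (forall z, z \in roots_of n (grid_angle t) ->
       r / (2 * n%:R * (grid_size n)%:R) <= normc (a + r%:C * z - x j)).
Proof.
move=> n0 r0.
have M0 : 0 < (grid_size n)%:R :> R by rewrite ltr0n.
have nR0 : 0 < n%:R :> R by rewrite ltr0n.
have rC0 : r%:C != 0 by rewrite (inj_eq (@complexI R)) gt_eqF.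
pose y j := (x j - a) / r%:C.
pose Q (j : 'I_n * 'I_n * bool) (t : 'I_(grid_size n)) :=
  if j.2 then normc (y j.1 ^+ n - grid_angle t) < (2 * (grid_size n)%:R)^-1
  else has (fun z => normc (z - y j.1) < (2 * n%:R * (grid_size n)%:R)^-1)
    (roots_of n (grid_angle t)).
have halves (c : R) (p q s : R[i]) : normc (p - q) < (2 * c)^-1 ->
    normc (s - q) < (2 * c)^-1 -> normc (p - s) < c^-1.
  move=> pq sq; have -> : p - s = (p - q) + (q - s) by ring.
  apply: (le_lt_trans (normcD _ _)); rewrite (normcB q).
  apply: (lt_le_trans (ltrD pq sq)); rewrite invfM -mulrDl.
  by rewrite (_ : 2^-1 + 2^-1 = 1 :> R) ?mul1r//; field.
have Quniq j t t' : Q j t -> Q j t' -> t = t'.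
  case: j => j []; rewrite /Q/=.
    move=> h h'.
    apply: grid_angle_separated; rewrite normcB in h; rewrite normcB in h'.
    exact: halves h h'.
  move=> /hasP[z zr zj] /hasP[z' zr' zj'].
  apply: grid_angle_separated.
  rewrite -mulrA in zj; rewrite -mulrA in zj'.
  have := halves _ _ _ _ zj zj'.
  rewrite invfM ltr_pdivlMl// => zz; apply: le_lt_trans zz.
  rewrite -(roots_ofP n0 zr) -(roots_ofP n0 zr').
  have := @normc_expB R z z' n 1; rewrite expr1n mulr1; apply.
    by rewrite (normc_roots_of n0 _ zr)// normc_circle_point.
  by rewrite (normc_roots_of n0 _ zr')// normc_circle_point.
have QM : (#|{: 'I_n * 'I_n * bool}| < #|'I_(grid_size n)|)%N.
  by rewrite card_ord /grid_size card_prod card_prod !card_ord card_bool; lia.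
have [t Qt] := pigeonhole_avoid Quniq QM.
exists t => j; split.
    by have := Qt (j, true); rewrite /Q/= -leNgt.
  move=> z zr; have /hasPn/(_ z zr) := Qt (j, false); rewrite -leNgt /= => h.
  have -> : a + r%:C * z - x j = r%:C * (z - y j).
    by rewrite mulrBr /y mulrCA divff// mulr1; ring.
  by rewrite normcM normc_real gtr0_norm// ler_pM2l.
Qed.

(** At a good angle, the discrete Jensen formula at both ends and the telescoping of the
    one-step bounds apply to the same [n] points of the grid. *)
Lemma log_max_sum_comparison n m (Z : forall j, (n - j).-tuple R[i])
    (g : forall j, (n.+1 - j).-tuple R) a r e T B :
  (m < n)%N -> 0 < r -> 0 < e ->
  (forall j, (j < m)%N -> forall k, 0 < tnth (g j.+1) k <= T) ->
  (forall j, (j < m)%N ->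
    zeros_with_multiplicity (randomized_derivative (Z j) (g j.+1)) (Z j.+1)) ->
  (forall j, (j < m)%N -> forall z, z \in circle_grid n a r ->
    e * \prod_(k < n - j) normc (z - tnth (Z j) k) <=
      normc (randomized_derivative (Z j) (g j.+1)).[z]) ->
  ln (2 * n%:R * (grid_size n)%:R / r) <= B -> ln (n%:R * T / e) <= B ->
  `|\sum_(k < n - m) log_max r (tnth (Z m) k - a) -
    \sum_(k < n - 0) log_max r (tnth (Z 0%N) k - a)|
    <= m%:R * B + 2 * ln (4 * (grid_size n)%:R).
Proof.
move=> mn r0 e0 gT zz lo dB TB.
have n0 : (0 < n)%N by lia.
have nR0 : 0 < n%:R :> R by rewrite ltr0n.
have M0 : 0 < (grid_size n)%:R :> R by rewrite ltr0n.
have M1 : 1 <= (grid_size n)%:R :> R by rewrite ler1n.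
have [t tP] := exists_good_angle a (fun p => nth 0 (Z p.1) p.2) n0 r0.
set u := grid_angle t in tP.
set d := r / _ in tP.
have d0 : 0 < d by rewrite divr_gt0// !mulr_gt0.
have far j : (j <= m)%N -> forall z, z \in roots_of n u -> forall k,
    d <= normc (a + r%:C * z - tnth (Z j) k).
  move=> jm z zr k.
  have jn : (j < n)%N := leq_ltn_trans jm mn.
  have kn : (k < n)%N := leq_trans (ltn_ord k) (leq_subr _ _).
  have [_ /(_ z zr)] := tP (Ordinal jn, Ordinal kn).
  by rewrite (tnth_nth 0).
have steps z : z \in roots_of n u -> forall j, (j <= m)%N ->
    `|\sum_(k < n - j) ln (normc (a + r%:C * z - tnth (Z j) k)) -
      \sum_(k < n - 0) ln (normc (a + r%:C * z - tnth (Z 0%N) k))| <= j%:R * B.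
  move=> zr; elim=> [|j IH] jm; first by rewrite subrr normr0 mul0r.
  rewrite -natr1 mulrDl mul1r [leRHS]addrC.
  have jm' : (j <= m)%N := ltnW jm.
  apply: (le_trans (ler_distD (\sum_(k < n - j) ln (normc (a + r%:C * z - tnth (Z j) k))) _ _)).
  apply: lerD; last exact: IH.
  apply: (@ln_potential_step _ _ _ _ (g j.+1) _ _ d e T) => //.
  - by rewrite subSS subn_gt0 (ltn_trans jm mn).
  - exact: gT.
  - exact: far.
  - exact: far.
  - exact: zz.
  - apply: lo => //; apply/allpairsPdep; exists t, z; split => //.
    by rewrite mem_enum.
  - by rewrite /d invf_div.
  - have nj : (0 < n - j)%N by rewrite subn_gt0 (ltn_trans jm mn).
    have T0 : 0 < T by case/andP: (gT j jm (Ordinal nj)) => ?; exact: lt_le_trans.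
    apply: le_trans TB; rewrite ler_ln_le ?divr_gt0 ?mulr_gt0 ?ltr0n//.
    by rewrite ler_pM2r ?invr_gt0// ler_pM2r// ler_nat subSS leq_subr.
have avg i : (i <= m)%N ->
    `|\sum_(z <- roots_of n u) \sum_(k < n - i) ln (normc (a + r%:C * z - tnth (Z i) k))
      - n%:R * \sum_(k < n - i) log_max r (tnth (Z i) k - a)|
     <= n%:R * ln (4 * (grid_size n)%:R).
  move=> im; rewrite exchange_big mulr_sumr -sumrB.
  apply: (le_trans (ler_norm_sum _ _ _)).
  have L0 : 0 <= ln (4 * (grid_size n)%:R) :> R.
    by rewrite ln_ge0// (le_trans M1)// ler_peMl ?ler1n// ltW.
  apply: (@le_trans _ _ ((n - i)%:R * ln (4 * (grid_size n)%:R))); last first.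
    by rewrite ler_wpM2r// ler_nat leq_subr.
  rewrite -[X in X%:R * _](card_ord (n - i)) mulr_natl -sumr_const.
  apply: ler_sum => k _.
  have -> : 4 * (grid_size n)%:R = 2 / (2 * (grid_size n)%:R)^-1 :> R by rewrite invrK; ring.
  have jn : (i < n)%N := leq_ltn_trans im mn.
  have kn : (k < n)%N := leq_trans (ltn_ord k) (leq_subr _ _).
  have [] := tP (Ordinal jn, Ordinal kn); rewrite /= -tnth_nth => h1 h2.
  apply: circle_log_average => //.
  - exact: normc_circle_point.
  - by rewrite invr_gt0 mulr_gt0.
  - by rewrite invf_le1 ?mulr_gt0// (le_trans M1)// ler_peMl ?ler1n// ltW.
  - by move=> z zr; apply: lt_le_trans (h2 z zr).
rewrite -(ler_pM2l nR0) -[in leLHS](gtr0_norm nR0) -normrM.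
have tot : `|\sum_(z <- roots_of n u) \sum_(k < n - m) ln (normc (a + r%:C * z - tnth (Z m) k))
  - \sum_(z <- roots_of n u) \sum_(k < n - 0) ln (normc (a + r%:C * z - tnth (Z 0%N) k))|
  <= n%:R * (m%:R * B).
  rewrite -sumrB; apply: (le_trans (ler_norm_sum _ _ _)).
  have -> : n%:R * (m%:R * B) = \sum_(z <- roots_of n u) m%:R * B.
    by rewrite big_const_seq count_predT size_roots_of// iter_addr addr0 mulr_natl.
  rewrite big_seq [leRHS]big_seq; apply: ler_sum => z zr.
  exact: steps.
have := avg m (leqnn m); have := avg 0%N (leq0n m).
move: tot; rewrite !ler_norml mulrBr mulrDr.
move=> /andP[? ?] /andP[? ?] /andP[? ?]; apply/andP; split; lra.
Qed.

End comparison.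

(** * The weighted Gauss-Lucas theorem *)

Section gauss_lucas.
Context {R : realType}.

Lemma Re_div_gt0 (t z : R[i]) : normc z < normc t -> 0 < Re (t / (t - z)).
Proof.
move=> zt; have tz : t - z != 0.
  by rewrite subr_eq0; apply: contraTneq zt => ->; rewrite ltxx.
have : normc z ^+ 2 < normc t ^+ 2.
  by rewrite ltr_pXn2r// nnegrE normc_ge0.
rewrite !normc_sqr.
have := normc_sqr (t - z); have : 0 < normc (t - z) ^+ 2.
  by rewrite exprn_gt0// normc_gt0.
case: t z {zt tz} => [a b] [c d] /= N0 NE lt.
rewrite -NE.
have -> : a * ((a - c) / Num.sqrt ((a - c) ^+ 2 + (b - d) ^+ 2) ^+ 2) -
  b * - ((b - d) / Num.sqrt ((a - c) ^+ 2 + (b - d) ^+ 2) ^+ 2) =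
  (a * (a - c) + b * (b - d)) / Num.sqrt ((a - c) ^+ 2 + (b - d) ^+ 2) ^+ 2.
  by ring.
rewrite divr_gt0//.
have := sqr_ge0 (a - c); have := sqr_ge0 (b - d); nra.
Qed.

(** Outside a disc centred at the origin that contains the zeros, every term of
    [\sum_k g_k t / (t - z_k)] has positive real part, so that the sum cannot vanish. *)
Lemma gauss_lucas_disc n n' (z : n.-tuple R[i]) (g : n.-tuple R) (z' : n'.-tuple R[i])
    (rho : R) :
  (0 < n)%N -> (forall k, 0 < tnth g k) ->
  zeros_with_multiplicity (randomized_derivative z g) z' ->
  (forall k, normc (tnth z k) <= rho) -> forall k, normc (tnth z' k) <= rho.
Proof.
move=> n0 g0 zz zr k; rewrite leNgt; apply/negP => tr.
set t := tnth z' k in tr.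
have rt : root (randomized_derivative z g) t.
  rewrite (zeros_with_multiplicityP zz) rootZ ?lead_coef_eq0; last by case: zz.
  by rewrite root_prod_XsubC mem_tnth.
have zt l : normc (tnth z l) < normc t := le_lt_trans (zr l) tr.
have tz l : t != tnth z l by apply: contraTneq (zt l) => <-; rewrite ltxx.
move: rt; rewrite /root randomized_derivativeE// mulf_eq0 => /orP[/prodf_eq0[l _]|/eqP s0].
  by rewrite subr_eq0 (negPf (tz l)).
have : Re (t * \sum_(k < n) (tnth g k)%:C / (t - tnth z k)) = 0 by rewrite s0 mulr0.
rewrite mulr_sumr raddf_sum /= => /eqP; rewrite gt_eqF//.
have pos l : 0 < Re (t * ((tnth g l)%:C / (t - tnth z l))).
  have -> : t * ((tnth g l)%:C / (t - tnth z l)) = (tnth g l)%:C * (t / (t - tnth z l)).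
    by rewrite mulrCA.
  have -> (c : R) (y : R[i]) : Re (c%:C * y) = c * Re y by case: y => a b; simpc.
  by rewrite mulr_gt0// Re_div_gt0.
rewrite (bigD1 (Ordinal n0))//= ltr_pwDl// sumr_ge0// => l _; exact: ltW.
Qed.

End gauss_lucas.

(** * Topology and Borel sets of the complex plane *)

Section complex_topology.
Context {R : realType}.
Implicit Types (x y z : R[i]) (e : R).

(** The topology of [R[i]] is given by balls with complex-valued radii; this passes to real
    radii and the real modulus. *)
Lemma nbhs_complexP z (A : set R[i]) :
  nbhs z A <-> exists2 e, 0 < e & forall y, normc (z - y) < e -> A y.
Proof.
split.
  move/nbhs_ballP => [e /= e0 eA]; exists (Re e).
    by move: e0; rewrite ltcE => /andP[].
  move=> y zy; apply: eA; rewrite -ball_normE/= normE.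
  move: e0; rewrite !ltcE/= => /andP[/eqP <- _].
  by rewrite eqxx.
move=> [e e0 eA]; apply/nbhs_ballP; exists e%:C; first by rewrite /= ltcR.
by move=> y; rewrite -ball_normE/= normE ltcR; exact: eA.
Qed.

Lemma continuous_complexP (f : R[i] -> R) : continuous f <->
  forall z e, 0 < e -> exists2 d, 0 < d & forall y, normc (z - y) < d -> `|f z - f y| < e.
Proof.
split=> cf z.
  move=> e e0; have := cf z (ball (f z) e) (nbhsx_ballx _ _ e0).
  by move/nbhs_complexP.
move=> A /nbhs_ballP[e /= e0 eA]; apply/nbhs_complexP.
by have [d d0 dA] := cf z e e0; exists d => // y /dA; exact: eA.
Qed.

Lemma lipschitz_continuous_complex (f : R[i] -> R) (K : R) :
  (forall x y, `|f x - f y| <= K * normc (x - y)) -> continuous f.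
Proof.
move=> fK; apply/continuous_complexP => z e e0.
have K0 : 0 < `|K| + 1 by rewrite ltr_wpDl.
exists (e / (`|K| + 1)); first by rewrite divr_gt0.
move=> y; rewrite ltr_pdivlMr// => zy; apply: le_lt_trans zy.
apply: (le_trans (fK _ _)); rewrite mulrC ler_wpM2l ?normc_ge0//.
by rewrite (le_trans (ler_norm _))// lerDl.
Qed.

Lemma continuous_measurable_complex (f : R[i] -> R) :
  continuous f -> measurable_fun setT f.
Proof.
move=> /continuousP cf; apply: (measurability _ (@RGenOpens.measurableE R)).
move=> _ [_ [a [b ->]] <-]; rewrite setTI; apply: sub_sigma_algebra.
apply: cf; exact: interval_open.
Qed.

Lemma Re_subE x y : Re (x - y) = Re x - Re y.
Proof. by case: x y => [a b] [c d]. Qed.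

Lemma Im_subE x y : Im (x - y) = Im x - Im y.
Proof. by case: x y => [a b] [c d]. Qed.

Lemma Im_le_normc z : `|Im z| <= normc z.
Proof.
by rewrite -(ler_pXn2r (n := 2))// ?nnegrE ?normc_ge0// normc_sqr real_normK ?num_real// lerDr sqr_ge0.
Qed.

Lemma normc_le_ReIm z : normc z <= `|Re z| + `|Im z|.
Proof.
rewrite -(ler_pXn2r (n := 2))// ?nnegrE ?normc_ge0 ?addr_ge0// normc_sqr sqrrD.
rewrite !real_normK ?num_real//.
have : 0 <= `|Re z| * `|Im z| *+ 2 by rewrite mulrn_wge0 ?mulr_ge0.
lra.
Qed.

Lemma continuous_Re : continuous (@complex.Re R).
Proof.
apply: (@lipschitz_continuous_complex _ 1) => x y.
by rewrite mul1r -Re_subE Re_le_normc.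
Qed.

Lemma continuous_Im : continuous (@complex.Im R).
Proof.
apply: (@lipschitz_continuous_complex _ 1) => x y.
by rewrite mul1r -Im_subE Im_le_normc.
Qed.

Lemma normc_lipschitz x y : `|normc x - normc y| <= normc (x - y).
Proof.
rewrite ler_norml normcB_ge andbT lerNl opprB.
by rewrite (le_trans (normcB_ge _ _))// normcB.
Qed.

Lemma measurable_normc_sub (a : R[i]) : measurable_fun setT (fun z : R[i] => normc (z - a)).
Proof.
apply: continuous_measurable_complex.
apply: (@lipschitz_continuous_complex _ 1) => x y.
rewrite mul1r; apply: (le_trans (normc_lipschitz _ _)).
by rewrite opprB addrA subrK.
Qed.

(** Heine's theorem, with compactness of squares inherited from [R * R]. *)
Lemma uniformly_continuous_complex (f : R[i] -> R) (rho e : R) :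
  continuous f -> 0 < e -> exists2 d, 0 < d &
    forall x y, normc x <= rho -> normc (x - y) < d -> `|f x - f y| < e.
Proof.
move=> cf e0.
pose K : set (R * R) := `[- rho, rho]%classic `*` `[- rho, rho]%classic.
have cK : compact K by apply: compact_setX; exact: segment_compact.
pose c (p : R * R) : R[i] := p.1 +i* p.2.
have cpq p q : normc (c p - c q) <= `|p.1 - q.1| + `|p.2 - q.2|.
  by apply: (le_trans (normc_le_ReIm _)); rewrite Re_subE Im_subE.
pose Q (d : R) (p : R * R) := forall y, normc (c p - y) < d -> `|f (c p) - f y| < e.
have nearQ p : K p -> \forall p' \near p & d \near 0^'+, Q d p'.
  move=> _; have e20 : 0 < e / 2 by rewrite divr_gt0.
  have [d d0 dP] := (continuous_complexP f).1 cf (c p) _ e20.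
  have d40 : 0 < d / 4 by rewrite divr_gt0.
  exists (ball p (d / 4), [set t | 0 < t < d / 4]).
    split => /=; first exact: nbhsx_ballx.
    exists (d / 4) => //= t; rewrite /ball/= sub0r normrN => + t0.
    by rewrite gtr0_norm// t0.
  move=> [q t] /= [[b1 b2] /andP[t0 td]] y qy.
  have pq : normc (c p - c q) < d / 2.
    apply: (le_lt_trans (cpq _ _)); move: b1 b2; rewrite /ball/= => b1 b2; lra.
  have h1 := dP (c q) ltac:(lra).
  have h2 : `|f (c p) - f y| < e / 2.
    apply: dP; have -> : c p - y = (c p - c q) + (c q - y) by ring.
    apply: (le_lt_trans (normcD _ _)); lra.
  have -> : f (c q) - f y = - (f (c p) - f (c q)) + (f (c p) - f y) by ring.
  by apply: (le_lt_trans (ler_normD _ _)); rewrite normrN; lra.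
have := (compact_near_coveringP K).1 cK _ _ Q _ nearQ.
case=> d /= d0 dQ; rewrite /ball/= in dQ; exists (d / 2); first by rewrite divr_gt0.
move=> x y xr xy; have := dQ (d / 2) _ _ (Re x, Im x).
rewrite /Q/c/=; case: x xr xy => a b xr xy; apply => //.
- by rewrite sub0r normrN gtr0_norm ?divr_gt0// ltr_pdivrMr// ltr_pMr// ltr1n.
- by rewrite divr_gt0.
- have := le_trans (Re_le_normc _) xr; have := le_trans (Im_le_normc _) xr.
  rewrite !ler_norml => h1 h2; rewrite /K/=; split; rewrite /= in_itv; [exact: h2|exact: h1].
Qed.

End complex_topology.

(** * The Gamma law *)

Section gamma_density.
Context {R : realType}.
Local Notation leb := (@lebesgue_measure R).

(** Maximising [p * ln t - t / 2] over [t]. *)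
Lemma powR_expR_le (p t : R) : 0 < p -> 0 < t ->
  t `^ p * expR (- (t / 2)) <= (2 * p) `^ p.
Proof.
move=> p0 t0; have p20 : 0 < 2 * p by rewrite mulr_gt0.
rewrite /powR !gt_eqF// -expRD ler_expR.
have lnE : ln t = ln (t / (2 * p)) + ln (2 * p).
  by rewrite -lnM ?posrE ?divr_gt0// divfK// gt_eqF.
have := ltW (@ln_sublinear R (t / (2 * p)) (divr_gt0 t0 p20)).
rewrite lnE -(ler_pM2l p0) => h.
have -> : t / 2 = p * (t / (2 * p)) by field; rewrite gt_eqF.
by rewrite mulrDr addrAC gerDr subr_le0.
Qed.

Lemma Gamma_fun_ge0 (a : R) : 0 <= Gamma_fun a.
Proof. by apply: Rintegral_ge0 => t _; rewrite mulr_ge0 ?powR_ge0 ?expR_ge0. Qed.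

Lemma gamma_pdf_ge0 (a t : R) : 0 <= gamma_pdf a t.
Proof.
apply: restrict_ge0 => {}t _.
by rewrite !mulr_ge0 ?invr_ge0 ?Gamma_fun_ge0 ?powR_ge0 ?expR_ge0.
Qed.

Lemma gamma_pdfE (a t : R) : 0 < t ->
  gamma_pdf a t = (Gamma_fun a)^-1 * t `^ (a - 1) * expR (- t).
Proof. by move=> t0; rewrite /gamma_pdf patchE mem_set//= in_itv/= t0. Qed.

Lemma gamma_pdf_eq0 (a t : R) : t <= 0 -> gamma_pdf a t = 0.
Proof.
move=> t0; rewrite /gamma_pdf patchE memNset//= in_itv/= andbT.
by apply/negP; rewrite -leNgt.
Qed.

Lemma measurable_gamma_pdf (a : R) : measurable_fun setT (gamma_pdf a).
Proof.
apply/measurable_restrict => //; apply: measurable_funTS.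
apply: measurable_funM; first by apply: measurable_funM.
by apply: measurableT_comp.
Qed.

Section law.
Context d (T : measurableType d) (P : probability T R).

Lemma gamma_law_le (a : R) (X : T -> R) (A : set R) (g : R -> R) :
  has_gamma_law P a X -> measurable A -> measurable_fun A g ->
  (forall t, A t -> gamma_pdf a t <= g t) ->
  (P (X @^-1` A) <= \int[leb]_(t in A) (g t)%:E)%E.
Proof.
move=> lawX mA mg le_g; rewrite lawX//; apply: ge0_le_integral => //.
- by move=> t _; rewrite lee_fin gamma_pdf_ge0.
- by apply/measurable_EFinP/measurable_funTS; exact: measurable_gamma_pdf.
- exact/measurable_EFinP.
Qed.

Lemma gamma_law_npos (a : R) (X : T -> R) : has_gamma_law P a X ->
  P (X @^-1` `]-oo, 0]) = 0%E.
Proof.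
move=> lawX; rewrite lawX//; apply: integral0_eq => t.
by rewrite /= in_itv/= => t0; rewrite gamma_pdf_eq0.
Qed.

End law.
End gamma_density.

Section gamma_estimates.
Context {R : realType} d (T : measurableType d) (P : probability T R).
Local Notation leb := (@lebesgue_measure R).

(** Half of the exponential absorbs any power of [t]; the other half is integrable, which is
    read off the exponential distribution. *)
Lemma gamma_law_tail (a : R) (q : nat) : 0 < a -> exists2 K : R, 0 <= K &
  forall X : T -> R, has_gamma_law P a X -> forall t, 1 <= t ->
    (P (X @^-1` `[t, +oo[) <= (K / t ^+ q)%:E)%E.
Proof.
move=> a0; pose p := a + q%:R.
have p0 : 0 < p by rewrite ltr_wpDr.
pose K := (Gamma_fun a)^-1 * (2 * p) `^ p * 2.
have K0 : 0 <= K by rewrite !mulr_ge0 ?invr_ge0 ?Gamma_fun_ge0 ?powR_ge0.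
exists K => // X lawX t t1.
have t0 : 0 < t by exact: lt_le_trans t1.
have h12 : 0 < 2^-1 :> R by rewrite invr_gt0.
have Kt0 : 0 <= K / t ^+ q by rewrite divr_ge0// exprn_ge0// ltW.
apply: (@le_trans _ _ (\int[leb]_(s in `[t, +oo[) (K / t ^+ q * exponential_pdf 2^-1 s)%:E)%E).
  apply: (gamma_law_le lawX) => //.
    apply: measurable_funM => //; apply: measurable_funTS.
    exact: measurable_exponential_pdf.
  move=> s; rewrite /= in_itv/= andbT => ts.
  have s0 : 0 < s by exact: lt_le_trans ts.
  rewrite gamma_pdfE// exponential_pdfE ?(ltW s0)//.
  rewrite (_ : _ / _ * _ = (Gamma_fun a)^-1 * ((2 * p) `^ p * (t ^+ q)^-1 * expR (- (s / 2)))).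
    rewrite -mulrA ler_wpM2l ?invr_ge0 ?Gamma_fun_ge0//.
    rewrite [leLHS](_ : _ = s `^ (a - 1) * expR (- (s / 2)) * expR (- (s / 2))).
      rewrite ler_wpM2r ?expR_ge0// ler_pdivlMr ?exprn_gt0//.
      apply: le_trans (powR_expR_le p0 s0).
      rewrite mulrAC ler_wpM2r ?expR_ge0//.
      rewrite -(mulr_powRB1 (ltW s0) p0) /p.
      rewrite (_ : a + q%:R - 1 = a - 1 + q%:R); last by ring.
      rewrite (@powRD _ s (a - 1) q%:R); last by rewrite (gt_eqF s0) implybT.
      rewrite (powR_mulrn _ (ltW s0)) mulrCA ler_wpM2l ?powR_ge0//.
      rewrite -[leLHS]mul1r; apply: ler_pM => //.
      - by rewrite exprn_ge0// ltW.
      - exact: le_trans ts.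
      - by apply: lerXn2r; rewrite ?nnegrE// ltW.
    by rewrite -mulrA -expRD; congr (_ * expR _); field.
  rewrite /K mulNr (mulrC _ s); move: (Gamma_fun a)^-1 => G; field.
  by rewrite expf_neq0 ?gt_eqF.
under eq_integral do rewrite EFinM.
rewrite ge0_integralZl//; last 2 first.
- by apply/measurable_EFinP/measurable_funTS; exact: measurable_exponential_pdf.
- by move=> s _; rewrite lee_fin exponential_pdf_ge0// ltW.
rewrite -[leRHS]mule1; apply: lee_wpmul2l => //.
rewrite -(integral_exponential_pdf h12); apply: ge0_subset_integral => //.
  by apply/measurable_EFinP; exact: measurable_exponential_pdf.
by move=> s _; rewrite lee_fin exponential_pdf_ge0// ltW.
Qed.


Lemma gamma_law_itv (a : R) (X : T -> R) e s : 0 < a -> 0 < e -> e < s ->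
  has_gamma_law P a X ->
  (P (X @^-1` `[e, s]) <= ((Gamma_fun a)^-1 / a * s `^ a)%:E)%E.
Proof.
move=> a0 e0 es lawX.
have es0 t : t \in `[e, s] -> 0 < t.
  by rewrite in_itv/= => /andP[et _]; exact: lt_le_trans et.
have s0 : 0 < s by exact: lt_trans es.
set c := (Gamma_fun a)^-1.
have c0 : 0 <= c by rewrite invr_ge0 Gamma_fun_ge0.
pose f t := c * t `^ (a - 1).
pose F t := c / a * t `^ a.
have dF (t : R) : 0 < t -> is_derive t 1 F (f t).
  move=> t0; have -> : f t = c / a * (a * t `^ (a - 1)).
    by rewrite /f mulrA divfK// gt_eqF.
  have := is_derive1_powR a t0 => ?.
  exact: is_deriveZ.
have dcont (t : R) : 0 < t -> {for t, continuous F}.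
  move=> t0; apply/differentiable_continuous/derivable1_diffP.
  by have [] := dF t t0.
apply: (@le_trans _ _ (\int[leb]_(t in `[e, s]) (f t)%:E)%E).
  apply: (gamma_law_le lawX) => //.
    by apply: measurable_funM => //; apply: measurable_funTS; exact: measurable_powR.
  move=> t /= /es0 t0; rewrite gamma_pdfE// ler_piMr ?mulr_ge0 ?powR_ge0//.
  by rewrite -expR0 ler_expR oppr_le0 ltW.
rewrite (@continuous_FTC2 _ f F e s)//.
- by rewrite -EFinB lee_fin gerBl mulr_ge0 ?powR_ge0// divr_ge0// ltW.
- apply: derivable_within_continuous => t /es0 t0.
  apply: derivableM => //; apply: derivable_powR.
  by rewrite in_itv/= t0.
- split.
  + move=> t; rewrite in_itv/= => /andP[et _].
    by have [] := dF t (lt_trans e0 et).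
  + exact/cvg_at_right_filter/dcont.
  + exact/cvg_at_left_filter/dcont.
- move=> t; rewrite in_itv/= => /andP[et _].
  by have [_] := dF t (lt_trans e0 et); rewrite derive1E.
Qed.

(** The density may be unbounded at 0: its integral is computed from [e > 0] to [s], where the
    power function is smooth, and [e] tends to 0. *)
Lemma gamma_law_small (a : R) (X : T -> R) s : 0 < a -> 0 < s ->
  measurable_fun setT X -> has_gamma_law P a X ->
  (P (X @^-1` `]-oo, s]) <= ((Gamma_fun a)^-1 / a * s `^ a)%:E)%E.
Proof.
move=> a0 s0 mX lawX.
pose F k := X @^-1` `[s / k.+2%:R, s]%classic.
have mF k : measurable (F k) by rewrite -[F k]setTI; exact: mX.
have FE : \bigcup_k F k = X @^-1` `]0, s]%classic.
  apply/seteqP; split => w /=.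
    move=> [k _]; rewrite /F/= !in_itv/= => /andP[h ->]; rewrite andbT.
    by apply: lt_le_trans h; rewrite divr_gt0.
  rewrite in_itv/= => /andP[X0 Xs]; exists (Num.truncn (s / X w)) => //.
  rewrite /F/= in_itv/= Xs andbT ler_pdivrMr// mulrC -ler_pdivrMr//.
  by rewrite (le_trans (ltW (truncnS_gt _)))// ler_nat.
have mU : measurable (\bigcup_k F k) by exact: bigcup_measurable.
have ndF : {homo F : n m / (n <= m)%N >-> (n <= m)%O}.
  move=> n m nm; apply/subsetPset => w; rewrite /F/= !in_itv/= => /andP[h ->].
  rewrite andbT; apply: le_trans h; rewrite ler_pM2l// lef_pV2 ?posrE//.
  by rewrite ler_nat.
have lim := @nondecreasing_cvg_mu _ _ _ P F mF mU ndF.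
have -> : X @^-1` `]-oo, s]%classic = X @^-1` `]-oo, 0]%classic `|` \bigcup_k F k.
  rewrite FE; apply/seteqP; split => w /=; rewrite !in_itv/=.
    by case: (leP (X w) 0) => [|X0 ->]; [left|right].
  by case=> [h|/andP[]//]; exact: le_trans (ltW s0).
apply: (le_trans (measureU2 _ _ _)) => //.
  by rewrite -[_ @^-1` _]setTI; exact: mX.
rewrite [X in (X + _)%E](gamma_law_npos lawX) add0e.
apply: (@le_trans _ _ (limn (P \o F))).
  by rewrite (cvg_lim (@ereal_hausdorff R) lim).
apply: lime_le; first by apply/cvg_ex; eexists; exact: lim.
apply: nearW => k; apply: gamma_law_itv => //; first by rewrite divr_gt0.
by rewrite ltr_pdivrMr// ltr_pMr// ltr1n.
Qed.

(** Below [s] the mass is of order [s^a]; above [s] the density is of order [1 / s], because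
    [t^a exp (- t)] is bounded. *)
Lemma gamma_law_window (a : R) : 0 < a -> exists2 K : R, 0 <= K &
  forall X : T -> R, measurable_fun setT X -> has_gamma_law P a X ->
    forall x L s : R, 0 <= L -> 0 < s ->
    (P (X @^-1` `[x, (x + L)%R]) <= (K * (s `^ a + L / s))%:E)%E.
Proof.
move=> a0; set c := (Gamma_fun a)^-1.
have c0 : 0 <= c by rewrite invr_ge0 Gamma_fun_ge0.
pose K1 := c / a; pose K2 := c * (2 * a) `^ a.
have K10 : 0 <= K1 by rewrite divr_ge0// ltW.
have K20 : 0 <= K2 by rewrite mulr_ge0// powR_ge0.
exists (K1 + K2); first by rewrite addr_ge0.
move=> X mX lawX x L s L0 s0.
have sub : X @^-1` `[x, (x + L)%R]%classic `<=`
    X @^-1` `]-oo, s]%classic `|` X @^-1` (`[x, (x + L)%R]%classic `&` `]s, +oo[%classic).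
  move=> w /=; rewrite !in_itv/= => xL; case: (leP (X w) s); first by left.
  by right.
have mpre (A : set R) : measurable A -> measurable (X @^-1` A).
  by move=> mA; rewrite -[_ @^-1` _]setTI; exact: mX.
have mA : measurable (`[x, (x + L)%R]%classic `&` `]s, +oo[%classic : set R).
  exact: measurableI.
apply: (@le_trans _ _ ((K1 * s `^ a)%:E + (K2 * (L / s))%:E)%E); last first.
  rewrite -EFinD lee_fin mulrDr lerD// ler_wpM2r ?lerDl ?lerDr ?powR_ge0//.
  by rewrite divr_ge0// ltW.
apply: (@le_trans _ _ (P (X @^-1` `]-oo, s]%classic `|`
    X @^-1` (`[x, (x + L)%R]%classic `&` `]s, +oo[%classic)))).
  by apply: le_measure => //; rewrite inE; [exact: mpre|apply: measurableU; exact: mpre].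
apply: (le_trans (measureU2 _ _ _)); [exact: mpre|exact: mpre|].
apply: leeD; first exact: gamma_law_small.
apply: (@le_trans _ _ (\int[leb]_(t in `[x, (x + L)%R]%classic `&` `]s, +oo[%classic) (K2 / s)%:E)%E).
  apply: (gamma_law_le lawX) => // t [_]; rewrite /= in_itv/= andbT => st.
  have t0 : 0 < t by exact: lt_trans st.
  rewrite gamma_pdfE// -mulrA /K2 -[leRHS]mulrA ler_wpM2l//.
  rewrite ler_pdivlMr//.
  apply: (@le_trans _ _ (t `^ (a - 1) * expR (- t) * t)).
    by rewrite ler_wpM2l ?mulr_ge0 ?powR_ge0 ?expR_ge0// ltW.
  rewrite mulrAC [_ * t]mulrC (mulr_powRB1 (ltW t0) a0).
  apply: le_trans (powR_expR_le a0 t0); rewrite ler_wpM2l ?powR_ge0//.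
  by rewrite ler_expR lerN2 ler_pdivrMr// mulr_natr mulr2n lerDl ltW.
apply: (@le_trans _ _ (\int[leb]_(t in `[x, (x + L)%R]%classic) (K2 / s)%:E)%E).
  apply: ge0_subset_integral => //.
  by move=> *; rewrite lee_fin divr_ge0// ltW.
rewrite (integral_cst leb)//.
have mE := lebesgue_measure_itv `[x, (x + L)%R].
rewrite [X in (_ * X)%E]mE /=.
have [xL|_] := ltP x%:E (x + L)%:E; last by rewrite mule0 lee_fin mulr_ge0// divr_ge0// ltW.
by rewrite -EFinD -EFinM lee_fin addrAC subrr add0r mulrAC mulrA.
Qed.

End gamma_estimates.

(** * Borel-Cantelli, anti-concentration and independence *)

Section union_bounds.
Context {R : realType} d (T : measurableType d) (P : probability T R).

Lemma measurable_bigU I (s : seq I) (F : I -> set T) :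
  (forall i, measurable (F i)) -> measurable (\big[setU/set0]_(i <- s) F i).
Proof. by move=> mF; elim/big_ind: _ => // A B; exact: measurableU. Qed.

Lemma measure_bigU_le I (s : seq I) (F : I -> set T) :
  (forall i, measurable (F i)) ->
  (P (\big[setU/set0]_(i <- s) F i) <= \sum_(i <- s) P (F i))%E.
Proof.
move=> mF; elim: s => [|i s IH]; first by rewrite !big_nil measure0.
rewrite !big_cons; apply: (le_trans (measureU2 _ _ _)) => //.
  exact: measurable_bigU.
exact: leeD2l.
Qed.

Lemma measure_bigU_fin_le (I : finType) (F : I -> set T) (b : R) :
  (forall i, measurable (F i)) -> (forall i, (P (F i) <= b%:E)%E) ->
  (P (\big[setU/set0]_(i : I) F i) <= (#|I|%:R * b)%:E)%E.
Proof.
move=> mF Fb; apply: (le_trans (measure_bigU_le _ mF)).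
apply: (@le_trans _ _ (\sum_(i : I) b%:E)%E); first exact: lee_sum.
by rewrite sumEFin sumr_const mulr_natl.
Qed.

(** Comparison of [1 / k^2] with [1 / (k - 1) - 1 / k]. *)
Lemma inverse_squares_telescope n m : (0 < m)%N ->
  \sum_(m.+1 <= k < n) (k%:R ^- 2 : R) <= m%:R^-1.
Proof.
move=> m0; have [mn|nm] := leqP m.+1 n; last by rewrite big_geq ?invr_ge0// ltnW.
suff : \sum_(m.+1 <= k < n) (k%:R ^- 2 : R) <= m%:R^-1 - n.-1%:R^-1.
  by move/le_trans; apply; rewrite gerBl invr_ge0.
elim: n mn => [//|n IH]; rewrite ltnS leq_eqVlt => /predU1P[<-|mn].
  by rewrite big_geq//= subr_ge0.
rewrite big_nat_recr//=; apply: (le_trans (lerD (IH mn) (lexx _))).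
suff : n%:R ^- 2 <= n.-1%:R^-1 - n%:R^-1 :> R by move=> h; lra.
have n1 : 0 < n.-1%:R :> R by rewrite ltr0n; case: n mn {IH} => // n; lia.
have nE : n%:R = n.-1%:R + 1 :> R by rewrite natr1 prednK//; lia.
rewrite nE; set x := n.-1%:R in n1 *.
have x1 : 0 < x + 1 by rewrite addr_gt0.
rewrite -subr_ge0 (_ : _ - _ = (x * (x + 1) ^+ 2)^-1).
  by rewrite invr_ge0 mulr_ge0 ?sqr_ge0// ltW.
by field; rewrite !gt_eqF.
Qed.

(** The Borel-Cantelli lemma combined with a union bound at each stage. *)
Lemma ae_eventually_avoid (I : nat -> finType) (F : forall n, I n -> set T)
    (b : nat -> R) (c : R) (n0 : nat) :
  (forall n i, (n0 <= n)%N -> measurable (F n i)) ->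
  (forall n i, (n0 <= n)%N -> (P (F n i) <= (b n)%:E)%E) ->
  (forall n, (n0 <= n)%N -> #|I n|%:R * b n <= c / n%:R ^+ 2) ->
  {ae P, forall w, \forall n \near \oo, forall i, ~ F n i w}.
Proof.
move=> mF Fb bc.
pose G n : set T := if (maxn n0 2 <= n)%N then \big[setU/set0]_(i : I n) F n i else set0.
have mG n : measurable (G n).
  rewrite /G; case: ifPn => // h; apply: measurable_bigU => i; apply: mF; lia.
have c0 : 0 <= c.
  have h : (n0 <= (maxn n0 2))%N by exact: leq_maxl.
  have n1 : 0 < (maxn n0 2)%:R :> R by rewrite ltr0n; lia.
  have : 0 <= #|I (maxn n0 2)|%:R * b (maxn n0 2).
    have [->|] := posnP #|I (maxn n0 2)|; first by rewrite mul0r.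
    move/card_gt0P => [i _]; rewrite mulr_ge0// -lee_fin.
    by apply: le_trans (Fb _ i h).
  move/le_trans => /(_ _ (bc _ h)).
  by rewrite pmulr_lge0// invr_gt0 exprn_gt0.
have sumG : (\sum_(0 <= n <oo) P (G n) < +oo)%E.
  apply: (@le_lt_trans _ _ c%:E); last exact: ltry.
  apply: lime_le; first exact: is_cvg_nneseries.
  apply: nearW => n.
  apply: (@le_trans _ _ (\sum_(0 <= k < n) (if (2 <= k)%N then c / k%:R ^+ 2 else 0)%:E)%E).
    apply: lee_sum => k _; rewrite /G; case: ifPn => h; last first.
      by rewrite measure0 lee_fin; case: ifP => // _; rewrite divr_ge0// sqr_ge0.
    rewrite ifT; last lia.
    apply: le_trans (measure_bigU_fin_le _ _) _.
    - by move=> i; apply: mF; lia.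
    - by move=> i; apply: Fb; lia.
    - by rewrite lee_fin bc//; lia.
  rewrite sumEFin lee_fin -big_mkcond/=.
  rewrite -mulr_sumr -[leRHS]mulr1 ler_wpM2l//.
  have := @inverse_squares_telescope n 1 isT; rewrite invr1; apply: le_trans.
  by rewrite [leRHS](@big_nat_widenl _ _ _ 2 0).
have lim0 := lim_sup_set_cvg0 mG sumG.
exists (lim_sup_set G); split => //.
  by apply: bigcap_measurable => // k _; apply: bigcup_measurable.
move=> w /= nw k _; apply: contrapT => kw; apply: nw.
exists (maxn k (maxn n0 2)) => // n /= kn i Fw; apply: kw.
exists n; first by rewrite /=; lia.
by rewrite /G ifT; [rewrite (bigD1 i)//=; left|lia].
Qed.

End union_bounds.

Section anti_concentration.
Context {R : realType} d (T : measurableType d) (P : probability T R).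

(** Slicing the range of [Y] into cells of length [L] replaces Fubini's theorem: on each
    cell [X] has to fall in a fixed interval of length [3 * L]. *)
Lemma anti_concentration (X Y : T -> R) (L q : R) : 0 < L ->
  measurable_fun setT X -> measurable_fun setT Y ->
  (forall A B : set R, measurable A -> measurable B ->
    P (Y @^-1` A `&` X @^-1` B) = (P (Y @^-1` A) * P (X @^-1` B))%E) ->
  (forall x, (P (X @^-1` `[x, (x + 3 * L)%R]) <= q%:E)%E) ->
  (P [set w | (`|X w - Y w| < L)%R] <= q%:E)%E.
Proof.
move=> L0 mX mY ind Xq.
have mpre (Z : T -> R) (A : set R) : measurable_fun setT Z -> measurable A ->
    measurable (Z @^-1` A).
  by move=> mZ mA; rewrite -[_ @^-1` _]setTI; exact: mZ.
pose cell (i : int) : set R := `[i%:~R * L, (i + 1)%:~R * L[%classic.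
pose win (i : int) : set R :=
  `[(i - 1)%:~R * L, ((i - 1)%:~R * L + 3 * L)%R]%classic.
(* [pickle_inv] is injective where it is defined, unlike [unpickle], so that the cells are
   disjoint. *)
pose C k : set R := if @pickle_inv int k is Some i then cell i else set0.
pose W k : set R := if @pickle_inv int k is Some i then win i else set0.
have mC k : measurable (C k) by rewrite /C; case: pickle_inv => [i|//]; exact: measurable_itv.
have mW k : measurable (W k) by rewrite /W; case: pickle_inv => [i|//]; exact: measurable_itv.
have trivC : trivIset setT (fun k => Y @^-1` C k).
  apply/trivIsetP => k l _ _ kl; apply/eqP/negPn/negP => /set0P[w []] /=.
  rewrite /C; case Ek: (@pickle_inv int k) => [i|//]; case El: (@pickle_inv int l) => [i'|//].
  rewrite /cell /= !in_itv/= => /andP[h1 h2] /andP[h3 h4].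
  have h5 := le_lt_trans h1 h4; have h6 := le_lt_trans h3 h2.
  rewrite ltr_pM2r// ltr_int in h5; rewrite ltr_pM2r// ltr_int in h6.
  have ii' : i = i' by lia.
  move/negP: kl; apply; apply/eqP.
  have := @pickle_invK int k; have := @pickle_invK int l.
  by rewrite /oapp Ek El => <- <-; rewrite ii'.
have sub : [set w | (`|X w - Y w| < L)%R] `<=` \bigcup_k (Y @^-1` C k `&` X @^-1` W k).
  move=> w /= XY; pose i := Num.floor (Y w / L).
  have /andP[i1 i2] := Num.Theory.floor_itv (Y w / L).
  have [k Ek] : exists k, @pickle_inv int k = Some i.
    by exists (choice.pickle i); exact: pickleK_inv.
  exists k => //; rewrite /C /W /= Ek /cell /win /= !in_itv/=.
  rewrite -/i in i1 i2; rewrite ler_pdivlMr// in i1; rewrite ltr_pdivrMr// in i2.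
  rewrite i1 i2; split => //.
  move: XY i1 i2; rewrite ltr_distl !intrD mulrDl => /andP[h1 h2] i1 i2.
  by apply/andP; split; lra.
have mE : measurable [set w | (`|X w - Y w| < L)%R].
  rewrite (_ : [set _ | _] = (fun w => `|X w - Y w|) @^-1` `]-oo, L[%classic).
    apply: mpre => //; apply: measurableT_comp => //; exact: measurable_funB.
  by apply/seteqP; split => w /=; rewrite in_itv.
have q0 : (0 <= q%:E)%E by apply: le_trans (Xq 0).
apply: (le_trans (@measure_sigma_subadditive _ _ _ P _ _ _ mE sub)).
  by move=> k; apply: measurableI; exact: mpre.
apply: (@le_trans _ _ (\sum_(0 <= k <oo) (q%:E * P (Y @^-1` C k)))%E).
  apply: lee_nneseries => // k _; have := ind _ _ (mC k) (mW k); rewrite /= => ->.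
  rewrite muleC lee_wpmul2r//.
  rewrite /W; case: pickle_inv => [i|]; last by rewrite preimage_set0 measure0.
  exact: Xq.
rewrite nneseriesZl// -measure_semi_bigcup//; last 2 first.
- by move=> k; exact: mpre.
- by apply: bigcup_measurable => k _; exact: mpre.
rewrite -[leRHS]mule1; apply: lee_wpmul2l => //; apply: probability_le1.
by apply: bigcup_measurable => k _; exact: mpre.
Qed.

End anti_concentration.

Section independent_pi_system.
Context {R : realType} d (T : measurableType d) (P : probability T R).

(** The sets that satisfy the product rule form a Dynkin class. *)
Lemma independent_of_generator (G : set (set T)) (E : set T) :
  setI_closed G -> G `<=` measurable -> measurable E ->
  (forall A, G A -> P (A `&` E) = (P A * P E)%E) ->
  forall A, <<s G >> A -> P (A `&` E) = (P A * P E)%E.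
Proof.
move=> GI Gm mE GE A GA.
suff : [set A | measurable A /\ P (A `&` E) = (P A * P E)%E] A by case.
apply: (lambda_system_subset GI _ _ _ GA) => //; last by move=> B GB; split; [exact: Gm|exact: GE].
apply/dynkin_lambda_system; split => /=.
- by rewrite setTI probability_setT mul1e.
- move=> B [mB BE]; split; first exact: measurableC.
  have fin C : measurable C -> P C \is a fin_num by exact: fin_num_measure.
  rewrite probability_setC// muleBl ?fin// mul1e -BE setIC -setDE measureD//.
    by rewrite setIC.
  by apply: (le_lt_trans (probability_le1 _ _)) => //; exact: ltry.
- move=> F tF FE.
  have mF k : measurable (F k) by have [] := FE k.
  split; first exact: bigcup_measurable.
  rewrite setI_bigcupl measure_semi_bigcup//; last 3 first.
  - by move=> k; apply: measurableI.
  - exact: trivIset_setIr.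
  - by apply: bigcup_measurable => k _; exact: measurableI.
  rewrite measure_semi_bigcup//; last exact: bigcup_measurable.
  have -> : P E = (fine (P E))%:E by rewrite fineK// fin_num_measure.
  rewrite muleC -nneseriesZl//; apply: eq_eseriesr => k _.
  have [_ FkE] := FE k; transitivity (P (F k) * P E)%E; first exact: FkE.
  by rewrite muleC fineK// fin_num_measure.
Qed.

End independent_pi_system.

(** * Independence of one weight from everything else *)

Section one_against_the_others.
Context {R : realType} d d1 d2 (T : measurableType d) (T1 : measurableType d1)
  (T2 : measurableType d2) (P : probability T R).
Context (I1 : choiceType) (I2 : Type) (D : set I1) (X : I1 -> T -> T1) (Y : I2 -> T -> T2).

(** A generator of the sigma-algebra of all the variables except [X i0]. *)
Definition other_events (i0 : I1) : set (set T) :=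
  (\bigcup_(i in D `\ i0) preimage_set_system setT (X i) measurable) `|`
  (\bigcup_(k in [set: I2]) preimage_set_system setT (Y k) measurable).

(** The intersections of an event of the second family with finitely many events on the
    first one, [i0] excluded, form a generating pi-system, on which the product rule
    follows from the two kinds of independence. *)
Lemma independent_of_others (i0 : I1) (B : set T1) :
  (forall i, D i -> measurable_fun setT (X i)) ->
  (forall k, measurable_fun setT (Y k)) ->
  mutually_independent P D X -> independent_families P D setT X Y ->
  D i0 -> measurable B ->
  forall A, <<s other_events i0 >> A ->
    P (A `&` X i0 @^-1` B) = (P A * P (X i0 @^-1` B))%E.
Proof.
move=> mX mY indX indXY Di0 mB A.
pose sigY := sigma_generated_by [set: I2] Y.
pose G : set (set T) := [set A | exists C, exists J : {fset I1}, exists E : I1 -> set T1,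
  [/\ sigY C, [set` J] `<=` D `\ i0, (forall i, measurable (E i)) &
   A = C `&` \bigcap_(i in [set` J]) X i @^-1` E i]].
have mpre i (E : set T1) : D i -> measurable E -> measurable (X i @^-1` E).
  by move=> Di mE; rewrite -[_ @^-1` _]setTI; exact: mX.
have sigYm C : sigY C -> measurable C.
  apply: smallest_sub; first exact: sigma_algebra_measurable.
  move=> _ [k _ [E mE <-]]; exact: mY.
have sigYI C C' : sigY C -> sigY C' -> sigY (C `&` C').
  have sa : sigma_algebra setT sigY by exact: smallest_sigma_algebra.
  exact: (@measurableI _ (g_sigma_algebraType
    (\bigcup_(i in [set: I2]) preimage_set_system setT (Y i) measurable))).
have sigYT : sigY setT.
  exact: (@measurableT _ (g_sigma_algebraType
    (\bigcup_(i in [set: I2]) preimage_set_system setT (Y i) measurable))).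
have mcap (J : {fset I1}) (E : I1 -> set T1) : [set` J] `<=` D ->
    (forall i, measurable (E i)) -> measurable (\bigcap_(i in [set` J]) X i @^-1` E i).
  by move=> JD mE; apply: fin_bigcap_measurable => // i /JD Di; exact: mpre.
have sigX (J : {fset I1}) (E : I1 -> set T1) : [set` J] `<=` D ->
    (forall i, measurable (E i)) ->
    sigma_generated_by D X (\bigcap_(i in [set` J]) X i @^-1` E i).
  move=> JD mE; apply: (@fin_bigcap_measurable _ (g_sigma_algebraType
    (\bigcup_(i in D) preimage_set_system setT (X i) measurable))) => // i iJ.
  apply: sub_sigma_algebra; exists i; first exact: JD.
  by exists (E i) => //; rewrite setTI.
have prodE (J : {fset I1}) (E : I1 -> set T1) : [set` J] `<=` D `\ i0 ->
    (forall i, measurable (E i)) ->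
    P ((\bigcap_(i in [set` J]) X i @^-1` E i) `&` X i0 @^-1` B) =
    (P (\bigcap_(i in [set` J]) X i @^-1` E i) * P (X i0 @^-1` B))%E /\
    sigma_generated_by D X ((\bigcap_(i in [set` J]) X i @^-1` E i) `&` X i0 @^-1` B).
  move=> JD mE; pose E' i := if i == i0 then B else E i.
  have mE' i : measurable (E' i) by rewrite /E'; case: eqP.
  have JD' : [set` J] `<=` D by move=> i /JD[].
  have i0J : i0 \notin J by apply/negP => i0J; have [_] := JD i0 i0J; apply.
  have iJ i : i \in J -> E' i = E i.
    by rewrite /E'; case: eqP => // ->; rewrite (negPf i0J).
  have capE : \bigcap_(i in [set` J]) X i @^-1` E i = \bigcap_(i in [set` J]) X i @^-1` E' i.
    by apply: eq_bigcapr => i /iJ ->.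
  have UD : [set` (i0 |` J)%fset] `<=` D.
    by move=> i /=; rewrite !inE => /orP[/eqP ->//|]; exact: JD'.
  have capU : (\bigcap_(i in [set` J]) X i @^-1` E i) `&` X i0 @^-1` B =
      \bigcap_(i in [set` (i0 |` J)%fset]) X i @^-1` E' i.
    by rewrite bigcap_fsetU1 capE setIC /E' eqxx.
  split; last by rewrite capU; exact: sigX.
  rewrite capU indX// big_fsetU1//= capE indX// muleC {2}/E' eqxx//.
have subG : <<s other_events i0 >> `<=` <<s G >>.
  apply: smallest_sub; first exact: smallest_sigma_algebra.
  move=> S [[i [Di ii0] [E mE <-]]|[k _ [E mE <-]]]; apply: sub_sigma_algebra.
    exists setT, [fset i]%fset, (fun=> E); split => //.
      by move=> i' /=; rewrite inE => /eqP ->.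
    by rewrite !setTI bigcap_fset big_seq_fset1.
  exists (setT `&` Y k @^-1` E), fset0, (fun=> setT); split => //.
  - by apply: sub_sigma_algebra; exists k => //; exists E.
  - by rewrite bigcap_fset big_seq_fset0 setIT.
move=> /subG; apply: independent_of_generator => //.
- move=> S S' [C [J [E [sC JD mE ->]]]] [C' [J' [E' [sC' JD' mE' ->]]]].
  exists (C `&` C'), (J `|` J')%fset,
    (fun i => (if i \in J then E i else setT) `&` (if i \in J' then E' i else setT)).
  split.
  - exact: sigYI.
  - by move=> i /=; rewrite inE => /orP[/JD|/JD'].
  - by move=> i; apply: measurableI; case: ifP.
  apply/seteqP; split => w /=.
    move=> [[Cw Jw] [Cw' Jw']]; split => // i /=; rewrite inE => /orP iJJ; split.
      by case: ifPn => // iJ; exact: Jw.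
    by case: ifPn => // iJ; exact: Jw'.
  move=> [[Cw Cw'] Jw]; split; split => // i /= iJ.
    by have [] := Jw i; rewrite /= ?inE ?iJ.
  by have [] := Jw i; rewrite /= ?inE ?iJ ?orbT.
- move=> _ [C [J [E [sC JD mE ->]]]]; apply: measurableI; first exact: sigYm.
  by apply: mcap => // i /JD[].
- exact: mpre.
- move=> _ [C [J [E [sC JD mE ->]]]].
  have [PE sX] := prodE J E JD mE.
  have JD' : [set` J] `<=` D by move=> i /JD[].
  rewrite -setIA setIC indXY// PE (setIC C) indXY//; last exact: sigX.
  by rewrite -muleA [RHS]muleAC muleA.
Qed.

End one_against_the_others.

(** * Cancellation in the logarithmic derivative *)

Section cancellation.
Context {R : realType}.

Lemma Re_divE (x y : R[i]) :
  Re (x / y) = (Re x * Re y + Im x * Im y) / normc y ^+ 2.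
Proof.
rewrite normc_sqr; case: x y => [a b] [c d] /=.
by rewrite mulrN opprK mulrDl !mulrA.
Qed.

(** The value that the first weight has to approach for the other terms of the
    logarithmic derivative at [t] to be cancelled. *)
Definition cancelling_weight n (k0 : 'I_n) (t : R[i]) (z : n.-tuple R[i]) (g : n.-tuple R) : R :=
  - \sum_(k < n | k != k0) tnth g k * Re ((t - tnth z k0) / (t - tnth z k)).

(** Multiplying the logarithmic derivative by [t - z_k0] leaves [g_k0] with the coefficient
    1; the modulus is at least the absolute value of the real part. *)
Lemma cancelling_weight_near n (k0 : 'I_n) t (z : n.-tuple R[i]) (g : n.-tuple R) (e rho : R) :
  0 < e -> normc (t - tnth z k0) <= rho ->
  normc (randomized_derivative z g).[t] < e * \prod_(k < n) normc (t - tnth z k) ->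
  `|tnth g k0 - cancelling_weight k0 t z g| < e * rho.
Proof.
move=> e0 zrho lt.
have p0 : \prod_(k < n) normc (t - tnth z k) != 0.
  apply/eqP => p0; move: lt; rewrite p0 mulr0 ltNge.
  by rewrite normc_ge0.
have tz k : t - tnth z k != 0.
  by move: p0 => /prodf_neq0/(_ k isT); rewrite normc_eq0.
have pp : 0 < \prod_(k < n) normc (t - tnth z k).
  by apply: prodr_gt0 => k _; rewrite normc_gt0.
rewrite randomized_derivativeE in lt; last by move=> k; rewrite -subr_eq0.
rewrite normcM normc_prod mulrC ltr_pM2r// in lt.
set S := \sum_(_ < _) _ in lt.
have SE : Re ((t - tnth z k0) * S) = tnth g k0 - cancelling_weight k0 t z g.
  rewrite /S mulr_sumr raddf_sum/= (bigD1 k0)//= /cancelling_weight opprK.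
  have ReM (c : R) (y : R[i]) : Re (c%:C * y) = c * Re y by case: y => a b; simpc.
  congr (_ + _).
    by rewrite mulrCA divff// mulr1.
  by apply: eq_bigr => k _; rewrite mulrCA ReM.
rewrite -SE; apply: (le_lt_trans (Re_le_normc _)); rewrite normcM mulrC.
apply: (@lt_le_trans _ _ (e * normc (t - tnth z k0))).
  by rewrite ltr_pM2r// normc_gt0.
by rewrite ler_pM2l.
Qed.

Lemma measurable_cancelling_weight d (T : measurableType d) n (k0 : 'I_n) t
    (z : T -> n.-tuple R[i]) (g : T -> n.-tuple R) :
  measurable_fun setT z ->
  (forall k, k != k0 -> measurable_fun setT (fun w => tnth (g w) k)) ->
  measurable_fun setT (fun w => cancelling_weight k0 t (z w) (g w)).
Proof.
move=> mz mg.
have mzk k : measurable_fun setT (fun w => tnth (z w) k).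
  exact: (measurableT_comp (measurable_tnth k) mz).
have mRe k : measurable_fun setT (fun w => Re (t - tnth (z w) k)).
  under eq_fun do rewrite Re_subE.
  apply: measurable_funB => //; apply: measurableT_comp (mzk k).
  apply: continuous_measurable_complex. exact: continuous_Re.
have mIm k : measurable_fun setT (fun w => Im (t - tnth (z w) k)).
  under eq_fun do rewrite Im_subE.
  apply: measurable_funB => //; apply: measurableT_comp (mzk k).
  exact: continuous_measurable_complex continuous_Im.
rewrite /cancelling_weight; apply: measurable_funN.
under eq_fun do rewrite big_mkcond.
apply: measurable_sum => k; case: (boolP (k != k0)) => kk0; last exact: measurable_cst.
apply: measurable_funM; first exact: mg.
under eq_fun => w.
  rewrite Re_divE normc_sqr.
  rewrite -powR_inv1 ?addr_ge0 ?sqr_ge0//.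
  over.
apply: measurable_funM; first by apply: measurable_funD; exact: measurable_funM.
apply: (measurableT_comp (measurable_powR _)).
by apply: measurable_funD; exact: measurable_funX.
Qed.

End cancellation.

Section no_cancellation.
Context {R : realType} d (T : measurableType d) (P : probability T R).
Variables (n m : nat) (gam : forall j, {RV P >-> (n.+1 - j)%N.-tuple R})
  (Z : forall j, {RV P >-> (n - j)%N.-tuple R[i]}).

Let D := [set i : {j : nat & 'I_(n.+1 - j)} | (1 <= tag i <= m)%N].
Let X (i : {j : nat & 'I_(n.+1 - j)}) w := tnth (gam (tag i) w) (tagged i).
Let Y (k : 'I_(n - 0)) w := tnth (Z 0%N w) k.

Hypothesis indX : mutually_independent P D X.
Hypothesis indXY : independent_families P D setT X Y.
Hypothesis labels : forall j, (j < m)%N ->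
  exists2 label : (n - j)%N.-tuple R[i] * (n - j)%N.-tuple R -> (n - j.+1)%N.-tuple R[i],
    measurable_fun setT label &
    {ae P, forall w, Z j.+1 w = label (Z j w, gam j.+1 w)}.

(** The labels are only almost surely measurable functions of the past; iterating them from
    the initial zeros gives versions that are measurable with respect to the weights of
    the earlier steps and the initial zeros, hence to everything but a later weight. *)
Lemma zeros_measurable_version j : (j <= m)%N ->
  exists Zt : T -> (n - j)%N.-tuple R[i],
    (forall i0 : {j : nat & 'I_(n.+1 - j)}, (j < tag i0)%N ->
      measurable_fun (setT : set (g_sigma_algebraType (other_events D X Y i0))) Zt) /\
    {ae P, forall w, Z j w = Zt w}.
Proof.
elim: j => [_|j IH jm].
  exists (Z 0%N); split; last exact: aeW.
  move=> i0 _; apply/measurable_fun_tnthP => k _ B mB; rewrite setTI.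
  by apply: sub_sigma_algebra; right; exists k => //; exists B => //; rewrite setTI.
have [Zt [mZt aeZ]] := IH (ltnW jm).
have [label mlabel aelabel] := labels jm.
exists (fun w => label (Zt w, gam j.+1 w)); split.
  move=> i0 ji0; apply: (measurableT_comp mlabel).
  apply: measurable_fun_pair; first by apply: mZt; exact: ltnW.
  apply/measurable_fun_tnthP => k _ B mB; rewrite setTI.
  apply: sub_sigma_algebra; left; exists (Tagged (fun j => 'I_(n.+1 - j)) (k : 'I_(n.+1 - j.+1))).
    split=> //= ii0; move: ji0; rewrite -ii0/= ltnn//.
  by exists B => //; rewrite setTI.
by move: aeZ aelabel; apply: filterS2 => w -> ->.
Qed.

Lemma no_cancellation j t (e rho q : R) : (j < m)%N -> (j < n)%N ->
  0 < e -> 0 < rho ->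
  (forall k x, (P ((fun w => tnth (gam j.+1 w) k) @^-1` `[x, (x + 3 * (e * rho))%R]) <= q%:E)%E) ->
  exists F : set T, [/\ measurable F, (P F <= q%:E)%E &
    {ae P, forall w, (forall k, normc (t - tnth (Z j w) k) <= rho) ->
      normc (randomized_derivative (Z j w) (gam j.+1 w)).[t] <
        e * \prod_(k < n - j) normc (t - tnth (Z j w) k) -> F w}].
Proof.
move=> jm jn e0 rho0 small.
have [Zt [mZt aeZ]] := zeros_measurable_version (ltnW jm).
have nj : (0 < n - j)%N by lia.
pose k0 := Ordinal nj.
pose i0 : {j : nat & 'I_(n.+1 - j)} := Tagged (fun j => 'I_(n.+1 - j)) (k0 : 'I_(n.+1 - j.+1)).
pose W w := cancelling_weight (k0 : 'I_(n - j)) t (Zt w) (gam j.+1 w).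
have mX i : D i -> measurable_fun setT (X i).
  by move=> _; apply: (measurableT_comp (measurable_tnth _)); exact: measurable_funPT.
have mY k : measurable_fun setT (Y k).
  by apply: (measurableT_comp (measurable_tnth _)); exact: measurable_funPT.
have Di0 : D i0 by rewrite /D/=; lia.
have mWo : measurable_fun (setT : set (g_sigma_algebraType (other_events D X Y i0))) W.
  apply: measurable_cancelling_weight; first exact: mZt.
  move=> k kk0 _ B mB; rewrite setTI.
  apply: sub_sigma_algebra; left; exists (Tagged (fun j => 'I_(n.+1 - j)) (k : 'I_(n.+1 - j.+1))).
    split=> //= kE; move/negP: kk0; apply.
    move: kE => /eqP; rewrite -tag_eqE /tag_eq /= eqxx/= tagged_asE.
    by move=> /eqP ->.
  by exists B => //; rewrite setTI.
have sub : other_events D X Y i0 `<=` measurable.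
  move=> _ [[i [Di _] [B mB <-]]|[k _ [B mB <-]]]; first exact: mX.
  exact: mY.
have mW : measurable_fun setT W.
  move=> _ B mB; have := mWo measurableT B mB; rewrite setTI => WB.
  apply: smallest_sub WB => //; exact: sigma_algebra_measurable.
have e3 : 0 < e * rho by rewrite mulr_gt0.
exists [set w | (`|X i0 w - W w| < e * rho)%R]; split.
- rewrite (_ : [set _ | _] = (fun w => `|X i0 w - W w|) @^-1` `]-oo, e * rho[%classic).
    rewrite -[_ @^-1` _]setTI; suff : measurable_fun setT (fun w => `|X i0 w - W w|) by exact.
    apply: measurableT_comp => //; apply: measurable_funB => //; exact: mX.
  by apply/seteqP; split => w /=; rewrite in_itv.
- apply: anti_concentration => //; first exact: mX.
  + move=> A B mA mB; apply: (independent_of_others mX mY indX indXY Di0 mB).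
    by have := mWo measurableT A mA; rewrite setTI.
  + exact: small.
- move: aeZ; apply: filterS => w ZE zrho lt.
  by rewrite /= /W -ZE; apply: cancelling_weight_near.
Qed.

End no_cancellation.

(** * Almost sure bounds on the initial zeros and on the weights *)

Section almost_sure_bounds.
Context {R : realType} d (Omega : measurableType d) (P : probability Omega R).

Lemma ler_natX (n : nat) (i j : nat) : (0 < n)%N -> (i <= j)%N ->
  n%:R ^+ i <= n%:R ^+ j :> R.
Proof. by move=> n0 ij; rewrite ler_weXn2l// ler1n. Qed.

(** The supremum is finite, and dominates each of its terms. *)
Lemma polynomial_tailP (mu : probability R[i] R) (c : R) :
  (ereal_sup [set (r `^ c)%:E * mu [set z : R[i] | (r%:C < `|z|)%R] |
        r in [set r : R | (1 <= r)%R]] < +oo)%E ->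
  exists2 K, 0 <= K & forall r, 1 <= r ->
    (mu [set z : R[i] | (r < normc z)%R] <= (K / r `^ c)%:E)%E.
Proof.
set S := [set _ | _ in _] => Soo.
have le_sup r : 1 <= r -> (((r `^ c)%:E * mu [set z : R[i] | (r%:C < `|z|)%R]) <= ereal_sup S)%E.
  by move=> r1; apply: ereal_sup_ubound; exists r.
have sup0 : (0 <= ereal_sup S)%E.
  by apply: le_trans (le_sup 1 (lexx _)); rewrite mule_ge0// lee_fin powR_ge0.
have supE : ereal_sup S = (fine (ereal_sup S))%:E by rewrite fineK// ge0_fin_numE.
exists (fine (ereal_sup S)); first exact: fine_ge0.
move=> r r1; have := le_sup r r1.
have -> : [set z : R[i] | (r%:C < `|z|)%R] = [set z : R[i] | (r < normc z)%R].
  by apply/seteqP; split => z /=; rewrite normE ltcR.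
have r0 : 0 < r `^ c by rewrite powR_gt0// (lt_le_trans _ r1).
by rewrite {1}supE muleC EFinM -lee_pdivlMr.
Qed.

(** With [C c >= 3] each of the [n] zeros exceeds [n^C] with probability [O(n^-3)]. *)
Lemma initial_zeros_bounded (mu : probability R[i] R) (c : R)
    (Z0 : forall n : nat, Omega -> (n - 0)%N.-tuple R[i]) :
  0 < c ->
  (ereal_sup [set (r `^ c)%:E * mu [set z : R[i] | (r%:C < `|z|)%R] |
        r in [set r : R | (1 <= r)%R]] < +oo)%E ->
  (forall n, measurable_fun setT (Z0 n)) ->
  (forall n, (2 <= n)%N -> forall (k : 'I_(n - 0)) (A : set R[i]), measurable A ->
      P ((fun w => tnth (Z0 n w) k) @^-1` A) = mu A) ->
  exists C : nat, (0 < C)%N /\ {ae P, forall w, \forall n \near \oo,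
    forall k, normc (tnth (Z0 n w) k) <= n%:R ^+ C}.
Proof.
move=> c0 tail mZ law; have [K K0 Kr] := polynomial_tailP tail.
pose C := (Num.truncn (3 / c)).+1.
have Cc : 3 <= C%:R * c.
  by rewrite -ler_pdivrMr// ltW// truncnS_gt.
exists C; split => //.
pose A n : set R[i] := [set z | n%:R ^+ C < normc z].
have mA n : measurable (A n).
  have := @measurable_normc_sub R 0 measurableT _ (measurable_itv `]n%:R ^+ C, +oo[).
  rewrite setTI; congr (measurable _); apply/seteqP; split => z /=.
    by rewrite in_itv/= andbT subr0.
  by rewrite in_itv/= andbT subr0.
pose F n (k : 'I_(n - 0)) := (fun w => tnth (Z0 n w) k) @^-1` A n.
have av : {ae P, forall w, \forall n \near \oo, forall k, ~ F n k w}.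
  apply: (@ae_eventually_avoid _ _ _ P (fun n => 'I_(n - 0)) F (fun n => K / n%:R ^+ 3) K 2).
  - move=> n k _; rewrite -[F n k]setTI.
    exact: (measurableT_comp (measurable_tnth k) (mZ n)).
  - move=> n k n2; rewrite /F law//.
    have n1 : 1 <= n%:R :> R by rewrite ler1n ltnW.
    have n0 : 0 < n%:R :> R by exact: lt_le_trans n1.
    apply: (le_trans (Kr _ _)); first by rewrite exprn_ege1.
    rewrite lee_fin ler_wpM2l// lef_pV2 ?posrE ?powR_gt0 ?exprn_gt0//.
    rewrite -[n%:R ^+ C]powR_mulrn ?ler0n// -powRrM -powR_mulrn ?ler0n//.
    exact: ler_powR.
  - move=> n n2; rewrite card_ord subn0.
    have n0 : n%:R != 0 :> R by rewrite pnatr_eq0; lia.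
    by rewrite [leLHS](_ : _ = K / n%:R ^+ 2)//; field.
move: av; apply: filterS => w; apply: filterS => n nF k.
by rewrite leNgt; apply/negP; exact: nF.
Qed.

Lemma weights_bounded (a : R) (m : nat -> nat)
    (gam : forall n j : nat, {RV P >-> (n.+1 - j)%N.-tuple R}) : 0 < a ->
  (forall n, (2 <= n)%N -> (m n < n)%N) ->
  (forall n, (2 <= n)%N -> forall j, (1 <= j <= m n)%N -> forall k : 'I_(n.+1 - j),
      has_gamma_law P a (fun w => tnth (gam n j w) k)) ->
  {ae P, forall w, \forall n \near \oo, forall j, (j < m n)%N ->
    forall k, 0 < tnth (gam n j.+1 w) k <= n%:R}.
Proof.
move=> a0 mn law; have [K K0 Kt] := gamma_law_tail P 4 a0.
pose B n : set R := `]-oo, 0]%classic `|` `[n%:R, +oo[%classic.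
pose F n (p : 'I_n * 'I_n) : set Omega := 
  if insub (nat_of_ord p.2) : option 'I_(n.+1 - p.1.+1) is Some k then
    if (p.1 < m n)%N then (fun w => tnth (gam n p.1.+1 w) k) @^-1` B n else set0
  else set0.
have mB n : measurable (B n) by exact: measurableU.
have mg n j k : measurable_fun setT (fun w => tnth (gam n j w) k).
  by apply: (measurableT_comp (measurable_tnth _)); exact: measurable_funPT.
have av : {ae P, forall w, \forall n \near \oo, forall k, ~ F n k w}.
  apply: (@ae_eventually_avoid _ _ _ P (fun n => ('I_n * 'I_n)%type) F (fun n => K / n%:R ^+ 4) K 2).
  - move=> n [j k] _; rewrite /F/=; case: insub => [k'|//]; case: ifP => // _.
    by rewrite -[_ @^-1` _]setTI; exact: mg.
  - move=> n [j k] n2; rewrite /F/=.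
    have n1 : 1 <= n%:R :> R by rewrite ler1n ltnW.
    have b0 : (0 <= (K / n%:R ^+ 4)%:E)%E by rewrite lee_fin divr_ge0// exprn_ge0.
    case: insub => [k'|]; last by rewrite measure0.
    case: ifP => jm; last by rewrite measure0.
    have lawk := law n n2 j.+1 (jm : (1 <= j.+1 <= m n)%N) k'.
    rewrite preimage_setU; apply: (le_trans (measureU2 _ _ _)).
    + by rewrite -[_ @^-1` _]setTI; exact: mg.
    + by rewrite -[_ @^-1` _]setTI; exact: mg.
    rewrite [X in (X + _)%E](gamma_law_npos lawk) add0e.
    exact: Kt.
  - move=> n n2; rewrite card_prod !card_ord.
    have n0 : n%:R != 0 :> R by rewrite pnatr_eq0; lia.
    by rewrite natrM [leLHS](_ : _ = K / n%:R ^+ 2)//; field.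
move: av; apply: filterS => w [N _ NF]; exists (maxn N 2) => // n /= Nn j jm k.
have n2 : (2 <= n)%N by lia.
have jn : (j < n)%N by have := mn n n2; lia.
have kn : (k < n)%N by have := ltn_ord k; lia.
have := NF n _ (Ordinal jn, Ordinal kn); rewrite /F /= jm.
have -> : insub (k : nat) = Some k :> option 'I_(n.+1 - j.+1).
  exact: valK.
move=> h; apply/andP; split.
  by rewrite ltNge; apply/negP => g0; apply: h; [rewrite /=; lia|left; rewrite /= in_itv].
apply/ltW; rewrite ltNge; apply/negP => g0; apply: h; first by rewrite /=; lia.
by right; rewrite /= in_itv/= g0.
Qed.

End almost_sure_bounds.

(** * Almost sure comparison of the potentials *)

Section iterated_derivatives.
Context {R : realType} d (Omega : measurableType d) (P : probability Omega R).
Context (m : nat -> nat)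
    (gam : forall n j : nat, {RV P >-> (n.+1 - j)%N.-tuple R})
    (Z : forall n j : nat, {RV P >-> (n - j)%N.-tuple R[i]}).

Hypothesis m_lt : forall n, (2 <= n)%N -> (m n < n)%N.
Hypothesis zerosZ : forall n j, (2 <= n)%N -> (j < m n)%N ->
    {ae P, forall w, zeros_with_multiplicity
      (randomized_derivative (Z n j w) (gam n j.+1 w)) (Z n j.+1 w)}.

Lemma ae_zeros : {ae P, forall w, forall n j, (2 <= n)%N -> (j < m n)%N ->
  zeros_with_multiplicity
      (randomized_derivative (Z n j w) (gam n j.+1 w)) (Z n j.+1 w)}.
Proof.
apply: ae_foralln => n; apply: ae_foralln => j.
have [n2|n2] := leqP 2 n; last by apply: aeW.
have [jm|jm] := ltnP j (m n); last by apply: aeW.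
by move: (zerosZ n2 jm); apply: filterS.
Qed.

Lemma all_zeros_bounded (C : nat) :
  {ae P, forall w, \forall n \near \oo,
    forall k, normc (tnth (Z n 0 w) k) <= n%:R ^+ C} ->
  {ae P, forall w, \forall n \near \oo, forall j, (j < m n)%N ->
    forall k, 0 < tnth (gam n j.+1 w) k <= n%:R} ->
  {ae P, forall w, \forall n \near \oo, forall j, (j <= m n)%N ->
    forall k, normc (tnth (Z n j w) k) <= n%:R ^+ C}.
Proof.
move=> b0 g0; have zz := ae_zeros.
move: b0 g0 zz; apply: filterS3 => w [N _ NZ] [N' _ Ng] zz.
exists (maxn 2 (maxn N N')) => // n /= Nn.
have n2 : (2 <= n)%N by lia.
elim=> [_|j IH jm]; first by apply: NZ; rewrite /=; lia.
have jn : (j < n)%N by have := m_lt n2; lia.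
apply: (@gauss_lucas_disc _ _ _ (Z n j w) (gam n j.+1 w)).
- lia.
- by move=> k; have /andP[] := Ng n (ltac:(rewrite /=; lia)) j jm k.
- exact: zz.
- by apply: IH; lia.
Qed.

Lemma le_grid_size (n : nat) : (0 < n)%N -> (grid_size n <= 3 * n ^ 2)%N.
Proof. by rewrite /grid_size => n0; have := @muln_gt0 n n; rewrite n0 -mulnn; nia. Qed.

Lemma size_circle_grid n (a : R[i]) r : (0 < n)%N ->
  size (circle_grid n a r) = (grid_size n * n)%N.
Proof.
move=> n0; rewrite size_allpairs_dep sumnE big_map.
under eq_bigr do rewrite size_roots_of//.
by rewrite big_const_seq count_predT size_enum_ord iter_addn_0 mulnC.
Qed.

Lemma normc_circle_grid n (a z : R[i]) r : (0 < n)%N -> 0 <= r ->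
  z \in circle_grid n a r -> normc z <= normc a + r.
Proof.
move=> n0 r0 /allpairsPdep[t [x [_ xr ->]]].
apply: (le_trans (normcD _ _)); rewrite lerD2l normcM normc_real ger0_norm//.
by rewrite (normc_roots_of n0 _ xr) ?mulr1// normc_circle_point.
Qed.

Context (b : R).
Hypothesis b0 : 0 < b.
Hypothesis gam_law : forall n, (2 <= n)%N ->
    mutually_independent P
      [set i : {j : nat & 'I_(n.+1 - j)} | (1 <= tag i <= m n)%N]
      (fun i w => tnth (gam n (tag i) w) (tagged i)) /\
    forall j, (1 <= j <= m n)%N -> forall k : 'I_(n.+1 - j),
      has_gamma_law P b (fun w => tnth (gam n j w) k).
Hypothesis gam_indep : forall n, (2 <= n)%N ->
    independent_families P
      [set i : {j : nat & 'I_(n.+1 - j)} | (1 <= tag i <= m n)%N]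
      [set: 'I_(n - 0)]
      (fun i w => tnth (gam n (tag i) w) (tagged i))
      (fun k w => tnth (Z n 0%N w) k).
Hypothesis labels : forall n j, (2 <= n)%N -> (j < m n)%N ->
    exists2 label : (n - j)%N.-tuple R[i] * (n - j)%N.-tuple R ->
        (n - j.+1)%N.-tuple R[i],
      measurable_fun setT label &
      {ae P, forall w, Z n j.+1 w = label (Z n j w, gam n j.+1 w)}.

Lemma ae_all_nat_fin (I : nat -> finType) (Q : forall n, I n -> Omega -> Prop) :
  (forall n i, {ae P, forall w, Q n i w}) -> {ae P, forall w, forall n i, Q n i w}.
Proof.
move=> H; apply: ae_foralln => n; apply: filter_forall => i; exact: H.
Qed.

(** There are [O(n^4)] pairs of a step and a grid point; the exponent [E] makes the
    probability of a cancellation [O(n^-6)] for each of them. *)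
Lemma no_cancellation_on_grid (C : nat) (a : R[i]) (r : R) : (0 < C)%N -> 0 < r ->
  {ae P, forall w, \forall n \near \oo, forall j, (j <= m n)%N ->
    forall k, normc (tnth (Z n j w) k) <= n%:R ^+ C} ->
  exists E : nat, {ae P, forall w, \forall n \near \oo, forall j, (j < m n)%N ->
    forall z, z \in circle_grid n a r ->
      n%:R ^- E * \prod_(k < n - j) normc (z - tnth (Z n j w) k) <=
      normc (randomized_derivative (Z n j w) (gam n j.+1 w)).[z]}.
Proof.
move=> C0 r0 Zb; have [K K0 Kw] := gamma_law_window P b0.
pose B := (Num.truncn (6 / b)).+1.
have Bb : 6 <= B%:R * b by rewrite -ler_pdivrMr// ltW// truncnS_gt.
(* [n^-B] is the threshold below which the mass of the Gamma law is [O(n^-6)]; [C.+1] is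
   the exponent of the distances to the zeros. *)
pose E := (C.+1 + B + 6)%N; exists E.
pose I n : finType := ('I_n * 'I_(size (circle_grid n a r)))%type.
pose rho n : R := n%:R ^+ C.+1.
pose q n : R := 4 * K / n%:R ^+ 6.
have ex n (p : I n) : exists F : set Omega, (2 <= n)%N ->
    [/\ measurable F, (P F <= (q n)%:E)%E &
     (p.1 < m n)%N -> {ae P, forall w,
      (forall k, normc ((circle_grid n a r)`_p.2 - tnth (Z n p.1 w) k) <= rho n) ->
      normc (randomized_derivative (Z n p.1 w) (gam n p.1.+1 w)).[(circle_grid n a r)`_p.2] <
        n%:R ^- E * \prod_(k < n - p.1) normc ((circle_grid n a r)`_p.2 - tnth (Z n p.1 w) k) ->
      F w}].
  case: p => j i /=.
  have [n2|n2] := leqP 2 n; last by exists set0.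
  have n0 : 0 < n%:R :> R by rewrite ltr0n; lia.
  have [jm|jm] := ltnP j (m n); last first.
    by exists set0 => _; split => //; rewrite measure0 lee_fin divr_ge0// ?mulr_ge0// exprn_ge0// ltW.
  have [indX law] := gam_law n2.
  have [||k x|F [mF PF aeF]] := no_cancellation indX (gam_indep n2)
    (fun j => @labels n j n2) ((circle_grid n a r)`_i) (e := n%:R ^- E) (rho := rho n)
    (q := q n) jm (ltn_ord j).
  - by rewrite invr_gt0 exprn_gt0.
  - by rewrite exprn_gt0.
  - have mg : measurable_fun setT (fun w => tnth (gam n j.+1 w) k).
      by apply: (measurableT_comp (measurable_tnth _)); exact: measurable_funPT.
    have lawk := law j.+1 (jm : (1 <= j.+1 <= m n)%N) k.
    have s0 : 0 < n%:R ^- B :> R by rewrite invr_gt0 exprn_gt0.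
    apply: (le_trans (Kw _ mg lawk x _ _ _ s0)).
      by rewrite !mulr_ge0// ?invr_ge0 exprn_ge0// ltW.
    have -> : q n = K * (4 / n%:R ^+ 6) by rewrite /q mulrAC mulrC.
    rewrite lee_fin ler_wpM2l//.
    have h1 : (n%:R ^- B) `^ b <= n%:R ^- 6 :> R.
      rewrite -powR_invn ?ler0n// -powRrM mulNr powRN lef_pV2 ?posrE ?powR_gt0 ?exprn_gt0//.
      by rewrite -[leLHS]powR_mulrn ?ler0n// ler_powR// ler1n; lia.
    have -> : 3 * (n%:R ^- E * rho n) / n%:R ^- B = 3 * n%:R ^- 6.
      rewrite /rho /E !exprD; field; rewrite !expf_neq0 ?gt_eqF//.
    rewrite (_ : 4 / n%:R ^+ 6 = n%:R ^- 6 + 3 * n%:R ^- 6); last by field; rewrite gt_eqF.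
    by rewrite lerD2r.
  by exists F.
pose F n (p : I n) := projT1 (cid (ex n p)).
have FP n p := projT2 (cid (ex n p)).
have avoid : {ae P, forall w, \forall n \near \oo, forall p : I n, ~ F n p w}.
  apply: (@ae_eventually_avoid _ _ _ P I F q (12 * K) 2).
  - by move=> n p n2; have [] := FP n p n2.
  - by move=> n p n2; have [] := FP n p n2.
  - move=> n n2; have n0 : (0 < n)%N by lia.
    rewrite card_prod !card_ord size_circle_grid//.
    have nR : 0 < n%:R :> R by rewrite ltr0n.
    have : (n * (grid_size n * n))%:R <= 3 * n%:R ^+ 4 :> R.
      rewrite -natrX -natrM ler_nat; have := le_grid_size n0; nia.
    move/ler_wpM2r => /(_ (q n)) h; apply: (le_trans (h _)).
      by rewrite divr_ge0// ?mulr_ge0// exprn_ge0// ltW.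
    rewrite [leLHS](_ : _ = 12 * K / n%:R ^+ 2)// /q; field.
    by rewrite ?expf_neq0 ?gt_eqF.
have impl : {ae P, forall w, forall n (p : I n), (2 <= n)%N -> (p.1 < m n)%N ->
      (forall k, normc ((circle_grid n a r)`_p.2 - tnth (Z n p.1 w) k) <= rho n) ->
      normc (randomized_derivative (Z n p.1 w) (gam n p.1.+1 w)).[(circle_grid n a r)`_p.2] <
        n%:R ^- E * \prod_(k < n - p.1) normc ((circle_grid n a r)`_p.2 - tnth (Z n p.1 w) k) ->
      F n p w}.
  apply: ae_all_nat_fin => n p.
  have [n2|n2] := leqP 2 n; last by apply: aeW.
  have [pm|pm] := ltnP p.1 (m n); last by apply: aeW.
  by have [_ _ /(_ pm)] := FP n p n2; apply: filterS => w h _ _; exact: h.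
move: Zb avoid impl; apply: filterS3 => w [N1 _ Zb] [N2 _ NF] impl.
exists (maxn (maxn N1 N2) (maxn 2 (Num.truncn (normc a + r)).+1)) => // n /=.
rewrite !geq_max => /andP[/andP[N1n N2n] /andP[n2 ar_n]].
have n0 : (0 < n)%N := ltnW n2.
have nR : 0 < n%:R :> R by rewrite ltr0n.
move=> j jm z zg; rewrite leNgt; apply/negP => lt.
have jn : (j < n)%N := ltn_trans jm (m_lt n2).
have zi : (index z (circle_grid n a r) < size (circle_grid n a r))%N by rewrite index_mem.
have zE : (circle_grid n a r)`_(index z (circle_grid n a r)) = z by rewrite nth_index.
apply: (NF n N2n (Ordinal jn, Ordinal zi)).
apply: impl => //; rewrite /= zE// => k.
apply: (le_trans (normcD _ _)); rewrite normcNE.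
have h1 : normc z <= n%:R.
  apply: (le_trans (normc_circle_grid n0 (ltW r0) zg)).
  by rewrite (le_trans (ltW (truncnS_gt _)))// ler_nat.
have h2 : normc (tnth (Z n j w) k) <= n%:R ^+ C by exact: (Zb n N1n j (ltnW jm)).
apply: (le_trans (lerD h1 h2)); rewrite /rho exprS.
have nC : n%:R <= n%:R ^+ C :> R by rewrite -[leLHS]expr1 ler_natX.
apply: (@le_trans _ _ (2 * n%:R ^+ C)); first by rewrite mulr_natl mulr2n lerD2r.
by rewrite ler_wpM2r ?exprn_ge0 ?ler0n// ler_nat.
Qed.

Lemma ln_le_mul_ln (n k : nat) (x : R) : (0 < n)%N -> 0 < x -> x <= n%:R ^+ k ->
  ln x <= k%:R * ln n%:R.
Proof.
move=> n0 x0 xn; apply: (le_trans (ler_ln_le x0 xn)).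
by rewrite lnXn ?ltr0n// mulr_natl.
Qed.

Hypothesis m_gt0 : forall n, (2 <= n)%N -> (0 < m n)%N.
Hypothesis m_small : (fun n => (m n)%:R / (n%:R / ln n%:R) : R) @ \oo --> (0 : R).

(** All the constants of the deterministic comparison are powers of [n], so that the bound is
    a multiple of [m n * ln n]. *)
Lemma log_max_means_close (C : nat) (a : R[i]) (r : R) : (0 < C)%N -> 0 < r ->
  {ae P, forall w, \forall n \near \oo,
    forall k, normc (tnth (Z n 0 w) k) <= n%:R ^+ C} ->
  {ae P, forall w, (fun n => (\sum_(k < n - m n) log_max r (tnth (Z n (m n) w) k - a) -
     \sum_(k < n - 0) log_max r (tnth (Z n 0%N w) k - a)) / n%:R : R) @ \oo --> (0 : R)}.
Proof.
move=> C0 r0 Zb0.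
have gb := weights_bounded b0 m_lt (fun n n2 => (gam_law n2).2).
have Zb := all_zeros_bounded Zb0 gb.
have [E nc] := no_cancellation_on_grid a C0 r0 Zb.
have zz := ae_zeros.
move: gb nc zz; apply: filterS3 => w [N1 _ gb] [N2 _ nc] zz.
suff key : \forall n \near \oo,
    `|\sum_(k < n - m n) log_max r (tnth (Z n (m n) w) k - a) -
     \sum_(k < n - 0) log_max r (tnth (Z n 0%N w) k - a)| <= 
     (E + 19)%:R * (m n)%:R * ln n%:R :> R.
  apply/cvgrPdist_lt => e e0.
  have E0 : 0 < (E + 19)%:R :> R by rewrite ltr0n; lia.
  have e1 : 0 < e / (E + 19)%:R by rewrite divr_gt0.
  have /cvgrPdist_lt/(_ _ e1) := m_small.
  move: key; apply: filterS2 => n key.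
  rewrite !sub0r !normrN.
  have [->|n0] := posnP n; first by move=> _; rewrite invr0 mulr0 normr0.
  have nR : 0 < n%:R :> R by rewrite ltr0n.
  rewrite invf_div ltr_pdivlMr// => lt; apply: le_lt_trans lt.
  rewrite normrM (@ger0_norm _ n%:R^-1) ?invr_ge0// ler_pdivrMr//.
  apply: (le_trans key); rewrite ger0_norm; last first.
    by rewrite mulr_ge0// divr_ge0// ln_ge0// ler1n.
  rewrite [leRHS](_ : _ = (E + 19)%:R * (m n)%:R * ln n%:R)//.
  by field; rewrite gt_eqF.
exists (maxn (maxn N1 N2) (maxn 2 (Num.truncn r^-1).+1)) => // n /=.
rewrite !geq_max => /andP[/andP[n1N n2N] /andP[n2 r_n]].
have n0 : (0 < n)%N := ltnW n2.
have nR : 0 < n%:R :> R by rewrite ltr0n.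
have rn : r^-1 <= n%:R.
  by rewrite (le_trans (ltW (truncnS_gt _)))// ler_nat.
have L0 : 0 <= ln n%:R :> R by rewrite ln_ge0// ler1n.
have M0 : 0 < (grid_size n)%:R :> R by rewrite ltr0n.
have := @log_max_sum_comparison R n (m n) (fun j => Z n j w) (fun j => gam n j w)
  a r (n%:R ^- E) n%:R ((E + 7)%:R * ln n%:R) (m_lt n2) r0.
have H1 : 0 < n%:R ^- E :> R by rewrite invr_gt0 exprn_gt0.
have H2 j : (j < m n)%N -> forall k, 0 < tnth (gam n j.+1 w) k <= n%:R.
  by move=> jm k; exact: gb.
have H3 : ln (2 * n%:R * (grid_size n)%:R / r) <= (E + 7)%:R * ln n%:R :> R.
  apply: (@le_trans _ _ (7%:R * ln n%:R)); last by rewrite ler_wpM2r// ler_nat leq_addl.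
  apply: ln_le_mul_ln => //; first by rewrite divr_gt0// !mulr_gt0.
  apply: (@le_trans _ _ ((2 * n * grid_size n)%:R * n%:R)).
    by rewrite !natrM ler_wpM2l// !mulr_ge0.
  rewrite -natrM -natrX ler_nat.
  apply: (@leq_trans (2 * n * (3 * n ^ 2) * n)).
    by rewrite leq_mul// leq_mul// le_grid_size.
  rewrite (_ : _ * _ * n = 6 * n ^ 4)%N; last by ring.
  rewrite (expnD n 3 4) leq_mul//.
  by apply: (@leq_trans (2 ^ 3)) => //; rewrite leq_exp2r.
have H4 : ln (n%:R * n%:R / n%:R ^- E) <= (E + 7)%:R * ln n%:R :> R.
  apply: ln_le_mul_ln => //; first by rewrite divr_gt0// mulr_gt0.
  by rewrite invrK -expr2 -exprD ler_natX// addnC leq_add2l.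
move=> /(_ H1 H2 (fun j jm => zz n j n2 jm) (nc n n2N) H3 H4) h.
apply: (le_trans h).
have H5 : ln (4 * (grid_size n)%:R) <= 6%:R * ln n%:R :> R.
  apply: ln_le_mul_ln => //; first by rewrite mulr_gt0.
  rewrite -natrM -natrX ler_nat.
  apply: (@leq_trans (4 * (3 * n ^ 2))); first by rewrite leq_mul// le_grid_size.
  rewrite mulnA (expnD n 4 2) leq_mul//.
  by apply: (@leq_trans (2 ^ 4)) => //; rewrite leq_exp2r.
have m1 : 1 <= (m n)%:R :> R by rewrite ler1n m_gt0.
rewrite (natrD _ E 19) (natrD _ E 7).
have : ln n%:R <= (m n)%:R * ln n%:R :> R by rewrite ler_peMl.
move: H5; set l := ln n%:R; set M := (m n)%:R; set e := E%:R; set g := ln _ => H5 h'.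
rewrite (_ : M * ((e + 7) * l) = e * (M * l) + 7 * (M * l)); last by ring.
rewrite (_ : (e + 19) * M * l = e * (M * l) + 19 * (M * l)); last by ring.
lra.
Qed.

End iterated_derivatives.

(** * Chernoff bound *)

Lemma prod_if_mem (R : comPzSemiRingType) (I : finType) (S : {set I}) (x y : R) :
  \prod_i (if i \in S then x else y) = x ^+ #|S| * y ^+ #|~: S|.
Proof.
rewrite (bigID (mem S))/=; congr (_ * _).
  by rewrite (eq_bigr (fun=> x)) ?prodr_const// => k ->.
rewrite (eq_bigr (fun=> y)); last by move=> k /negPf ->.
by rewrite prodr_const; congr (_ ^+ _); apply: eq_card => k; rewrite !inE.
Qed.

Section chernoff.
Context {R : realType} d d1 (Omega : measurableType d) (T : measurableType d1)
  (P : probability Omega R) (mu : probability T R).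
Context (N : nat) (X : 'I_N -> Omega -> T).
Hypothesis mX : forall k, measurable_fun setT (X k).
Hypothesis indX : mutually_independent P setT X.
Hypothesis lawX : forall k A, measurable A -> P (X k @^-1` A) = mu A.

Definition hits (A : set T) w : {set 'I_N} := finset (fun k => X k w \in A).

(** Independence is used for the events [X k \in A] and [X k \notin A] only, which makes the
    number of hits binomial without any computation of expectations. *)
Lemma probability_hits (A : set T) (S : {set 'I_N}) : measurable A ->
  measurable [set w | hits A w = S] /\
  P [set w | hits A w = S] =
    ((fine (mu A)) ^+ #|S| * (1 - fine (mu A)) ^+ #|~: S|)%:E.
Proof.
move=> mA; pose E k := if k \in S then A else ~` A.
have mE k : measurable (E k) by rewrite /E; case: ifP => // _; exact: measurableC.
pose J : {fset 'I_N} := [fset k in enum 'I_N]%fset.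
have -> : [set w | hits A w = S] = \bigcap_(k in [set` J]) X k @^-1` E k.
  apply/seteqP; split => w /=.
    move=> hS k _; rewrite /E -hS inE; case: ifPn => [/set_mem//|].
    by move=> kA /mem_set; rewrite (negPf kA).
  move=> wE; apply/setP => k; rewrite inE; have := wE k; rewrite /E /= inE mem_enum => /(_ isT).
  by case: ifPn => [_ /mem_set//|_ kA]; apply/negP => /set_mem.
split.
  apply: fin_bigcap_measurable => // k _; rewrite -[_ @^-1` _]setTI; exact: mX.
rewrite indX//.
have -> : (\prod_(i <- J) P (X i @^-1` E i) = \prod_(i : 'I_N) P (X i @^-1` E i))%E.
  rewrite -big_enum; apply: perm_big; apply: uniq_perm; rewrite ?fset_uniq ?enum_uniq//.
  by move=> k; rewrite inE.
have pE k : P (X k @^-1` E k) = (if k \in S then fine (mu A) else 1 - fine (mu A))%:E.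
  rewrite lawX// /E; case: ifP => _; first by rewrite fineK// fin_num_measure.
  by rewrite probability_setC// EFinB fineK// fin_num_measure.
under eq_bigr do rewrite pE.
by rewrite prodEFin prod_if_mem.
Qed.

Lemma expR_le_quadratic (t : R) : 0 <= t <= 2^-1 -> expR t <= 1 + t + 2 * t ^+ 2.
Proof.
move=> /andP[t0 t1]; have h1 : 0 < 1 - t by lra.
have := expR_ge1Dx (- t); rewrite expRN => h.
apply: (@le_trans _ _ (1 - t)^-1).
  by rewrite -[expR t]invrK lef_pV2 ?posrE// invr_gt0 expR_gt0.
rewrite -[leLHS]mul1r ler_pdivrMr// -subr_ge0.
rewrite (_ : _ - 1 = t ^+ 2 * (1 - 2 * t)); last by ring.
by rewrite mulr_ge0 ?sqr_ge0//; lra.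
Qed.

(** Chernoff's argument on the explicit binomial weights, with exponent [t = e / 4]. *)
Lemma binomial_upper_tail (A : set T) (e : R) : measurable A -> 0 < e <= 1 ->
  measurable [set w | (fine (mu A) + e) * N%:R <= #|hits A w|%:R] /\
  (P [set w | ((fine (mu A) + e) * N%:R <= #|hits A w|%:R)%R] <=
    (expR (- (e ^+ 2 / 8 * N%:R)))%:E)%E.
Proof.
move=> mA /andP[e0 e1]; set p := fine (mu A).
have p0 : 0 <= p by rewrite fine_ge0.
have p1 : p <= 1.
  by rewrite -lee_fin fineK ?fin_num_measure// probability_le1.
pose Q (S : {set 'I_N}) := (p + e) * N%:R <= #|S|%:R.
pose F (S : {set 'I_N}) := if Q S then [set w | hits A w = S] else set0.
have mF S : measurable (F S).
  by rewrite /F; case: ifP => // _; have [] := probability_hits S mA.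
have -> : [set w | (p + e) * N%:R <= #|hits A w|%:R] = \big[setU/set0]_(S : {set 'I_N}) F S.
  apply/seteqP; split => w /=.
    by move=> h; rewrite (bigD1 (hits A w))//=; left; rewrite /F /Q h.
  elim/big_ind : _ => //.
    by move=> U V hU hV [/hU|/hV].
  by move=> S _; rewrite /F; case: ifPn => // QS /= ->.
split; first exact: measurable_bigU.
apply: (le_trans (measure_bigU_le P _ mF)).
(* The minimiser of [2 t^2 - t e], the exponent per variable. *)
pose t := e / 4.
have t0 : 0 < t by rewrite divr_gt0.
apply: (@le_trans _ _ (\sum_(S : {set 'I_N})
   (expR (- (t * (p + e) * N%:R)) * ((p * expR t) ^+ #|S| * (1 - p) ^+ #|~: S|))%:E)%E).
  apply: lee_sum => S _.
  have rhs0 : 0 <= (p * expR t) ^+ #|S| * (1 - p) ^+ #|~: S|.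
    by rewrite mulr_ge0 ?exprn_ge0 ?mulr_ge0 ?expR_ge0// subr_ge0.
  rewrite /F; case: ifPn => QS; last by rewrite measure0 lee_fin mulr_ge0 ?expR_ge0.
  have [_ ->] := probability_hits S mA; rewrite -/p lee_fin.
  rewrite [leRHS](_ : _ = (expR (- (t * (p + e) * N%:R)) * expR t ^+ #|S|) *
    (p ^+ #|S| * (1 - p) ^+ #|~: S|)); last by rewrite exprMn; ring.
  rewrite ler_peMl ?mulr_ge0 ?exprn_ge0 ?subr_ge0//.
  rewrite -expRM_natl -expRD -[leLHS]expR0 ler_expR addrC subr_ge0.
  by rewrite -mulrA [leRHS]mulrC ler_pM2l.
rewrite sumEFin lee_fin -mulr_sumr.
have -> : \sum_(S : {set 'I_N}) (p * expR t) ^+ #|S| * (1 - p) ^+ #|~: S| =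
    (p * expR t + (1 - p)) ^+ N.
  have := @bigA_distr R 0 1 *%R +%R 'I_N (fun=> p * expR t) (fun=> 1 - p).
  rewrite prodr_const card_ord => ->; apply: eq_bigr => S _.
  by rewrite -prod_if_mem.
have base : p * expR t + (1 - p) <= expR (p * (t + 2 * t ^+ 2)).
  apply: le_trans (expR_ge1Dx _).
  rewrite addrCA lerD2l -{2}[p]mulr1 -mulrBr ler_wpM2l//.
  have := @expR_le_quadratic t; rewrite ltW//= => /(_ _) h.
  by have := h ltac:(rewrite /t; lra); lra.
apply: (@le_trans _ _ (expR (- (t * (p + e) * N%:R)) * expR (p * (t + 2 * t ^+ 2)) ^+ N)).
  rewrite ler_wpM2l ?expR_ge0//; apply: lerXn2r; rewrite ?nnegrE ?expR_ge0//.
  by rewrite addr_ge0 ?mulr_ge0 ?expR_ge0 ?subr_ge0.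
rewrite -expRM_natl -expRD ler_expR.
rewrite [leLHS](_ : _ = - ((t * (p + e) - p * (t + 2 * t ^+ 2)) * N%:R)); last by ring.
rewrite lerN2 ler_wpM2r//.
have : p * (2 * t ^+ 2) <= 2 * t ^+ 2 by rewrite ler_piMl// mulr_ge0 ?sqr_ge0.
have -> : 2 * t ^+ 2 = e ^+ 2 / 8 by rewrite /t; field.
have -> : t * (p + e) - p * (t + e ^+ 2 / 8) = e ^+ 2 / 4 - p * (e ^+ 2 / 8).
  by rewrite /t; field.
lra.
Qed.

End chernoff.

(** * Law of large numbers for triangular arrays *)

Section law_of_large_numbers.
Context {R : realType} d d1 (Omega : measurableType d) (T : measurableType d1)
  (P : probability Omega R) (mu : probability T R).
Context (N : nat -> nat) (n0 : nat) (X : forall n, 'I_(N n) -> Omega -> T).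
Hypothesis N_ge : forall n, (n <= N n)%N.
Hypothesis mX : forall n (k : 'I_(N n)), measurable_fun setT (X k).
Hypothesis indX : forall n, (n0 <= n)%N -> mutually_independent P setT (@X n).
Hypothesis lawX : forall n, (n0 <= n)%N -> forall (k : 'I_(N n)) A, measurable A ->
  P (X k @^-1` A) = mu A.

Lemma expRN_le (x : R) : 0 < x -> expR (- x) <= 4 / x ^+ 2.
Proof.
move=> x0; rewrite expRN -[4 / _]invrK lef_pV2 ?posrE ?invr_gt0 ?expR_gt0 ?divr_gt0 ?exprn_gt0//.
rewrite invf_div.
have -> : expR x = expR (x / 2) ^+ 2 by rewrite -expRM_natl; congr expR; field.
rewrite (_ : x ^+ 2 / 4 = (x / 2) ^+ 2); last by field.
apply: lerXn2r; rewrite ?nnegrE ?expR_ge0//; first by rewrite divr_ge0// ltW.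
by apply: le_trans (expR_ge1Dx _); rewrite lerDr.
Qed.

(** No relation between the rows of the triangular array is assumed, hence the use of
    exponential bounds. *)
Lemma lln_set (A : set T) : measurable A ->
  {ae P, forall w, (fun n => (\sum_(k < N n) \1_A (X k w)) / (N n)%:R : R) @ \oo
     --> fine (mu A)}.
Proof.
move=> mA.
have close (i : nat) : {ae P, forall w, \forall n \near \oo,
    `|fine (mu A) - (\sum_(k < N n) \1_A (X k w)) / (N n)%:R| < i.+1%:R^-1 :> R}.
  set e : R := i.+1%:R^-1.
  have e0 : 0 < e by rewrite invr_gt0.
  have e1 : e <= 1 by rewrite invf_le1// ler1n.
  pose B (b : bool) := if b then A else ~` A.
  have mB b : measurable (B b) by case: b => //; exact: measurableC.
  pose F n (b : bool) := [set w | (fine (mu (B b)) + e) * (N n)%:R <=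
    #|hits (@X n) (B b) w|%:R].
  have av : {ae P, forall w, \forall n \near \oo, forall b, ~ F n b w}.
    apply: (@ae_eventually_avoid _ _ _ P (fun=> bool) F
      (fun n => 256 / e ^+ 4 / n%:R ^+ 2) (512 / e ^+ 4) (maxn n0 1)).
    - move=> n b nn; have n0n : (n0 <= n)%N by lia.
      have e01 : 0 < e <= 1 by rewrite e0.
      by have [] := binomial_upper_tail (@mX n) (indX n0n) (lawX n0n) (mB b) e01.
    - move=> n b nn; have n0n : (n0 <= n)%N by lia.
      have e01 : 0 < e <= 1 by rewrite e0.
      have [_] := binomial_upper_tail (@mX n) (indX n0n) (lawX n0n) (mB b) e01.
      move/le_trans; apply; rewrite lee_fin.
      have nR : 0 < n%:R :> R by rewrite ltr0n; lia.
      have NR : n%:R <= (N n)%:R :> R by rewrite ler_nat.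
      have NR0 : 0 < (N n)%:R :> R by exact: lt_le_trans NR.
      apply: (le_trans (expRN_le _)).
        by rewrite mulr_gt0// divr_gt0// exprn_gt0.
      rewrite [leLHS](_ : _ = 256 / e ^+ 4 / (N n)%:R ^+ 2); last first.
        by field; rewrite !gt_eqF.
      rewrite ler_wpM2l ?divr_ge0 ?exprn_ge0//; first exact: ltW.
      rewrite lef_pV2 ?posrE ?exprn_gt0//.
      by apply: lerXn2r; rewrite ?nnegrE// ltW.
    - move=> n nn; rewrite card_bool !mulrA -natrM.
      by rewrite (_ : 2 * 256 = 512)%N.
  move: av; apply: filterS => w [k _ kF]; exists (maxn k 1) => // n /= kn.
  have nR : 0 < (N n)%:R :> R by rewrite ltr0n (leq_trans _ (N_ge n))//; lia.
  have cnt b : (\sum_(k < N n) \1_(B b) (X k w) : R) = #|hits (@X n) (B b) w|%:R.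
    rewrite -sum1_card natr_sum [RHS]big_mkcond/=.
    by apply: eq_bigr => l _; rewrite indicE inE; case: (_ \in _).
  have up b : \sum_(k < N n) \1_(B b) (X k w) < (fine (mu (B b)) + e) * (N n)%:R :> R.
    by rewrite cnt ltNge; apply/negP; apply: kF; rewrite /=; lia.
  have h1 := up true; have h2 := up false.
  have sumB : \sum_(k < N n) \1_(B false) (X k w) =
      (N n)%:R - \sum_(k < N n) \1_A (X k w) :> R.
    rewrite -[X in X%:R](card_ord (N n)) -sumr_const -sumrB.
    by apply: eq_bigr => l _; rewrite /B !indicE in_setC; case: (_ \in A); rewrite ?subrr ?subr0.
  have muB : fine (mu (B false)) = 1 - fine (mu A).
    by rewrite /B probability_setC// fineB// fin_num_measure.
  rewrite sumB muB in h2; rewrite /B in h1.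
  rewrite ltr_distl; apply/andP; split.
    by rewrite ltrBlDr ltr_pdivrMr.
  by rewrite -ltrBlDr ltr_pdivlMr//; lra.
move: (ae_foralln close); apply: filterS => w cl.
apply/cvgrPdist_lt => e e0.
have [i ie] : exists i : nat, i.+1%:R^-1 < e.
  exists (Num.truncn e^-1); rewrite -[ltRHS]invrK ltf_pV2 ?posrE ?invr_gt0//.
  exact: truncnS_gt.
by move: (cl i); apply: filterS => n /lt_trans; apply.
Qed.

End law_of_large_numbers.

Section bounded_integrals.
Context {R : realType} d (T : measurableType d) (mu : probability T R).
Implicit Types (f g : T -> R).

Lemma bounded_integrable f (M : R) : measurable_fun setT f -> (forall x, `|f x| <= M) ->
  mu.-integrable setT (EFin \o f).
Proof.
move=> mf fM; apply: measurable_bounded_integrable => //.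
  by apply: (le_lt_trans (probability_le1 _ _)) => //; exact: ltry.
exists M; split; first exact: num_real.
by move=> x Mx y _; apply: (le_trans (fM y)); exact: ltW.
Qed.

Lemma Rintegral_indic (A : set T) : measurable A ->
  \int[mu]_x (\1_A x : R) = fine (mu A).
Proof. by move=> mA; rewrite /Rintegral integral_indic// setIT. Qed.

Lemma Rintegral_close f g (M e : R) : measurable_fun setT f -> measurable_fun setT g ->
  (forall x, `|f x| <= M) -> (forall x, `|g x| <= M) ->
  (forall x, `|f x - g x| <= e) -> `|\int[mu]_x f x - \int[mu]_x g x| <= e.
Proof.
move=> mf mg fM gM fg.
have If := bounded_integrable mf fM; have Ig := bounded_integrable mg gM.
have half (u v : T -> R) : measurable_fun setT u -> (forall x, `|u x| <= M) ->
    measurable_fun setT v -> (forall x, `|v x| <= M) ->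
    (forall x, u x <= v x + e) -> \int[mu]_x u x <= \int[mu]_x v x + e.
  move=> mu_ uM mv vM uv.
  have Ie : mu.-integrable setT (EFin \o cst e).
    by apply: (@bounded_integrable _ `|e|) => //.
  have -> : \int[mu]_x v x + e = \int[mu]_x (v x + cst e x).
    rewrite RintegralD//; last exact: bounded_integrable vM.
    by rewrite Rintegral_cst// [X in _ * fine X](_ : _ = 1%E) ?mulr1//; exact: (@probability_setT _ _ _ mu).
  apply: le_Rintegral => //; first exact: bounded_integrable uM.
  have := integrableD measurableT (bounded_integrable mv vM) Ie.
  by apply: eq_integrable.
rewrite ler_distl; apply/andP; split.
  rewrite lerBlDr; apply: half => // x; have := fg x.
  by rewrite ler_distl => /andP[]; rewrite lerBlDr.
apply: half => // x; have := fg x.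
by rewrite ler_distl => /andP[].
Qed.

Lemma Rintegral_sum I (s : seq I) (F : I -> T -> R) (M : I -> R) :
  (forall i, measurable_fun setT (F i)) -> (forall i x, `|F i x| <= M i) ->
  \int[mu]_x (\sum_(i <- s) F i x) = \sum_(i <- s) \int[mu]_x F i x.
Proof.
move=> mF FM; elim: s => [|i s IH].
  rewrite big_nil; under eq_Rintegral do rewrite big_nil.
  by rewrite Rintegral_cst// mul0r.
rewrite big_cons -IH; under eq_Rintegral do rewrite big_cons.
rewrite RintegralD//; first exact: bounded_integrable (FM i).
apply: (@bounded_integrable _ (\sum_(j <- s) M j)).
  exact: measurable_sum.
by move=> x; apply: (le_trans (ler_norm_sum _ _ _)); exact: ler_sum.
Qed.

End bounded_integrals.

Section level_sets.
Context {R : realType}.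

(** The sum counts the natural numbers less than [y], since [y <= K]. *)
Lemma count_below (K : nat) (y : R) : 0 <= y <= K%:R ->
  y <= \sum_(i < K) ((i%:R < y)%R)%:R <= y + 1.
Proof.
elim: K => [|K IH] /andP[y0 yK].
  by rewrite big_ord0; apply/andP; split; [exact: yK|rewrite addr_ge0].
rewrite big_ord_recr/=; have [yK'|Ky] := leP y K%:R.
  by rewrite addr0 IH// y0.
rewrite (eq_bigr (fun=> 1)); last first.
  by move=> i _; rewrite (lt_trans _ Ky)// ltr_nat.
rewrite sumr_const card_ord natr1 yK/= -natr1 lerD2r ltW//.
Qed.

Definition level_approx T (f : T -> R) (K : nat) (x : T) : R :=
  K%:R^-1 * \sum_(i < K) \1_[set y | i%:R / K%:R < f y] x.

Lemma level_approx_close T (f : T -> R) (K : nat) (x : T) : (0 < K)%N -> 0 <= f x <= 1 ->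
  `|level_approx f K x - f x| <= K%:R^-1.
Proof.
move=> K0 /andP[f0 f1]; have KR : 0 < K%:R :> R by rewrite ltr0n.
have := @count_below K (K%:R * f x); rewrite mulr_ge0//= ler_piMr//.
move=> /(_ isT); rewrite /level_approx.
rewrite (_ : \sum_(i < K) ((i%:R < K%:R * f x)%R)%:R =
  \sum_(i < K) (\1_[set y | i%:R / K%:R < f y] x : R)); last first.
  apply: eq_bigr => i _; rewrite indicE; congr ((nat_of_bool _)%:R).
  rewrite mulrC -ltr_pdivrMr//; apply/idP/idP => [h|/set_mem//].
  by rewrite inE.
move: (\sum_(i < K) _) => S /andP[h1 h2].
rewrite ler_distl; apply/andP; split.
  by rewrite -(ler_pM2l KR) mulrBr mulVKf ?gt_eqF// mulfV ?gt_eqF//; lra.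
by rewrite -(ler_pM2l KR) mulrDr mulVKf ?gt_eqF// mulfV ?gt_eqF//; lra.
Qed.

End level_sets.

Section lln_bounded.
Context {R : realType} d d1 (Omega : measurableType d) (T : measurableType d1)
  (P : probability Omega R) (mu : probability T R).
Context (N : nat -> nat) (n0 : nat) (X : forall n, 'I_(N n) -> Omega -> T).
Hypothesis N_ge : forall n, (n <= N n)%N.
Hypothesis mX : forall n (k : 'I_(N n)), measurable_fun setT (X k).
Hypothesis indX : forall n, (n0 <= n)%N -> mutually_independent P setT (@X n).
Hypothesis lawX : forall n, (n0 <= n)%N -> forall (k : 'I_(N n)) A, measurable A ->
  P (X k @^-1` A) = mu A.

(** A uniform approximation by averages of indicators of level sets reduces the claim to
    [lln_set]. *)
Lemma lln_bounded (f : T -> R) : measurable_fun setT f -> (forall x, 0 <= f x <= 1) ->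
  {ae P, forall w, (fun n => (\sum_(k < N n) f (X k w)) / (N n)%:R : R) @ \oo
     --> (\int[mu]_x f x)}.
Proof.
move=> mf f01.
pose A (K i : nat) : set T := [set y | i%:R / K%:R < f y].
have mA K i : measurable (A K i).
  rewrite (_ : A K i = setT `&` f @^-1` `]i%:R / K%:R, +oo[%classic).
    exact: mf.
  by apply/seteqP; split => y /=; rewrite in_itv/= andbT; [split|case].
have lln : {ae P, forall w, forall K i,
  (fun n => (\sum_(k < N n) \1_(A K i) (X k w)) / (N n)%:R : R) @ \oo --> fine (mu (A K i))}.
  apply: ae_foralln => K; apply: ae_foralln => i.
  exact: (lln_set N_ge mX indX lawX (mA K i)).
move: lln; apply: filterS => w lln.
apply/cvgrPdist_lt => e e0.
have [K Ke] : exists K : nat, K.+1%:R^-1 < e / 4.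
  exists (Num.truncn (e / 4)^-1); rewrite -[ltRHS]invrK ltf_pV2 ?posrE ?invr_gt0 ?divr_gt0//.
  exact: truncnS_gt.
set F := level_approx f K.+1.
have fM x : `|f x| <= 2 by have := f01 x; rewrite ler_norml => /andP[? ?]; apply/andP; split; lra.
have Ff x : `|F x - f x| <= K.+1%:R^-1 by apply: level_approx_close.
have K1 : K.+1%:R^-1 <= 1 :> R by rewrite invf_le1// ler1n.
have FM x : `|F x| <= 2.
  have [f0 f1] : 0 <= f x /\ f x <= 1 by apply/andP.
  move: (Ff x) K1; rewrite !ler_norml; move: (F x) (f x) f0 f1 (K.+1%:R^-1) => u v v0 v1 c.
  by move=> /andP[h1 h2] h3; apply/andP; split; lra.
have mF : measurable_fun setT F.
  apply: measurable_funM => //; apply: measurable_sum => i.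
  by apply: measurable_indic; exact: mA.
have intF : \int[mu]_x F x = K.+1%:R^-1 * \sum_(i < K.+1) fine (mu (A K.+1 i)).
  rewrite /F /level_approx RintegralZl//; last first.
    apply: (@bounded_integrable _ _ _ _ _ (\sum_(i < K.+1) 1)).
      by apply: measurable_sum => i; apply: measurable_indic; exact: mA.
    move=> x; apply: (le_trans (ler_norm_sum _ _ _)); apply: ler_sum => i _.
    by rewrite indicE normr_nat lern1 leq_b1.
  rewrite (@Rintegral_sum _ _ _ _ _ _ _ (fun=> 1)).
  - congr (_ * _); apply: eq_bigr => i _; exact: (Rintegral_indic mu (mA K.+1 i)).
  - by move=> i; apply: measurable_indic; exact: mA.
  - by move=> i x; rewrite indicE normr_nat lern1 leq_b1.
have cF : (fun n => (\sum_(k < N n) F (X k w)) / (N n)%:R : R) @ \oo --> \int[mu]_x F x.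
  rewrite intF (_ : (fun n => _) = (fun n => K.+1%:R^-1 * \sum_(i < K.+1)
     ((\sum_(k < N n) \1_(A K.+1 i) (X k w)) / (N n)%:R))); last first.
    apply/funext => n; rewrite -mulr_suml mulrA; congr (_ / _).
    by rewrite exchange_big mulr_sumr.
  apply: cvgM; first exact: cvg_cst.
  by apply: cvg_big => [|i _]; [exact: add_continuous|exact: lln].
have e20 : 0 < e / 4 by rewrite divr_gt0.
move/cvgrPdist_lt/(_ _ e20): cF; case=> k _ kF; exists (maxn k 1) => // n /= kn.
have := kF n ltac:(rewrite /=; lia).
have := Rintegral_close mu mF mf FM fM Ff.
have NR : 0 < (N n)%:R :> R by rewrite ltr0n (leq_trans _ (N_ge n))//; lia.
have : `|(\sum_(k < N n) F (X k w)) / (N n)%:R - (\sum_(k < N n) f (X k w)) / (N n)%:R| <= K.+1%:R^-1.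
  rewrite -mulrBl normrM normfV (gtr0_norm NR) ler_pdivrMr// -sumrB.
  apply: (le_trans (ler_norm_sum _ _ _)).
  rewrite -[X in _ * X%:R](card_ord (N n)) mulr_natr -sumr_const.
  by apply: ler_sum => l _.
rewrite !ler_norml !ltr_norml; move: Ke; set c := K.+1%:R^-1; clearbody c.
by move=> Ke /andP[? ?] /andP[? ?] /andP[? ?]; apply/andP; split; lra.
Qed.

End lln_bounded.

(** * Logarithmic bumps *)

Section bumps.
Context {R : realType}.
Implicit Types (a w : R[i]) (rho s : R).

(** By Jensen's formula, the mean of [ln |z - w|] over [z] on a circle of centre [a] and radius
    [2 rho], minus the same for radius [rho], normalised to height 1. *)
Definition log_bump rho a w : R := (log_max (2 * rho) (w - a) - log_max rho (w - a)) / ln 2.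

Lemma ln2_gt0 : 0 < ln 2 :> R.
Proof. by rewrite ln_gt0// ltr1n. Qed.

Lemma max_lipschitz (r x y : R) : `|Num.max r x - Num.max r y| <= `|x - y|.
Proof.
have [rx|xr] := leP r x; have [ry|yr] := leP r y => //.
- by rewrite !ger0_norm ?subr_ge0// ?(le_trans (ltW yr))//; lra.
- by rewrite !ler0_norm ?subr_le0// ?(le_trans (ltW xr))//; lra.
- by rewrite subrr normr0.
Qed.

Lemma log_max_lipschitz r (x y : R[i]) : 0 < r ->
  `|log_max r x - log_max r y| <= r^-1 * normc (x - y).
Proof.
move=> r0.
have one u v : r <= u -> r <= v -> ln u - ln v <= r^-1 * `|u - v|.
  move=> ru rv; have u0 := lt_le_trans r0 ru; have v0 := lt_le_trans r0 rv.
  rewrite -ln_div ?posrE//.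
  have -> : u / v = 1 + (u - v) / v by rewrite mulrBl divff ?gt_eqF// addrCA subrr addr0.
  apply: (le_trans (le_ln1Dx _)).
    by rewrite mulrBl divff ?gt_eqF// ltrDr divr_gt0.
  apply: (le_trans (ler_norm _)); rewrite normrM mulrC ler_wpM2r// normfV gtr0_norm//.
  by rewrite lef_pV2.
have ge_r z : r <= Num.max r z by rewrite le_max lexx.
have bnd : r^-1 * `|Num.max r (normc x) - Num.max r (normc y)| <= r^-1 * normc (x - y).
  rewrite ler_pM2l ?invr_gt0//; apply: (le_trans (max_lipschitz _ _ _)).
  exact: normc_lipschitz.
rewrite ler_norml; apply/andP; split.
  by rewrite lerNl opprB; apply: le_trans bnd; rewrite distrC; exact: one.
by apply: le_trans bnd; exact: one.
Qed.

Lemma continuous_log_bump rho a : 0 < rho -> continuous (log_bump rho a).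
Proof.
move=> r0; apply: (@lipschitz_continuous_complex _ _ (((2 * rho)^-1 + rho^-1) / ln 2)) => x y.
have e : x - a - (y - a) = x - y by ring.
rewrite /log_bump -mulrBl normrM (@ger0_norm _ (ln 2)^-1) ?invr_ge0 ?(ltW ln2_gt0)//.
rewrite mulrAC ler_pM2r ?invr_gt0 ?ln2_gt0//.
have r20 : 0 < 2 * rho by rewrite mulr_gt0.
have h1 := log_max_lipschitz (x - a) (y - a) r20.
have h2 := log_max_lipschitz (x - a) (y - a) r0.
rewrite e in h1 h2.
rewrite (_ : _ - _ = (log_max (2 * rho) (x - a) - log_max (2 * rho) (y - a)) -
  (log_max rho (x - a) - log_max rho (y - a))); last by ring.
by apply: (le_trans (ler_normB _ _)); rewrite [leRHS]mulrDl; exact: lerD.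
Qed.

Lemma log_bump_itv rho a w : 0 < rho -> 0 <= log_bump rho a w <= 1.
Proof.
move=> r0; rewrite /log_bump /log_max.
have r20 : 0 < 2 * rho by rewrite mulr_gt0.
have m0 : 0 < Num.max rho (normc (w - a)) by rewrite lt_max r0.
have rr : rho <= 2 * rho by rewrite ler_peMl ?ler1n// ltW.
apply/andP; split.
  rewrite divr_ge0 ?(ltW ln2_gt0)// subr_ge0 ler_ln_le//.
  by rewrite ge_max !le_max rr lexx orbT.
rewrite ler_pdivrMr ?ln2_gt0// mul1r lerBlDr -lnM ?posrE// ler_ln_le//.
  by rewrite lt_max r20.
by rewrite maxr_pMr// ge_max !le_max lexx/= ler_peMl ?normc_ge0 ?ler1n ?orbT.
Qed.

Lemma log_bump_eq1 rho a w : 0 < rho -> normc (w - a) <= rho -> log_bump rho a w = 1.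
Proof.
move=> r0 war; rewrite /log_bump /log_max !max_l//; last first.
  by rewrite (le_trans war)// ler_peMl ?ler1n// ltW.
by rewrite lnM ?posrE// addrK divff// gt_eqF// ln2_gt0.
Qed.

Lemma log_bump_eq0 rho a w : 0 < rho -> 2 * rho <= normc (w - a) -> log_bump rho a w = 0.
Proof.
move=> r0 war; rewrite /log_bump /log_max !max_r//; first by rewrite subrr mul0r.
by rewrite (le_trans _ war)// ler_peMl ?ler1n// ltW.
Qed.

Definition lattice_point s (B p q : nat) : R[i] :=
  (s * (p%:R - B%:R)) +i* (s * (q%:R - B%:R)).

Lemma count_integers_near (n : nat) (y : R) :
  \sum_(p < n) (((`|p%:R - y| < 4)%R : nat)%:R : R) <= 9.
Proof.
pose l := Num.floor (y - 4).
have /andP[l1 l2] := Num.Theory.floor_itv (y - 4).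
pose U := [seq p <- iota 0 n | `|p%:R - y| < 4].
have -> : \sum_(p < n) (((`|p%:R - y| < 4)%R : nat)%:R : R) = (size U)%:R.
  rewrite /U size_filter -sum1_count natr_sum [RHS]big_mkcond/=.
  rewrite -(big_mkord predT (fun p => (((`|p%:R - y| < 4)%R : nat)%:R : R))) /index_iota subn0.
  by apply: eq_bigr => p _; case: ifP.
rewrite ler_nat.
have := @uniq_leq_size _ U [seq absz (l + Posz i) | i <- iota 0 9].
rewrite size_map size_iota; apply; first by rewrite filter_uniq// iota_uniq.
move=> p; rewrite mem_filter ltr_distl => /andP[/andP[h1 h2] _].
rewrite -/l intrD in l1 l2.
have h3 : l < p%:Z by rewrite -(ltr_int R); apply: le_lt_trans l1 _.
have h4 : p%:Z < l + 9.
  rewrite -(ltr_int R) intrD; have -> : (Posz p)%:~R = p%:R :> R by [].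
  have -> : (9 : int)%:~R = 9 :> R by [].
  have e1 : (1 : int)%:~R = 1 :> R by [].
  rewrite e1 in l2; lra.
apply/mapP; exists (absz (p%:Z - l)); first by rewrite mem_iota; lia.
lia.
Qed.

(** Only the lattice points of a square of side [8 s] around [w] contribute, which leaves at
    most 9 values for each coordinate. *)
Lemma lattice_overlap s (B n : nat) w : 0 < s ->
  \sum_(p < n) \sum_(q < n) log_bump (2 * s) (lattice_point s B p q) w <= 81.
Proof.
move=> s0; have s20 : 0 < 2 * s by rewrite mulr_gt0.
pose I (x : R) (p : nat) : R := ((`|p%:R - (x / s + B%:R)| < 4)%R : nat)%:R.
apply: (@le_trans _ _ (\sum_(p < n) \sum_(q < n) I (Re w) p * I (Im w) q)).
  apply: ler_sum => p _; apply: ler_sum => q _.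
  have [near|far] := ltP (normc (w - lattice_point s B p q)) (2 * (2 * s)); last first.
    by rewrite log_bump_eq0// mulr_ge0.
  have aux (x : R) (k : nat) : `|x - s * (k%:R - B%:R)| < 2 * (2 * s) -> I x k = 1.
    move=> h; rewrite /I.
    have -> : k%:R - (x / s + B%:R) = - ((x - s * (k%:R - B%:R)) / s).
      by field; rewrite gt_eqF.
    rewrite normrN normrM normfV (gtr0_norm s0) ltr_pdivrMr//.
    by rewrite (_ : 4 * s = 2 * (2 * s)) ?h//; ring.
  rewrite !aux; last 2 first.
  - by apply: le_lt_trans near; rewrite (le_trans _ (Im_le_normc _))// Im_subE.
  - by apply: le_lt_trans near; rewrite (le_trans _ (Re_le_normc _))// Re_subE.
  by rewrite mulr1; have /andP[] := log_bump_itv (lattice_point s B p q) w s20.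
under eq_bigr do rewrite -mulr_sumr.
rewrite -mulr_suml (_ : 81 = 9 * 9); last by ring.
by apply: ler_pM; rewrite ?count_integers_near// sumr_ge0.
Qed.

End bumps.

Section bump_approximation.
Context {R : realType}.
Implicit Types (a w : R[i]) (s : R) (g : R[i] -> R).

Definition bump_sum s (B : nat) (c : nat -> nat -> R) w : R :=
  \sum_(p < B.*2.+1) \sum_(q < B.*2.+1) c p q * log_bump (2 * s) (lattice_point s B p q) w.

Lemma normc_lattice_point s (B : nat) (p q : 'I_B.*2.+1) : 0 < s ->
  normc (lattice_point s B p q) <= 2 * s * B%:R.
Proof.
move=> s0; apply: (le_trans (normc_le_ReIm _)) => /=.
have aux (k : 'I_B.*2.+1) : `|s * (k%:R - B%:R)| <= s * B%:R.
  rewrite normrM gtr0_norm// ler_pM2l// ler_norml.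
  have kB : (k%:R : R) <= B%:R + B%:R by rewrite -natrD ler_nat; have := ltn_ord k; lia.
  have k0 : 0 <= (k%:R : R) by [].
  by apply/andP; split; lra.
by have := aux p; have := aux q; lra.
Qed.

Lemma lattice_covers s (B : nat) w : 0 < s -> normc w <= s * (B%:R - 1) ->
  exists p q : 'I_B.*2.+1, normc (w - lattice_point s B p q) <= 2 * s.
Proof.
move=> s0 ws.
have aux (x : R) : `|x| <= s * (B%:R - 1) ->
    exists p : 'I_B.*2.+1, `|x - s * (p%:R - B%:R)| <= s.
  move=> xs; pose l := Num.floor (x / s).
  have /andP[l1 l2] := Num.Theory.floor_itv (x / s); rewrite -/l in l1 l2.
  rewrite intrD in l2.
  have e1 : (1 : int)%:~R = 1 :> R by [].
  have eB : (Posz B)%:~R = B%:R :> R by [].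
  have xl : `|x / s| <= B%:R - 1.
    by rewrite normrM normfV (gtr0_norm s0) ler_pdivrMr// mulrC.
  rewrite ler_norml in xl; move/andP: xl => [x1 x2].
  have h1 : - (Posz B) <= l by rewrite -ltzD1 -(ltr_int R) intrD rmorphN/= eB; lra.
  have h2 : l < Posz B by rewrite -(ltr_int R) eB; lra.
  have pB : (absz (l + Posz B)%R < B.*2.+1)%N by lia.
  exists (Ordinal pB) => /=.
  have -> : (absz (l + Posz B)%R)%:R = l%:~R + B%:R :> R.
    by rewrite -eB -intrD pmulrn; congr (_%:~R); lia.
  rewrite addrK; rewrite e1 in l2.
  have -> : x - s * l%:~R = s * (x / s - l%:~R) by field; rewrite gt_eqF.
  rewrite normrM (gtr0_norm s0) ler_piMr ?(ltW s0)// ler_norml.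
  by apply/andP; split; lra.
have [p hp] := aux (Re w) (le_trans (Re_le_normc w) ws).
have [q hq] := aux (Im w) (le_trans (Im_le_normc w) ws).
exists p, q; apply: (le_trans (normc_le_ReIm _)); rewrite Re_subE Im_subE /=.
lra.
Qed.

(** The bumps overlap boundedly and cover, so that averaging a function of small
    oscillation against them removes a fixed proportion of its sup norm. *)
Lemma bump_approximation g (rho M : R) : continuous g -> 0 < M ->
  (forall w, rho < normc w -> g w = 0) -> (forall w, `|g w| <= M) ->
  exists j B c rho', let h := bump_sum j.+1%:R^-1 B c in
    (forall w, `|g w - h w| <= 161 / 162 * M) /\
    (forall w, rho' < normc w -> g w - h w = 0).
Proof.
move=> cg M0 supp gM.
have e0 : 0 < M / 162 by rewrite divr_gt0.
have [d d0 unif] := uniformly_continuous_complex rho cg e0.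
have osc x y : normc (x - y) < d -> `|g x - g y| <= M / 162.
  move=> xy; have [xr|xr] := leP (normc x) rho; first exact/ltW/unif.
  have [yr|yr] := leP (normc y) rho.
    by rewrite distrC; apply/ltW/unif => //; rewrite normcB.
  by rewrite !supp// subrr normr0 ltW.
have [j js] : exists j : nat, j.+1%:R^-1 < d / 4.
  exists (Num.truncn (d / 4)^-1); rewrite -[ltRHS]invrK ltf_pV2 ?posrE ?invr_gt0 ?divr_gt0//.
  exact: truncnS_gt.
set s := j.+1%:R^-1 in js.
have s0 : 0 < s by rewrite invr_gt0.
have s20 : 0 < 2 * s by rewrite mulr_gt0.
pose B := (Num.truncn (rho / s)).+2.
have rB : rho <= s * (B%:R - 1).
  rewrite mulrC -ler_pdivrMr// /B -natr1 addrK; exact/ltW/truncnS_gt.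
pose a (p q : nat) := lattice_point s B p q.
pose b p q w := log_bump (2 * s) (a p q) w.
have b01 p q w : 0 <= b p q w <= 1 by exact: log_bump_itv.
have b0 p q w : 0 <= b p q w by have /andP[] := b01 p q w.
pose S w := \sum_(p < B.*2.+1) \sum_(q < B.*2.+1) b p q w.
have S81 w : S w <= 81 by exact: lattice_overlap.
have S0 w : 0 <= S w by rewrite sumr_ge0// => p _; rewrite sumr_ge0.
exists j, B, (fun p q => g (a p q) / 81), (`|rho| + (2 * s * B%:R + 4 * s)) => h.
have hE w : h w = \sum_(p < B.*2.+1) \sum_(q < B.*2.+1) g (a p q) / 81 * b p q w by [].
split=> w; last first.
  have Br : 0 <= 2 * s * B%:R + 4 * s by rewrite addr_ge0// ?mulr_ge0// ltW.
  move=> wr; rewrite supp; last first.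
    by apply: le_lt_trans wr; rewrite (le_trans (ler_norm _))// lerDl.
  rewrite hE big1 ?subrr// => p _; rewrite big1// => q _.
  rewrite /b log_bump_eq0 ?mulr0//.
  have := normcB_ge w (a p q); have := normc_lattice_point p q s0; rewrite -/(a p q).
  have := normr_ge0 rho; lra.
have -> : g w - h w = g w * (1 - S w / 81) +
    \sum_(p < B.*2.+1) \sum_(q < B.*2.+1) (g w - g (a p q)) / 81 * b p q w.
  rewrite hE /S mulrBr mulr1 -addrA; congr (_ + _).
  rewrite !mulr_suml mulr_sumr -!sumrN -big_split; apply: eq_bigr => p _ /=.
  rewrite !mulr_suml mulr_sumr -!sumrN -big_split; apply: eq_bigr => q _ /=.
  by ring.
apply: (le_trans (ler_normD _ _)).
have h2 : `|\sum_(p < B.*2.+1) \sum_(q < B.*2.+1) (g w - g (a p q)) / 81 * b p q w| <= M / 162.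
  apply: (@le_trans _ _ (M / 162 / 81 * S w)); last first.
    by rewrite mulrAC ler_pdivrMr// ler_wpM2l// ltW.
  rewrite /S mulr_sumr; apply: (le_trans (ler_norm_sum _ _ _)); apply: ler_sum => p _.
  rewrite mulr_sumr; apply: (le_trans (ler_norm_sum _ _ _)); apply: ler_sum => q _.
  have [near|far] := ltP (normc (w - a p q)) (2 * (2 * s)); last first.
    by rewrite /b log_bump_eq0// !mulr0 normr0.
  rewrite normrM (ger0_norm (b0 p q w)) ler_wpM2r// normrM (@ger0_norm _ 81^-1)//.
  rewrite ler_wpM2r// osc// (lt_trans near)//; lra.
have h1 : `|g w * (1 - S w / 81)| <= 80 / 81 * M.
  have S81' : S w / 81 <= 1 by rewrite ler_pdivrMr// mul1r.
  rewrite normrM (ger0_norm (x := 1 - _)) ?subr_ge0//.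
  have [wr|wr] := leP (normc w) rho; last first.
    by rewrite supp// normr0 mul0r mulr_ge0// ltW.
  have [p [q pq]] := lattice_covers s0 (le_trans wr rB).
  have S1 : 1 <= S w.
    rewrite /S (bigD1 p)//= (bigD1 q)//= {1}/b log_bump_eq1//.
    by rewrite -addrA lerDl addr_ge0// sumr_ge0// => ? _; rewrite ?sumr_ge0.
  rewrite mulrC; apply: ler_pM => //; first by rewrite subr_ge0.
  have : 1 / 81 <= S w / 81 by rewrite ler_wpM2r.
  lra.
by have := lerD h1 h2; lra.
Qed.

End bump_approximation.

(** * Weak convergence tested on bumps *)

Section discrepancy.
Context {R : realType} (mu : probability R[i] R).
Implicit Types (f g : R[i] -> R) (z : seq R[i]).

Definition bounded_continuous f :=
  continuous f /\ exists M : R, forall x, `|f x| <= M.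

Lemma bounded_continuous_integrable f : bounded_continuous f ->
  mu.-integrable setT (EFin \o f).
Proof.
move=> [cf [M fM]]; apply: bounded_integrable fM.
exact: continuous_measurable_complex.
Qed.

Lemma bounded_continuousD f g : bounded_continuous f -> bounded_continuous g ->
  bounded_continuous (fun x => f x + g x).
Proof.
move=> [cf [M fM]] [cg [M' gM]]; split; last first.
  by exists (M + M') => x; apply: (le_trans (ler_normD _ _)); exact: lerD.
apply/continuous_complexP => x e e0.
have e2 : 0 < e / 2 by rewrite divr_gt0.
have [d1 d10 df] := (continuous_complexP f).1 cf x _ e2.
have [d2 d20 dg] := (continuous_complexP g).1 cg x _ e2.
exists (Num.min d1 d2); first by rewrite lt_min d10.
move=> y; rewrite lt_min => /andP[/df fxy /dg gxy].
have -> : f x + g x - (f y + g y) = (f x - f y) + (g x - g y) by ring.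
by apply: (le_lt_trans (ler_normD _ _)); lra.
Qed.

Lemma bounded_continuousM f g : bounded_continuous f -> bounded_continuous g ->
  bounded_continuous (fun x => f x * g x).
Proof.
move=> [cf [M fM]] [cg [M' gM]]; split; last first.
  by exists (M * M') => x; rewrite normrM; apply: ler_pM.
have M0 : 0 <= M := le_trans (normr_ge0 _) (fM 0).
have M'0 : 0 <= M' := le_trans (normr_ge0 _) (gM 0).
apply/continuous_complexP => x e e0.
have K0 : 0 < M + M' + 1 by lra.
have eK : 0 < e / (M + M' + 1) by rewrite divr_gt0.
have [d1 d10 df] := (continuous_complexP f).1 cf x _ eK.
have [d2 d20 dg] := (continuous_complexP g).1 cg x _ eK.
exists (Num.min d1 d2); first by rewrite lt_min d10.
move=> y; rewrite lt_min => /andP[/df fxy /dg gxy].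
have -> : f x * g x - f y * g y = f x * (g x - g y) + g y * (f x - f y) by ring.
apply: (le_lt_trans (ler_normD _ _)); rewrite !normrM.
have h1 : `|f x| * `|g x - g y| <= M * (e / (M + M' + 1)).
  by apply: ler_pM => //; exact: ltW.
have h2 : `|g y| * `|f x - f y| <= M' * (e / (M + M' + 1)).
  by apply: ler_pM => //; exact: ltW.
have : (M + M' + 1) * (e / (M + M' + 1)) = e by rewrite mulrC divfK// gt_eqF.
rewrite !mulrDl mul1r; lra.
Qed.

Lemma bounded_continuous_cst (c : R) : bounded_continuous (fun=> c).
Proof.
split; last by exists `|c|.
by apply: (@lipschitz_continuous_complex _ _ 0) => x y; rewrite subrr normr0 mul0r.
Qed.

Lemma bounded_continuous_sum I (s : seq I) (F : I -> R[i] -> R) :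
  (forall i, bounded_continuous (F i)) ->
  bounded_continuous (fun x => \sum_(i <- s) F i x).
Proof.
move=> bF; elim: s => [|i s IH].
  under eq_fun do rewrite big_nil; exact: bounded_continuous_cst.
under eq_fun do rewrite big_cons; exact: bounded_continuousD.
Qed.

Definition mean z f : R := (\sum_(x <- z) f x) / (size z)%:R.

Definition discrepancy z f : R := mean z f - \int[mu]_x f x.

Lemma discrepancyD z f g : bounded_continuous f -> bounded_continuous g ->
  discrepancy z (fun x => f x + g x) = discrepancy z f + discrepancy z g.
Proof.
move=> bf bg; rewrite /discrepancy /mean RintegralD//; last 2 first.
- exact: bounded_continuous_integrable.
- exact: bounded_continuous_integrable.
by rewrite big_split/= mulrDl; ring.
Qed.

Lemma discrepancyZ z (c : R) f : bounded_continuous f ->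
  discrepancy z (fun x => c * f x) = c * discrepancy z f.
Proof.
move=> bf; rewrite /discrepancy /mean RintegralZl//; last exact: bounded_continuous_integrable.
by rewrite -mulr_sumr; ring.
Qed.

Lemma discrepancy_sum z I (s : seq I) (F : I -> R[i] -> R) :
  (forall i, bounded_continuous (F i)) ->
  discrepancy z (fun x => \sum_(i <- s) F i x) = \sum_(i <- s) discrepancy z (F i).
Proof.
move=> bF; elim: s => [|i s IH].
  rewrite big_nil /discrepancy /mean; under eq_Rintegral do rewrite big_nil.
  by rewrite Rintegral_cst// mul0r big1 ?mul0r ?subrr// => x _; rewrite big_nil.
rewrite big_cons -IH -discrepancyD//; last exact: bounded_continuous_sum.
by congr discrepancy; apply/funext => x /=; rewrite big_cons.
Qed.

Lemma mean_le z f (M : R) : (0 < size z)%N -> (forall x, `|f x| <= M) -> `|mean z f| <= M.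
Proof.
move=> z0 fM; have zR : 0 < (size z)%:R :> R by rewrite ltr0n.
rewrite /mean normrM normfV (gtr0_norm zR) ler_pdivrMr//.
apply: (le_trans (ler_norm_sum _ _ _)).
have -> : M * (size z)%:R = \sum_(x <- z) M.
  by rewrite big_const_seq count_predT iter_addr addr0 mulr_natr.
exact: ler_sum.
Qed.

Lemma Rintegral_le f (M : R) : bounded_continuous f -> (forall x, `|f x| <= M) ->
  `|\int[mu]_x f x| <= M.
Proof.
move=> [cf _] fM; have M0 : 0 <= M := le_trans (normr_ge0 _) (fM 0).
have := @Rintegral_close R _ _ mu f (fun=> 0) M M.
rewrite Rintegral_cst// mul0r subr0; apply => //.
- exact: continuous_measurable_complex.
- by move=> x; rewrite normr0.
- by move=> x; rewrite subr0.
Qed.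

Lemma discrepancy_le z f (M : R) : (0 < size z)%N -> bounded_continuous f ->
  (forall x, `|f x| <= M) -> `|discrepancy z f| <= 2 * M.
Proof.
move=> z0 bf fM; apply: (le_trans (ler_normB _ _)).
by rewrite mulr_natl mulr2n lerD ?mean_le ?Rintegral_le.
Qed.

Lemma bounded_continuous_log_bump (rho : R) a : 0 < rho -> bounded_continuous (log_bump rho a).
Proof.
move=> r0; split; first exact: continuous_log_bump.
by exists 1 => x; have /andP[h h1] := log_bump_itv a x r0; rewrite ger0_norm.
Qed.

Definition lattice_scale (l j : nat) : R := l.+1%:R / j.+1%:R.

Lemma lattice_scale_gt0 l j : 0 < lattice_scale l j.
Proof. by rewrite divr_gt0. Qed.

Context (z : nat -> seq R[i]).
Hypothesis z_gt0 : \forall n \near \oo, (0 < size (z n))%N.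
Hypothesis bumps : forall l j B p q,
  (fun n => discrepancy (z n) (log_bump (2 * lattice_scale l j)
     (lattice_point (lattice_scale l j) B p q))) @ \oo --> (0 : R).

(** Each use of [bump_approximation] splits off a combination of bumps, whose discrepancy
    tends to 0, and leaves a function with a smaller sup norm. *)
Lemma discrepancy_contraction k g (rho M : R) : continuous g ->
  (forall w, rho < normc w -> g w = 0) -> (forall w, `|g w| <= M) ->
  forall e, 0 < e -> \forall n \near \oo,
    `|discrepancy (z n) g| <= 2 * ((161 / 162) ^+ k * M) + e.
Proof.
elim: k g rho M => [|k IH] g rho M cg supp gM e e0.
  move: z_gt0; apply: filterS => n zn.
  rewrite expr0 mul1r (le_trans (discrepancy_le zn _ gM)) ?lerDl ?ltW//.
  by split=> //; exists M.
have M0 : 0 <= M := le_trans (normr_ge0 _) (gM 0).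
have [M00|M00] := eqVneq M 0.
  move: z_gt0; apply: filterS => n zn.
  have := discrepancy_le zn (conj cg (ex_intro _ M gM)) gM.
  by rewrite M00 !mulr0 add0r => h; apply: (le_trans h); exact: ltW.
have {}M0 : 0 < M by rewrite lt_def M00.
have [j [B [c [rho' /= [gh hsupp]]]]] := bump_approximation cg M0 supp gM.
set h := bump_sum _ B c in gh hsupp.
have e20 : 0 < e / 2 by rewrite divr_gt0.
pose b p q := log_bump (2 * lattice_scale 0 j) (lattice_point (lattice_scale 0 j) B p q).
have bb p q : bounded_continuous (b p q).
  by apply: bounded_continuous_log_bump; rewrite mulr_gt0 ?lattice_scale_gt0.
have bcb p q : bounded_continuous (fun x => c p q * b p q x).
  by apply: bounded_continuousM => //; exact: bounded_continuous_cst.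
have hE : h = fun w => \sum_(p < B.*2.+1) \sum_(q < B.*2.+1) c p q * b p q w.
  by apply/funext => w; rewrite /h /bump_sum /b /lattice_scale mul1r.
have bh : bounded_continuous h.
  by rewrite hE; apply: bounded_continuous_sum => p; exact: bounded_continuous_sum.
have dh : (fun n => discrepancy (z n) h) @ \oo --> (0 : R).
  have -> : (fun n => discrepancy (z n) h) = (fun n =>
      \sum_(p < B.*2.+1) \sum_(q < B.*2.+1) c p q * discrepancy (z n) (b p q)).
    apply/funext => n; rewrite hE discrepancy_sum; last by move=> p; exact: bounded_continuous_sum.
    apply: eq_bigr => p _; rewrite discrepancy_sum//.
    by apply: eq_bigr => q _; rewrite discrepancyZ.
  rewrite -[X in _ --> X](_ : \sum_(p < B.*2.+1) \sum_(q < B.*2.+1) c p q * 0 = 0); last first.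
    by rewrite big1// => p _; rewrite big1// => q _; rewrite mulr0.
  apply: cvg_big => [|p _]; first exact: add_continuous.
  apply: cvg_big => [|q _]; first exact: add_continuous.
  by apply: cvgM; [exact: cvg_cst|exact: bumps].
have bg : bounded_continuous g by split=> //; exists M.
have bgh : bounded_continuous (fun x => g x + (-1) * h x).
  apply: bounded_continuousD => //.
  by apply: bounded_continuousM => //; exact: bounded_continuous_cst.
have ghE x : g x + (-1) * h x = g x - h x by rewrite mulN1r.
have gh' x : `|g x + (-1) * h x| <= 161 / 162 * M by rewrite ghE.
have gsupp w : rho' < normc w -> g w + (-1) * h w = 0 by move=> ?; rewrite ghE hsupp.
have := IH _ rho' _ bgh.1 gsupp gh' _ e20.
move/cvgrPdist_lt/(_ _ e20): dh; apply: filterS2 => n; rewrite sub0r normrN => h1 h2.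
have -> : discrepancy (z n) g = discrepancy (z n) (fun x => g x + (-1) * h x) + discrepancy (z n) h.
  by rewrite -discrepancyD//; congr discrepancy; apply/funext => x /=; rewrite ghE subrK.
apply: (le_trans (ler_normD _ _)); rewrite exprSr -mulrA; lra.
Qed.

Lemma compactly_supported_cvg g (rho : R) : bounded_continuous g ->
  (forall w, rho < normc w -> g w = 0) ->
  (fun n => discrepancy (z n) g) @ \oo --> (0 : R).
Proof.
move=> [cg [M gM]] supp; apply/cvgrPdist_lt => e e0.
have M0 : 0 <= M := le_trans (normr_ge0 _) (gM 0).
have geo : (fun k => 2 * ((161 / 162) ^+ k * M)) @ \oo --> (2 * (0 * M) : R).
  apply: cvgM; first exact: cvg_cst.
  apply: cvgM; last exact: cvg_cst.
  by apply: cvg_expr; rewrite ger0_norm//; lra.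
have e20 : 0 < e / 2 by rewrite divr_gt0.
rewrite mul0r mulr0 in geo.
have /cvgrPdist_lt/(_ _ e20) [k _ /(_ k (leqnn k))] := geo.
rewrite /= sub0r normrN ger0_norm; last by rewrite mulr_ge0// mulr_ge0// exprn_ge0.
move=> hk; have := discrepancy_contraction k cg supp gM e20.
by apply: filterS => n; rewrite sub0r normrN => h; apply: (le_lt_trans h); lra.
Qed.

(** The outermost bumps serve as cut-offs: they reduce the claim to compactly supported
    functions and, having the right limit themselves, prevent mass from escaping. *)
Lemma bounded_continuous_cvg g : bounded_continuous g ->
  (fun n => discrepancy (z n) g) @ \oo --> (0 : R).
Proof.
move=> bg; have [cg [M gM]] := bg; apply/cvgrPdist_lt => e e0.
have M0 : 0 <= M := le_trans (normr_ge0 _) (gM 0).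
have M1 : 0 < 4 * (M + 1) by lra.
pose D l : set R[i] := [set w | normc w <= l.+1%:R].
have mD l : measurable (D l).
  have := @measurable_normc_sub R 0 measurableT _ (measurable_itv `]-oo, l.+1%:R]).
  rewrite setTI; congr (measurable _); apply/seteqP; split => w /=; by rewrite in_itv/= subr0.
have UD : \bigcup_l D l = setT.
  apply/seteqP; split => // w _; exists (Num.truncn (normc w)) => //=.
  exact/ltW/truncnS_gt.
have ndD : {homo D : n m / (n <= m)%N >-> (n <= m)%O}.
  move=> n m nm; apply/subsetPset => w /= h; apply: (le_trans h).
  by rewrite ler_nat.
have [l hl] : exists l, 1 - e / (4 * (M + 1)) < fine (mu (D l)).
  have mU : measurable (\bigcup_l D l) by exact: bigcup_measurable.
  have lim := @nondecreasing_cvg_mu _ _ _ mu D mD mU ndD.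
  have e1 : 0 < e / (4 * (M + 1)) by rewrite divr_gt0.
  have fl : (fun l => fine (mu (D l))) @ \oo --> (1 : R).
    apply: fine_cvg; move: lim; rewrite UD [X in _ --> X](_ : _ = 1%E)//.
    exact: (@probability_setT _ _ _ mu).
  move/cvgrPdist_lt/(_ _ e1): fl => [l _ /(_ l (leqnn l))] /=.
  by rewrite ltr_distlC => /andP[h _]; exists l.
(* A bump of the family centred at 0, equal to 1 on a disc that carries nearly all of [mu]. *)
pose chi := log_bump (2 * lattice_scale l 0) (lattice_point (lattice_scale l 0) 0 0 0).
have s0 : 0 < 2 * lattice_scale l 0 by rewrite mulr_gt0 ?lattice_scale_gt0.
have bchi : bounded_continuous chi by exact: bounded_continuous_log_bump.
have chi01 w : 0 <= chi w <= 1 by exact: log_bump_itv.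
have center0 : lattice_point (lattice_scale l 0) 0 0 0 = 0.
  by rewrite /lattice_point subrr mulr0.
have scaleE : lattice_scale l 0 = l.+1%:R by rewrite /lattice_scale divr1.
have chi_ge w : \1_(D l) w <= chi w.
  rewrite indicE; case: (boolP (w \in D l)) => [/set_mem wD|_]; last by have /andP[] := chi01 w.
  rewrite /chi log_bump_eq1// center0 subr0 scaleE; apply: (le_trans wD).
  by rewrite ler_peMl// ler1n.
have int_chi : 1 - e / (4 * (M + 1)) < \int[mu]_w chi w.
  apply: (lt_le_trans hl); rewrite -(Rintegral_indic mu (mD l)).
  apply: le_Rintegral => //; last exact: bounded_continuous_integrable.
  apply: (@bounded_integrable _ _ _ _ _ 1); first by apply: measurable_indic; exact: mD.
  by move=> x; rewrite indicE normr_nat lern1 leq_b1.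
pose g1 w := g w * chi w.
have bg1 : bounded_continuous g1 by exact: bounded_continuousM.
have cvg1 : (fun n => discrepancy (z n) g1) @ \oo --> (0 : R).
  apply: (@compactly_supported_cvg _ (2 * (2 * lattice_scale l 0))) => // w wr.
  by rewrite /g1 /chi log_bump_eq0 ?mulr0// center0 subr0 ltW.
have e40 : 0 < e / 4 by rewrite divr_gt0.
have e41 : 0 < e / (4 * (M + 1)) by rewrite divr_gt0.
have cvgchi := bumps l 0 0 0 0.
move/cvgrPdist_lt/(_ _ e40): cvg1; move/cvgrPdist_lt/(_ _ e41): cvgchi.
move: z_gt0; apply: filterS3 => n zn; rewrite !sub0r !normrN -/chi => hchi hg1.
pose g2 w := g w + (-1) * g1 w.
have bg2 : bounded_continuous g2.
  apply: bounded_continuousD => //.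
  by apply: bounded_continuousM => //; exact: bounded_continuous_cst.
have -> : discrepancy (z n) g = discrepancy (z n) g1 + discrepancy (z n) g2.
  rewrite -discrepancyD//; congr discrepancy; apply/funext => w /=.
  by rewrite /g2 mulN1r addrCA subrr addr0.
have zR : 0 < (size (z n))%:R :> R by rewrite ltr0n.
pose v w := 1 + (-1) * chi w.
have bv : bounded_continuous v.
  apply: bounded_continuousD; first exact: bounded_continuous_cst.
  by apply: bounded_continuousM => //; exact: bounded_continuous_cst.
have v0 w : 0 <= v w by have /andP[? ?] := chi01 w; rewrite /v; lra.
have g2v w : `|g2 w| <= M * v w.
  have -> : g2 w = g w * v w by rewrite /g2 /v /g1; ring.
  by rewrite normrM (ger0_norm (v0 w)) ler_wpM2r.
have int_one : \int[mu]_w (1 : R) = 1.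
  rewrite Rintegral_cst// mul1r [X in fine X](_ : _ = 1%E)//.
  exact: (@probability_setT _ _ _ mu).
have intv : \int[mu]_w v w = 1 - \int[mu]_w chi w.
  rewrite /v RintegralD//; last 2 first.
  - exact: (bounded_continuous_integrable (bounded_continuous_cst 1)).
  - apply: bounded_continuous_integrable; apply: bounded_continuousM => //.
    exact: bounded_continuous_cst.
  by rewrite int_one RintegralZl ?mulN1r//; exact: bounded_continuous_integrable.
have meanv : mean (z n) v = 1 - mean (z n) chi.
  rewrite /mean /v big_split/= -mulr_sumr mulrDl mulN1r mulNr.
  by rewrite big_const_seq count_predT iter_addr addr0 divff// gt_eqF.
have mean_g2 : `|mean (z n) g2| <= M * mean (z n) v.
  rewrite /mean normrM normfV (gtr0_norm zR) mulrA ler_pM2r ?invr_gt0//.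
  by apply: (le_trans (ler_norm_sum _ _ _)); rewrite mulr_sumr; exact: ler_sum.
have int_g2 : `|\int[mu]_w g2 w| <= M * \int[mu]_w v w.
  rewrite -RintegralZl//; last exact: bounded_continuous_integrable.
  apply: (le_trans (le_normr_Rintegral _ _)) => //; first exact: bounded_continuous_integrable.
  apply: le_Rintegral => //.
  - have [cg2 [M2 g2M]] := bg2; apply: (@bounded_integrable _ _ _ _ _ M2).
      by apply: measurableT_comp => //; exact: continuous_measurable_complex.
    by move=> x; rewrite normr_id.
  - apply: bounded_continuous_integrable; apply: bounded_continuousM => //.
    exact: bounded_continuous_cst.
have disc2 : `|discrepancy (z n) g2| <= M * mean (z n) v + M * \int[mu]_w v w.
  by apply: (le_trans (ler_normB _ _)); exact: lerD.
have hchi' : mean (z n) v <= \int[mu]_w v w + e / (4 * (M + 1)).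
  rewrite meanv intv; move: hchi; rewrite /discrepancy ltr_norml => /andP[? ?]; lra.
have vI : \int[mu]_w v w < e / (4 * (M + 1)) by rewrite intv; lra.
have mv : M * mean (z n) v <= M * (2 * (e / (4 * (M + 1)))).
  by rewrite ler_wpM2l//; lra.
have mi : M * \int[mu]_w v w <= M * (e / (4 * (M + 1))) by rewrite ler_wpM2l// ltW.
have Me : M * (e / (4 * (M + 1))) <= e / 4.
  rewrite mulrA ler_pdivrMr// [leRHS](_ : _ = e * (M + 1)); last by field.
  by rewrite mulrDr mulr1 mulrC lerDl ltW.
apply: (le_lt_trans (ler_normD _ _)); lra.
Qed.

End discrepancy.

(** * Empirical measures and the theorem *)

Section empirical.
Context {R : realType}.

Lemma ge0_integral_empirical (z : seq R[i]) (f : R[i] -> R) :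
  measurable_fun setT f -> (forall x, 0 <= f x) ->
  (\int[empirical_measure z]_x (f x)%:E = (mean z f)%:E)%E.
Proof.
move=> mf f0; have mEf : measurable_fun setT (EFin \o f) by exact/measurable_EFinP.
rewrite ge0_integral_mscale//; last by move=> x _; rewrite lee_fin.
rewrite ge0_integral_measure_sum//; last by move=> x _; rewrite lee_fin.
under eq_bigr do rewrite integral_dirac// diracT mul1e.
rewrite sumEFin -EFinM /mean mulrC; congr (_ / _)%:E.
by rewrite (big_nth 0) big_mkord.
Qed.

(** Positive and negative parts are treated separately, because the integral against a sum of
    measures is available for nonnegative functions. *)
Lemma Rintegral_empirical (z : seq R[i]) (f : R[i] -> R) : measurable_fun setT f ->
  \int[empirical_measure z]_x f x = mean z f.
Proof.
move=> mf; rewrite /Rintegral integralE.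
rewrite funerpos funerneg.
rewrite (@ge0_integral_empirical z (f^\+)); last 2 first.
- exact: measurable_funrpos.
- by move=> x; exact: funrpos_ge0.
rewrite (@ge0_integral_empirical z (f^\-)); last 2 first.
- exact: measurable_funrneg.
- by move=> x; exact: funrneg_ge0.
rewrite -EFinB /= /mean -mulrBl -sumrB; congr (_ / _); apply: eq_bigr => x _.
exact: (congr1 (fun h => h x) (funrposBneg f)).
Qed.

End empirical.

Section mean_transfer.
Context {R : realType}.

(** The two means have different denominators; for a function with values between 0 and 1
    this costs at most [m / n]. *)
Lemma mean_transfer (z z0 : nat -> seq R[i]) (m : nat -> nat) (f : R[i] -> R) (l : R) :
  (forall n, (2 <= n)%N -> (m n < n)%N /\ size (z n) = (n - m n)%N) ->
  (forall n, size (z0 n) = n) ->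
  (forall x, 0 <= f x <= 1) ->
  (fun n => (m n)%:R / n%:R : R) @ \oo --> (0 : R) ->
  (fun n => (\sum_(x <- z n) f x - \sum_(x <- z0 n) f x) / n%:R) @ \oo --> (0 : R) ->
  (fun n => mean (z0 n) f) @ \oo --> l ->
  (fun n => mean (z n) f - l) @ \oo --> (0 : R).
Proof.
move=> szz sz0 f01 mn diff lln; apply/cvgrPdist_lt => e e0.
have e30 : 0 < e / 4 by rewrite divr_gt0.
move/cvgrPdist_lt/(_ _ e30): mn; move/cvgrPdist_lt/(_ _ e30): diff.
move/cvgrPdist_lt/(_ _ e30): lln => [N1 _ h1] [N2 _ h2] [N3 _ h3].
exists (maxn 2 (maxn N1 (maxn N2 N3))) => // n /= Nn.
have n2 : (2 <= n)%N by lia.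
have {}h1 := h1 n (ltac:(rewrite /=; lia)).
have {}h2 := h2 n (ltac:(rewrite /=; lia)).
have {}h3 := h3 n (ltac:(rewrite /=; lia)).
have [mn sz] := szz n n2.
have nR : 0 < n%:R :> R by rewrite ltr0n; lia.
have zR : 0 < (n - m n)%:R :> R by rewrite ltr0n subn_gt0.
rewrite /= !sub0r !normrN in h1 h2 h3 *.
have S0 : 0 <= mean (z n) f.
  by rewrite divr_ge0// sumr_ge0// => x _; have /andP[] := f01 x.
have S1 : mean (z n) f <= 1.
  have := @mean_le R (z n) f 1; rewrite sz subn_gt0 => /(_ mn) h.
  apply: le_trans (h _); first exact: ler_norm.
  by move=> x; have /andP[? ?] := f01 x; rewrite ger0_norm.
have key : mean (z n) f - mean (z0 n) f =
    (\sum_(x <- z n) f x - \sum_(x <- z0 n) f x) / n%:R + mean (z n) f * ((m n)%:R / n%:R).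
  rewrite /mean sz sz0 natrB ?(ltnW mn)//; field.
  by rewrite gt_eqF//= -natrB ?(ltnW mn)// gt_eqF.
have h4 : 0 <= mean (z n) f * ((m n)%:R / n%:R) <= (m n)%:R / n%:R.
  have q0 : 0 <= (m n)%:R / n%:R :> R by rewrite divr_ge0.
  by apply/andP; split; [exact: mulr_ge0|exact: ler_piMl].
move: h1 h2 h3; rewrite !ltr_norml => /andP[? ?] /andP[? ?] /andP[? ?].
move/andP: h4 => [? ?]; apply/andP; split; lra.
Qed.

End mean_transfer.

Theorem theorem3 (R : realType) (d : measure_display) (Omega : measurableType d)
    (P : probability Omega R) (beta : R) (mu : probability R[i] R)
    (m : nat -> nat)
    (gam : forall n j : nat, {RV P >-> (n.+1 - j)%N.-tuple R})
    (Z : forall n j : nat, {RV P >-> (n - j)%N.-tuple R[i]}) :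
  0 < beta ->
  (exists c : R, 0 < c /\
    (ereal_sup [set (r `^ c)%:E * mu [set z : R[i] | (r%:C < `|z|)%R] |
        r in [set r : R | (1 <= r)%R]] < +oo)%E) ->
  (forall n, (2 <= n)%N -> (1 <= m n <= n - 1)%N) ->
  (forall n, (2 <= n)%N ->
    mutually_independent P setT (fun (k : 'I_(n - 0)) w => tnth (Z n 0%N w) k) /\
    forall (k : 'I_(n - 0)) (A : set R[i]), measurable A ->
      P ((fun w => tnth (Z n 0%N w) k) @^-1` A) = mu A) ->
  (forall n, (2 <= n)%N ->
    mutually_independent P
      [set i : {j : nat & 'I_(n.+1 - j)} | (1 <= tag i <= m n)%N]
      (fun i w => tnth (gam n (tag i) w) (tagged i)) /\
    forall j, (1 <= j <= m n)%N -> forall k : 'I_(n.+1 - j),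
      has_gamma_law P (beta / 2) (fun w => tnth (gam n j w) k)) ->
  (forall n, (2 <= n)%N ->
    independent_families P
      [set i : {j : nat & 'I_(n.+1 - j)} | (1 <= tag i <= m n)%N]
      [set: 'I_(n - 0)]
      (fun i w => tnth (gam n (tag i) w) (tagged i))
      (fun k w => tnth (Z n 0%N w) k)) ->
  (forall n j, (2 <= n)%N -> (j < m n)%N ->
    {ae P, forall w, zeros_with_multiplicity
      (randomized_derivative (Z n j w) (gam n j.+1 w)) (Z n j.+1 w)}) ->
  (forall n j, (2 <= n)%N -> (j < m n)%N ->
    exists2 label : (n - j)%N.-tuple R[i] * (n - j)%N.-tuple R ->
        (n - j.+1)%N.-tuple R[i],
      measurable_fun setT label &
      {ae P, forall w, Z n j.+1 w = label (Z n j w, gam n j.+1 w)}) ->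
  (fun n => (m n)%:R / (n%:R / ln n%:R) : R) @ \oo --> (0 : R) ->
  {ae P, forall w,
    weakly_converges (fun n => empirical_measure (Z n (m n) w)) mu}.
Proof.
move=> beta0 [c [c0 tail]] m_bounds Z0_law gam_law gam_indep zerosZ labels m_small.
have m_lt n : (2 <= n)%N -> (m n < n)%N by move=> n2; have := m_bounds n n2; lia.
have m_gt0 n : (2 <= n)%N -> (0 < m n)%N by move=> /m_bounds /andP[].
have b0 : 0 < beta / 2 by rewrite divr_gt0.
have mZ0 n : measurable_fun setT (Z n 0%N) by exact: measurable_funPT.
have mZ0k n (k : 'I_(n - 0)) : measurable_fun setT (fun w => tnth (Z n 0%N w) k).
  by apply: (measurableT_comp (measurable_tnth _)); exact: mZ0.
have [C [C0 Zb]] := initial_zeros_bounded c0 tail mZ0 (fun n n2 => (Z0_law n n2).2).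
pose scale (v : nat * nat * (nat * nat * nat)) : R := 2 * lattice_scale v.1.1 v.1.2.
pose center (v : nat * nat * (nat * nat * nat)) : R[i] :=
  lattice_point (lattice_scale v.1.1 v.1.2) v.2.1.1 v.2.1.2 v.2.2.
have scale0 v : 0 < scale v by rewrite mulr_gt0 ?lattice_scale_gt0.
have mn0 : (fun n => (m n)%:R / n%:R : R) @ \oo --> (0 : R).
  apply/cvgrPdist_lt => e e0.
  have e1 : 0 < e * ln 2 by rewrite mulr_gt0 ?ln2_gt0.
  move/cvgrPdist_lt/(_ _ e1): m_small => [N _ hN].
  exists (maxn 2 N) => // n /= Nn; have {}hN := hN n (ltac:(rewrite /=; lia)).
  have nR : 0 < n%:R :> R by rewrite ltr0n; lia.
  have ln2n : ln 2 <= ln n%:R :> R by rewrite ler_ln_le// ler_nat; lia.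
  have L0 : 0 < ln n%:R :> R by apply: lt_le_trans ln2n; exact: ln2_gt0.
  move: hN; rewrite /= !sub0r !normrN !ger0_norm ?divr_ge0// ?divr_ge0 ?ltW//.
  rewrite invf_div mulrA mulrAC => h.
  rewrite -(ltr_pM2r (@ln2_gt0 R)); apply: le_lt_trans h.
  by rewrite ler_wpM2l// divr_ge0.
(* Almost sure convergence holds for countably many bumps at once. *)
have bump_all : {ae P, forall w, forall k : nat, forall v, choice.unpickle k = Some v ->
    (fun n => discrepancy mu (Z n (m n) w) (log_bump (scale v) (center v))) @ \oo --> (0 : R)}.
  apply: ae_foralln => k.
  case E : (@choice.unpickle (nat * nat * (nat * nat * nat))%type k) => [v|]; last by apply: aeW.
  set f := log_bump (scale v) (center v).
  have f01 x : 0 <= f x <= 1 by exact: log_bump_itv.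
  have mf : measurable_fun setT f.
    by apply: continuous_measurable_complex; exact: continuous_log_bump.
  have s2 : 0 < 2 * scale v by rewrite mulr_gt0.
  have near1 := @log_max_means_close R d Omega P m gam Z m_lt zerosZ (beta / 2) b0 gam_law
    gam_indep labels m_gt0 m_small C (center v) _ C0 (scale0 v) Zb.
  have near2 := @log_max_means_close R d Omega P m gam Z m_lt zerosZ (beta / 2) b0 gam_law
    gam_indep labels m_gt0 m_small C (center v) _ C0 s2 Zb.
  have lln := @lln_bounded R _ _ Omega _ P mu (fun n => (n - 0)%N) 2
    (fun n k w => tnth (Z n 0%N w) k) _ mZ0k (fun n n2 => (Z0_law n n2).1)
    (fun n n2 => (Z0_law n n2).2) f mf f01.
  have {}lln := lln (fun n => ltac:(rewrite subn0; exact: leqnn)).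
  move: near1 near2 lln; apply: filterS3 => w near1 near2 lln v' [<-].
  apply: (@mean_transfer R _ (fun n => Z n 0%N w) m f) => //.
  - by move=> n n2; split; [exact: m_lt|rewrite size_tuple].
  - by move=> n; rewrite size_tuple subn0.
  - have -> : (fun n => (\sum_(x <- Z n (m n) w) f x - \sum_(x <- Z n 0%N w) f x) / n%:R) =
      (fun n => ((\sum_(k < n - m n) log_max (2 * scale v) (tnth (Z n (m n) w) k - center v) -
        \sum_(k < n - 0) log_max (2 * scale v) (tnth (Z n 0%N w) k - center v)) / n%:R -
        (\sum_(k < n - m n) log_max (scale v) (tnth (Z n (m n) w) k - center v) -
        \sum_(k < n - 0) log_max (scale v) (tnth (Z n 0%N w) k - center v)) / n%:R) / ln 2).
      apply/funext => n; rewrite !big_tuple /f /log_bump -!mulr_suml !sumrB.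
      by ring.
    rewrite -[X in _ --> X](mul0r (ln 2)^-1); apply: cvgM; last exact: cvg_cst.
    by rewrite -[X in _ --> X](subrr 0); apply: cvgB.
  - apply: cvg_trans lln; apply: near_eq_cvg; apply: nearW => n.
    by rewrite /mean big_tuple size_tuple.
move: bump_all; apply: filterS => w bumps f cf [M fM].
have bf : bounded_continuous f by split=> //; exists M.
have sz : \forall n \near \oo, (0 < size (Z n (m n) w))%N.
  by exists 2 => // n /= n2; rewrite size_tuple subn_gt0 m_lt.
have := @bounded_continuous_cvg R mu (fun n => Z n (m n) w) sz _ f bf.
have bumps' l j B p q : (fun n => discrepancy mu (Z n (m n) w)
    (log_bump (2 * lattice_scale l j) (lattice_point (lattice_scale l j) B p q))) @ \oo --> (0 : R).
  have [k kE] : exists k : nat, choice.unpickle k = Some (l, j, (B, p, q)).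
    by exists (choice.pickle (l, j, (B, p, q))); exact: choice.pickleK.
  exact: (bumps k _ kE).
move=> /(_ bumps') disc.
apply/cvgrPdist_lt => e e0; move/cvgrPdist_lt/(_ _ e0): disc; apply: filterS => n.
rewrite sub0r normrN distrC /discrepancy Rintegral_empirical//.
exact: continuous_measurable_complex.
Qed.
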